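(* Let $K\ge 1$, and let $A$ be an $n\times n$ random matrix satisfying the dependence assumption (Dep) and the continuous-distribution assumption (Cont) with parameter $K$ (both stated in the context). Choose $M\ge 1$ such that the event $\mathcal{B}_{A,M}=\{\|A\|\le M\sqrt{n}\}$ holds with probability at least $1/2$. Let $\varepsilon\in(8/n,1/2)$ and $s>0$. Then, conditionally on $\mathcal{B}_{A,M}$, the following holds with probability at least $1-(cs)^{\varepsilon n}$: every eigenvector $v\in\mathbb{C}^n$ of $A$ satisfies $$\|v_I\|_2\ge(\varepsilon s)^6\|v\|_2\quad\text{for all } I\subset[n],\ |I|\ge\varepsilon n.$$ Here $c=c(K,M)>0$ depends only on $K$ and $M$.
   Context: $[n]=\{1,\dots,n\}$. For $v\in\mathbb{C}^n$ and $I\subset[n]$, $v_I\in\mathbb{C}^I$ is the vector of coordinates of $v$ indexed by $I$. $\|A\|$ is the operator norm with respect to the Euclidean norm $\|\cdot\|_2$. (Dep): for any $i,j$, the entry $A_{ij}$ is independent of the rest of the entries of $A$ except possibly $A_{ji}$ (that is, $A_{ij}$ is independent of the family of all entries other than $A_{ij}$ and $A_{ji}$); moreover, the real part of $A$ is random and the imaginary part of $A$ is fixed (deterministic). (Cont): the real parts of the entries of $A$ have densities bounded by the number $K\ge 1$. *)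

(* Defs.v *)
From HB Require Import structures.
From mathcomp Require Import all_boot all_order all_algebra.
From mathcomp Require Import all_classical all_reals all_analysis.
From mathcomp Require Import complex.

Set Implicit Arguments.
Unset Strict Implicit.
Unset Printing Implicit Defensive.

Import Order.TTheory GRing.Theory Num.Theory.
Import numFieldNormedType.Exports.

Local Open Scope classical_set_scope.
Local Open Scope ring_scope.
Local Open Scope complex_scope.

Definition l2norm (R : realType) (m : nat) (v : 'cV[R[i]]_m) : R :=
  Num.sqrt (\sum_i ComplexField.Normc.normc (v i 0) ^+ 2).

(* The supremum is over the closed unit ball rather than the unit sphere only
   so that the set is nonempty in every dimension. *)
Definition opnorm (R : realType) (n : nat) (A : 'M[R[i]]_n) : R :=
  sup [set l2norm (A *m v) | v in [set v : 'cV[R[i]]_n | l2norm v <= 1]].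

(* [v_I], with the index set [I] enumerated by ['I_#|I|]. *)
Definition subvec (R : realType) (n : nat) (v : 'cV[R[i]]_n) (I : {set 'I_n}) :
    'cV[R[i]]_#|I| :=
  rowsub (fun k : 'I_#|I| => enum_val k) v.

(* Right (column) eigenvectors; MathComp's [eigenspace] is about rows. *)
Definition eigenvector (R : realType) (n : nat) (A : 'M[R[i]]_n)
    (v : 'cV[R[i]]_n) : Prop :=
  v != 0 /\ exists lambda : R[i], A *m v = lambda *: v.

Section RandomMatrix.
Context (R : realType) (d : measure_display) (T : measurableType d).
Context (P : probability T R) (n : nat).
Implicit Types A : T -> 'M[R[i]]_n.

(* C is identified with R * R, whose product sigma-algebra is the Borel one. *)
Definition entry A (p : 'I_n * 'I_n) (t : T) : R * R :=
  (complex.Re (A t p.1 p.2), complex.Im (A t p.1 p.2)).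

Definition random_matrix A : Prop :=
  forall p, measurable_fun [set: T] (entry A p).

(* The sigma-algebra generated by the family of entries with index in [S]. *)
Definition entries_sigma A (S : set ('I_n * 'I_n)) : set (set T) :=
  <<s \bigcup_(p in S) preimage_set_system [set: T] (entry A p) measurable >>.

Definition independent_systems (F G : set (set T)) : Prop :=
  forall E E', F E -> G E' -> P (E `&` E') = (P E * P E')%E.

Definition Dep A : Prop :=
  (forall i j : 'I_n,
     independent_systems (entries_sigma A [set (i, j)])
       (entries_sigma A [set p | p <> (i, j) /\ p <> (j, i)])) /\
  exists B : 'M[R]_n, forall t i j, complex.Im (A t i j) = B i j.

Definition has_density (X : T -> R) (f : R -> R) : Prop :=
  [/\ measurable_fun [set: R] f,
      (forall x, 0 <= f x) &
      forall B : set R, measurable B ->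
        P (X @^-1` B) = (\int[lebesgue_measure]_(x in B) (f x)%:E)%E].

Definition Cont (K : R) A : Prop :=
  forall i j : 'I_n, exists f : R -> R,
    has_density (fun t => complex.Re (A t i j)) f /\ forall x, f x <= K.

Definition bounded_event A (M : R) : set T :=
  [set t | opnorm (A t) <= M * Num.sqrt n%:R].

Definition condprob (E B : set T) : R := fine (P (E `&` B)) / fine (P B).

End RandomMatrix.

(* Main.v *)
Require Import Defs.
From HB Require Import structures.
From mathcomp Require Import all_boot all_order all_algebra.
From mathcomp Require Import all_classical all_reals all_analysis.
From mathcomp Require Import measurable_realfun.
From mathcomp Require Import complex ring lra zify.

(* If an eigenvector [v] is small on a set [I] of [m ~ eps n] coordinates, then
   for a nearby point [mu] of a net of the disc of radius [||A||] the matrix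
   [A - mu] almost annihilates a vector [x] supported off [I].  By a union bound
   over [I] and [mu] it is enough to bound the probability of this for fixed
   [I] and [mu].  Consider the columns of [A - mu] off [I], restricted to the rows
   off [I] and to a few rows of [I].  If this block has many small singular
   values, there are many sequences of columns each of which is close to the span
   of the remaining ones; each such event only involves a column given
   independent entries, so small ball estimates for projections make their
   expected number tiny.  Otherwise [x] is close to a subspace of small dimension
   determined by the block, which has a small net, and for each [y] in the net the
   unused rows of [I], which are independent of the block, satisfy
   [|(A y)_i| <= c^5] independently with probability [O(c^2)], by a
   Littlewood-Offord estimate that only uses a bounded density. *)

Set Implicit Arguments.
Unset Strict Implicit.
Unset Printing Implicit Defensive.

Import Order.TTheory GRing.Theory Num.Theory.
Import numFieldNormedType.Exports.

Local Open Scope classical_set_scope.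
Local Open Scope ring_scope.

(** Put [w = eps * s] and [m = |I|]. The union over sets and over the net of eigenvalues costs about
    [(e n / m)^m w^-12], so the target for fixed data is [C^m w^(m + 12)]. The exponent 6 is
    [2 + 4]: singular values count as small below [w^2 sqrt n], and the net of the small singular
    directions has mesh of order [w^4]. The first choice makes one close column cost about
    [w^(m / 100)], so that a sequence of 200 of them is more than enough. The second leaves a
    squared error of order [w^7] per row; as Littlewood-Offord turns squared size [c^10] into
    probability [c^2], each row gains [w^(4/3)], and the excess over [w] pays for the net. The
    obstacle is that [A_ij] may depend on [A_ji]. A block can be refreshed only if it contains no
    two distinct transposed entries and the event does not see the transposes of the block. This is
    why the vectors are supported off [I] while the fresh rows lie in [I], and why choosing a column
    also deletes the row of the same index. Sets with fewer than 40000 elements are too small for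
    this scheme and are handled by a single close column. *)

Section LevelSets.
Context (R : realType) (d : measure_display) (T : measurableType d) (f : T -> R).
Hypothesis mf : measurable_fun [set: T] f.

Lemma measurable_sublevel (x : R) : measurable [set t | f t <= x].
Proof.
have -> : [set t | f t <= x] = f @^-1` `]-oo, x]%classic.
  by apply/seteqP; split => t; rewrite /= in_itv.
by rewrite -[X in measurable X]setTI; exact: mf.
Qed.

Lemma measurable_strict_sublevel (x : R) : measurable [set t | f t < x].
Proof.
have -> : [set t | f t < x] = f @^-1` `]-oo, x[%classic.
  by apply/seteqP; split => t; rewrite /= in_itv.
by rewrite -[X in measurable X]setTI; exact: mf.
Qed.

Lemma measurable_superlevel (x : R) : measurable [set t | x <= f t].
Proof.
have -> : [set t | x <= f t] = f @^-1` `[x, +oo[%classic.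
  by apply/seteqP; split => t; rewrite /= in_itv /= andbT.
by rewrite -[X in measurable X]setTI; exact: mf.
Qed.

End LevelSets.

Lemma expR1_ge1 (R : realType) : 1 <= expR 1 :> R.
Proof. by rewrite -[leLHS]expR0 ler_expR. Qed.

(** * Configurations of real entries: product sigma-algebra and resampling *)

Section Config.
Context (R : realType) (I : finType).

Definition coord_sets : set (set (I -> R)) :=
  \bigcup_(p in [set: I])
    preimage_set_system [set: I -> R] (fun a => a p) measurable.

(** The alias carries the product sigma-algebra, so that the law of the entries is a measure on one
    space and a resampled configuration is again a point of it. *)
Definition config := g_sigma_algebraType coord_sets.

HB.instance Definition _ := Measurable.on config.

Definition box (B : I -> set R) : set config := [set a | forall p, B p (a p)].

Definition boxes : set (set config) :=
  [set W | exists2 B, (forall p, measurable (B p)) & W = box B].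

Lemma measurable_coord p : measurable_fun [set: config] (fun a : config => a p).
Proof.
move=> _ B mB; apply: sub_sigma_algebra; exists p => //.
by exists B.
Qed.

Lemma measurable_config d (T : measurableType d) (h : T -> config) :
  (forall p, measurable_fun [set: T] (fun t => h t p)) ->
  measurable_fun [set: T] h.
Proof.
move=> mh; apply: (@measurability _ _ T config setT h coord_sets) => //.
move=> _ [_ [p _ [B mB <-]] <-]; rewrite setTI.
rewrite -[X in measurable X]setTI.
by have := mh p measurableT B mB; rewrite !setTI.
Qed.

Lemma measurable_box (B : I -> set R) :
  (forall p, measurable (B p)) -> measurable (box B).
Proof.
move=> mB.
have -> : box B = \big[setI/setT]_(p : I) ((fun a : config => a p) @^-1` B p).
  rewrite -bigcap_seq; apply/seteqP; split => [a Ba p _|a Ba p]; first exact: Ba.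
  by apply: Ba; rewrite /= mem_index_enum.
apply: bigsetI_measurable => p _.
by rewrite -[X in measurable X]setTI; apply: measurable_coord.
Qed.

Lemma boxes_generate : @measurable _ config = <<s boxes >>.
Proof.
apply/seteqP; split; last first.
  apply: smallest_sub; first exact: sigma_algebra_measurable.
  by move=> _ [B mB ->]; apply: measurable_box.
apply: smallest_sub; first exact: smallest_sigma_algebra.
move=> _ [p _ [B mB <-]]; apply: sub_sigma_algebra.
exists (fun q => if q == p then B else setT).
  by move=> q; case: ifP.
rewrite setTI; apply/seteqP; split => [a /= Ba q|a /(_ p)].
  by case: eqP => // ->.
by rewrite eqxx.
Qed.

Lemma boxes_setI : setI_closed boxes.
Proof.
move=> _ _ [B mB ->] [C mC ->].
exists (fun p => B p `&` C p); first by move=> p; exact: measurableI.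
apply/seteqP; split => [a [Ba Ca] p|a BCa]; first by split.
by split=> p; have [] := BCa p.
Qed.

(** Dynkin's theorem: the boxes form a generating pi-system that contains the whole space. *)
Lemma config_measure_unique (m1 m2 : {measure set config -> \bar R}) :
  (m1 setT < +oo)%E -> (forall B, (forall p, measurable (B p)) -> m1 (box B) = m2 (box B)) ->
  forall W, measurable W -> m1 W = m2 W.
Proof.
move=> m1T m12; have boxT : box (fun=> setT) = setT by apply/seteqP; split.
apply: (measure_unique boxes (fun=> setT)) => //.
- exact: boxes_generate.
- exact: boxes_setI.
- by move=> i; exists (fun=> setT).
- by apply/seteqP; split => // a _; exists 0%N.
- by move=> _ [B mB ->]; apply: m12.
Qed.

(** [b] is meant to be an independent copy of the entries, from which those in [Q] are refreshed,
    while [a] holds the entries that are kept. *)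
Definition mix (Q : {set I}) (a b : config) : config :=
  fun p => if p \in Q then b p else a p.

Definition depends_on (V : Type) (Z : {set I}) (g : config -> V) :=
  forall a b : config, (forall p, p \in Z -> a p = b p) -> g a = g b.

Lemma depends_indic (Z : {set I}) (F : set config) :
  depends_on Z F -> depends_on Z (\1_F : config -> R).
Proof.
move=> dF a b /dF ab; rewrite !indicE; congr (nat_of_bool _)%:R.
by apply/idP/idP; rewrite !inE ab.
Qed.

End Config.

(** * Independence of blocks of entries *)

Section Decoupling.
Context (R : realType) (I : finType) (tr : I -> I).
Context (d : measure_display) (T : measurableType d) (P : probability T R).
Variable X : T -> config R I.
Hypothesis mX : forall p, measurable_fun [set: T] (fun t => X t p).

Definition coord_sigma (S : set I) : set (set T) :=
  <<s \bigcup_(p in S)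
        preimage_set_system [set: T] (fun t => X t p) measurable >>.

Hypothesis indepX : forall p B E, measurable B ->
  coord_sigma [set q | q <> p /\ q <> tr p] E ->
  P ((fun t => X t p) @^-1` B `&` E) = (P ((fun t => X t p) @^-1` B) * P E)%E.

Lemma coord_sigma_sub S S' : S `<=` S' -> coord_sigma S `<=` coord_sigma S'.
Proof.
move=> SS'; apply: smallest_sub; first exact: smallest_sigma_algebra.
by move=> E [p Sp Ep]; apply: sub_sigma_algebra; exists p => //; exact: SS'.
Qed.

Lemma coord_sigma_measurable S E : coord_sigma S E -> measurable E.
Proof.
move: E; apply: smallest_sub; first exact: sigma_algebra_measurable.
by move=> _ [p _ [B mB <-]]; exact: mX.
Qed.

Lemma coord_sigma_box (S : pred I) (B : I -> set R) :
  (forall p, measurable (B p)) ->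
  coord_sigma [set p | S p] [set t | forall p, S p -> B p (X t p)].
Proof.
move=> mB; pose U := g_sigma_algebraType (\bigcup_(p in [set p | S p])
        preimage_set_system [set: T] (fun t => X t p) measurable).
have -> : [set t | forall p, S p -> B p (X t p)] =
    \big[setI/setT]_(p | S p) ((fun t => X t p) @^-1` B p).
  rewrite -bigcap_seq_cond; apply/seteqP; split => [t Bt p /=|t Bt p Sp].
    by case/andP => _ /Bt.
  by apply: Bt; rewrite /= mem_index_enum.
suff : @measurable _ U (\big[setI/setT]_(p | S p) ((fun t => X t p) @^-1` B p)) by [].
apply: bigsetI_measurable => p Sp; apply: sub_sigma_algebra.
by exists p => //; exists (B p); rewrite ?setTI.
Qed.

Lemma coord_sigmaI S E F : coord_sigma S E -> coord_sigma S F ->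
  coord_sigma S (E `&` F).
Proof.
move=> SE SF; pose U := g_sigma_algebraType (\bigcup_(p in S)
        preimage_set_system [set: T] (fun t => X t p) measurable).
by have : @measurable _ U (E `&` F) by apply: measurableI.
Qed.

(** The independence of single entries is iterated: once [p] is peeled off, what remains involves
    neither [p] nor [tr p], because [Q] contains no two distinct transposed entries and [D] avoids
    [Q] and its transposes. *)
Lemma indep_seq (Q : seq I) (B : I -> set R) (D : set T) :
  uniq Q -> (forall p, measurable (B p)) ->
  {in Q &, forall p q, q = tr p -> q = p} ->
  coord_sigma [set q | q \notin Q /\ forall p, p \in Q -> q <> tr p] D ->
  P ([set t | forall p, p \in Q -> B p (X t p)] `&` D) =
  ((\prod_(p <- Q) P ((fun t => X t p) @^-1` B p)) * P D)%E.
Proof.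
elim: Q => [|p Q IH] /= in D *.
  move=> _ _ _ _; rewrite big_nil mul1e; congr (P _).
  by apply/seteqP; split => [t []|t].
move=> /andP[pQ uQ] mB Qtr DQ.
have -> : [set t | forall q, q \in p :: Q -> B q (X t q)] `&` D =
  (fun t => X t p) @^-1` B p `&`
     ([set t | forall q, q \in Q -> B q (X t q)] `&` D).
  apply/seteqP; split => [t [Bt Dt]|t [Bp [BQ Dt]]].
    split; first by apply: Bt; rewrite mem_head.
    by split => // q qQ; apply: Bt; rewrite inE qQ orbT.
  by split => // q; rewrite inE => /orP[/eqP ->//|]; exact: BQ.
rewrite indepX//; last first.
  apply: coord_sigmaI; last first.
    apply: coord_sigma_sub DQ => q /= [] qpQ qtr; split.
      by move=> qp; rewrite qp mem_head in qpQ.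
    by apply: qtr; rewrite mem_head.
  apply: coord_sigma_sub (coord_sigma_box (S := mem Q) mB) => q /= qQ; split.
    by move=> qp; rewrite -qp qQ in pQ.
  move=> qtr; have qp : q = p by apply: Qtr; rewrite ?inE ?eqxx ?qQ ?orbT.
  by rewrite -qp qQ in pQ.
rewrite IH//; last 2 first.
  by move=> q r qQ rQ; apply: Qtr; rewrite inE ?qQ ?rQ orbT.
  apply: coord_sigma_sub DQ => q /= []; rewrite inE negb_or => /andP[_ ->] qtr.
  by split=> // r rQ; apply: qtr; rewrite inE rQ orbT.
by rewrite big_cons muleA.
Qed.

(* [Q] contains no two distinct mutually dependent entries. *)
Definition free_set (Q : {set I}) := {in Q &, forall p q, q = tr p -> q = p}.

(** With the whole space for [D], [indep_seq] identifies the product of the single probabilities as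
    the probability of the block event. *)
Lemma indep_block (Q : {set I}) (B : I -> set R) (D : set T) :
  (forall p, measurable (B p)) -> free_set Q ->
  coord_sigma [set q | q \notin Q /\ forall p, p \in Q -> q <> tr p] D ->
  P ([set t | forall p, p \in Q -> B p (X t p)] `&` D) =
  (P [set t | forall p, p \in Q -> B p (X t p)] * P D)%E.
Proof.
move=> mB Qtr DQ.
have eQ (p : I) : (p \in enum Q) = (p \in Q) by rewrite mem_enum.
have eB : [set t | forall p, p \in Q -> B p (X t p)] =
   [set t | forall p, p \in enum Q -> B p (X t p)].
  by apply/seteqP; split => t /= h p; [rewrite eQ|rewrite -eQ]; exact: h.
have h E : coord_sigma [set q | q \notin Q /\ forall p, p \in Q -> q <> tr p] E ->
    P ([set t | forall p, p \in Q -> B p (X t p)] `&` E) =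
    ((\prod_(p <- enum Q) P ((fun t => X t p) @^-1` B p)) * P E)%E.
  move=> EQ; rewrite eB; apply: indep_seq => //; first exact: enum_uniq.
    by move=> p q; rewrite !eQ; exact: Qtr.
  apply: coord_sigma_sub EQ => q /= [qQ qtr]; rewrite eQ; split => // p.
  by rewrite eQ; exact: qtr.
rewrite h//; congr (_ * _)%E.
rewrite -[in RHS](setIT [set t | _]) h ?probability_setT ?mule1//.
pose U := g_sigma_algebraType (\bigcup_(p in [set q | q \notin Q /\ forall p, p \in Q -> q <> tr p])
        preimage_set_system [set: T] (fun t => X t p) measurable).
by have : @measurable _ U setT by exact: measurableT.
Qed.

End Decoupling.

(** * Resampling a block of entries under the integral *)

Section DecouplingIntegral.
Context (R : realType) (I : finType) (tr : I -> I).
Context (d : measure_display) (T : measurableType d) (P : probability T R).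
Variable X : T -> config R I.
Hypothesis mX : forall p, measurable_fun [set: T] (fun t => X t p).
Hypothesis indepX : forall p B E, measurable B ->
  coord_sigma X [set q | q <> p /\ q <> tr p] E ->
  P ((fun t => X t p) @^-1` B `&` E) = (P ((fun t => X t p) @^-1` B) * P E)%E.

Lemma measurable_X : measurable_fun [set: T] X.
Proof. exact: measurable_config. Qed.

Lemma measurable_mix d' (T' : measurableType d') (Q : {set I})
    (a b : T' -> config R I) :
  measurable_fun [set: T'] a -> measurable_fun [set: T'] b ->
  measurable_fun [set: T'] (fun t => mix Q (a t) (b t)).
Proof.
move=> ma mb; apply: measurable_config => p; rewrite /mix.
by case: (p \in Q); apply: (measurableT_comp (@measurable_coord R I p)).
Qed.

Lemma measurable_mixr (Q : {set I}) (a : config R I) :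
  measurable_fun [set: config R I] (mix Q a).
Proof.
apply: (@measurable_mix _ _ Q (fun=> a) id); last exact: measurable_id.
exact: (measurable_cst (a : config R I)).
Qed.

Lemma measurable_mixX (Q : {set I}) (a : config R I) :
  measurable_fun [set: T] (fun t => mix Q a (X t)).
Proof. by apply: (measurableT_comp (measurable_mixr _ _)); exact: measurable_X. Qed.

Lemma measurable_mixXX (Q : {set I}) :
  measurable_fun [set: T * T] (fun z => mix Q (X z.1) (X z.2)).
Proof.
by apply: measurable_mix; apply: (measurableT_comp measurable_X);
  [exact: measurable_fst|exact: measurable_snd].
Qed.

Definition zero_config : config R I := fun=> 0.

(* The transposes of the resampled entries, which a function of the matrix must
   not see for the resampling to be harmless, are frozen to [0]. *)
Let frozen (Q : {set I}) : {set I} := (tr @: Q)%SET :\: Q.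
Let freeze (Q : {set I}) (a : config R I) := mix (frozen Q) a zero_config.

(** It is enough to compare the two laws on boxes. There the event splits into a part [E] on [Q] and
    a part [D] away from [Q] and its transposes; [indep_block] factors the left side, and the right
    side is the measure of a rectangle. *)
Lemma decoupling_law (Q : {set I}) : free_set tr Q -> forall W, measurable W ->
  pushforward P (fun t => freeze Q (X t)) W =
  pushforward (P \x P)%E
    (fun z => freeze Q (mix Q (X z.1) (X z.2))) W.
Proof.
move=> Qfree.
have m1 : measurable_fun [set: T] (fun t => freeze Q (X t)).
  apply: (measurable_mix (frozen Q) measurable_X).
  exact: (measurable_cst zero_config).
have m2 : measurable_fun [set: T * T] (fun z => freeze Q (mix Q (X z.1) (X z.2))).
  apply: (measurable_mix (frozen Q) (measurable_mixXX Q)).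
  exact: (measurable_cst zero_config).
pose n1 := measure_function_pushforward__canonical__measure_function_Measure P m1.
pose n2 := measure_function_pushforward__canonical__measure_function_Measure
  (P \x P)%E m2.
apply: (config_measure_unique (m1 := n1) (m2 := n2)).
  by rewrite /n1 /= /pushforward preimage_setT probability_setT ltry.
move=> B mB; rewrite /n1 /n2 /= /pushforward.
(* Frozen coordinates are always 0, so a box with a frozen side that misses 0 has empty preimage
   under both maps. *)
have [B0|] := pselect (forall p, p \in frozen Q -> B p 0); last first.
  move=> /existsNP[p /not_implyP[pQ Bp]].
  have -> : (fun t => freeze Q (X t)) @^-1` box B = set0.
    by apply/seteqP; split => // t /(_ p); rewrite /freeze /mix pQ.
  have -> : (fun z => freeze Q (mix Q (X z.1) (X z.2))) @^-1` box B = set0.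
    by apply/seteqP; split => // t /(_ p); rewrite /freeze /mix pQ.
  by rewrite !measure0.
pose D := [set t | forall p, (p \notin Q) && (p \notin frozen Q) -> B p (X t p)].
pose E := [set t | forall p, p \in Q -> B p (X t p)].
have DQ : coord_sigma X [set q | q \notin Q /\ forall p, p \in Q -> q <> tr p] D.
  apply: coord_sigma_sub (coord_sigma_box (S := fun p => (p \notin Q) && (p \notin frozen Q)) mB) => q /= /andP[qQ].
  rewrite inE qQ /= => /imsetP qtr; split => // p pQ qp; apply: qtr.
  by exists p.
have QE : coord_sigma X [set q | q \in Q] E.
  exact: coord_sigma_box.
have -> : (fun t => freeze Q (X t)) @^-1` box B = E `&` D.
  apply/seteqP; split => [t Bt|t [Et Dt] p].
    split => p pQ; have := Bt p; rewrite /freeze /mix.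
      by rewrite inE pQ.
    by case/andP: pQ => pQ /negPf ->.
  rewrite /freeze /mix; case: ifPn => [/B0//|pF].
  by have [pQ|pQ] := boolP (p \in Q); [exact: Et|apply: Dt; rewrite pQ].
rewrite (indep_block indepX)//.
have -> : (fun z => freeze Q (mix Q (X z.1) (X z.2))) @^-1` box B = D `*` E.
  apply/seteqP; split => [[t t'] Bt|[t t'] [/= Dt Et] p].
    split => p /= pQ; have := Bt p; rewrite /freeze /mix /=.
      by case/andP: pQ => /negPf -> /negPf ->.
    by rewrite inE pQ.
  rewrite /freeze /mix /=; case: ifPn => [/B0//|pF].
  by case: ifPn => pQ; [exact: Et|apply: Dt; rewrite pQ].
rewrite product_measure1E//; last 2 first.
- exact: coord_sigma_measurable DQ.
- exact: coord_sigma_measurable QE.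
by rewrite muleC.
Qed.

(** [f] sees the transpose of a refreshed entry only if that transpose is refreshed too, so freezing
    does not change [f]; then [decoupling_law] equates the integrals and Tonelli separates the kept
    entries from the fresh ones. *)
Lemma decoupling (Q Z : {set I}) (f : config R I -> \bar R) :
  free_set tr Q -> (forall p, p \in Q -> tr p \in Z -> tr p \in Q) ->
  measurable_fun [set: config R I] f -> (forall a, 0 <= f a)%E -> depends_on Z f ->
  (\int[P]_t f (X t) = \int[P]_t' \int[P]_t f (mix Q (X t') (X t)))%E.
Proof.
move=> Qfree QZ mf f0 fZ.
have m1 : measurable_fun [set: T] (fun t => freeze Q (X t)).
  apply: (measurable_mix (frozen Q) measurable_X).
  exact: (measurable_cst zero_config).
have m2 : measurable_fun [set: T * T] (fun z => freeze Q (mix Q (X z.1) (X z.2))).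
  apply: (measurable_mix (frozen Q) (measurable_mixXX Q)).
  exact: (measurable_cst zero_config).
have ff a : f a = f (freeze Q a).
  apply: fZ => p pZ; rewrite /freeze /mix; case: ifPn => //.
  rewrite inE => /andP[pQ /imsetP[q qQ pq]]; move: pQ.
  by rewrite pq QZ// -pq.
transitivity (\int[P]_t f (freeze Q (X t)))%E.
  by apply: eq_integral => t _; rewrite -ff.
have := @ge0_integral_pushforward _ _ _ _ R _ m1 P setT f measurableT mf (fun y _ => f0 y).
rewrite preimage_setT => <-.
transitivity (\int[P \x P]_z f (freeze Q (mix Q (X z.1) (X z.2))))%E.
  have := @ge0_integral_pushforward _ _ _ _ R _ m2 (P \x P)%E setT f measurableT mf (fun y _ => f0 y).
  rewrite preimage_setT => <-.
  apply: eq_measure_integral => W mW _; exact: decoupling_law.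
rewrite fubini_tonelli1//; last first.
  by apply: (measurableT_comp mf).
by apply: eq_integral => t' _; apply: eq_integral => t _; rewrite -ff.
Qed.

(** This replaces conditioning: [beta] bounds the expectation of [g1] over the block [Q] uniformly
    in the kept entries, while [g2] sees neither [Q] nor its transposes and stays fixed during the
    resampling. *)
Lemma decoupling_le (Q Z1 Z2 : {set I}) (g1 g2 : config R I -> \bar R) (beta : \bar R) :
  free_set tr Q -> (forall p, p \in Q -> tr p \in Z1 -> tr p \in Q) ->
  (forall p, p \in Q -> (p \notin Z2) && (tr p \notin Z2)) ->
  measurable_fun [set: config R I] g1 -> measurable_fun [set: config R I] g2 ->
  (forall a, 0 <= g1 a)%E -> (forall a, 0 <= g2 a)%E -> (0 <= beta)%E ->
  depends_on Z1 g1 -> depends_on Z2 g2 ->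
  (forall a, \int[P]_t g1 (mix Q a (X t)) <= beta)%E ->
  (\int[P]_t (g1 (X t) * g2 (X t)) <= beta * \int[P]_t g2 (X t))%E.
Proof.
move=> Qfree QZ1 QZ2 mg1 mg2 g10 g20 b0 dg1 dg2 g1b.
rewrite (@decoupling Q (Z1 :|: Z2) (fun a => g1 a * g2 a)%E)//.
- rewrite -ge0_integralZl//; last first.
    by apply: (measurableT_comp mg2); exact: measurable_X.
  apply: ge0_le_integral => //.
  + by move=> t _; apply: integral_ge0 => t' _; rewrite mule_ge0.
  + apply: (@measurable_fun_fubini_tonelli_F _ _ _ _ _ P (fun z => g1 (mix Q (X z.1) (X z.2)) *
      g2 (mix Q (X z.1) (X z.2)))%E).
      by apply: emeasurable_funM; apply: measurableT_comp => //; exact: measurable_mixXX.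
    by move=> z; rewrite mule_ge0.
  + apply: measurable_funeM; apply: (measurableT_comp mg2); exact: measurable_X.
  move=> t' _.
  rewrite (_ : (fun t => _) = (fun t => g2 (X t') * g1 (mix Q (X t') (X t)))%E); last first.
    apply/funext => t; rewrite muleC; congr (_ * _)%E; apply: dg2 => p pZ.
    by rewrite /mix; case: ifPn => // /QZ2; rewrite pZ.
  rewrite ge0_integralZl//.
  + by rewrite muleC lee_wpmul2r.
  + by apply: (measurableT_comp mg1); exact: measurable_mixX.
- move=> p pQ; rewrite inE => /orP[]; first exact: QZ1.
  by have /andP[_ /negPf ->] := QZ2 _ pQ.
- by apply: emeasurable_funM.
- by move=> a; rewrite mule_ge0.
- move=> a b ab; congr (_ * _)%E; [apply: dg1|apply: dg2] => p pZ; apply: ab;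
  by rewrite inE pZ ?orbT.
Qed.

End DecouplingIntegral.

(** * Squared norms and orthogonal projections in complex coordinates *)

Section SquaredNorm.
Context (R : realType).
Local Notation C := R[i].
Import complex.

(** All estimates are made on squared moduli with values in [R]; the price is that the triangle
    inequality becomes [nsqD_le], with a factor 2. *)
Definition nsq (z : C) : R := complex.Re z ^+ 2 + complex.Im z ^+ 2.

Lemma nsq_ge0 z : 0 <= nsq z.
Proof. by rewrite addr_ge0 ?sqr_ge0. Qed.

Lemma nsqE (z : C) : (nsq z)%:C%C = z * z^*.
Proof.
case: z => a b; rewrite /nsq /=; apply/eqP; rewrite eq_complex /=; apply/andP; split;
 apply/eqP; ring.
Qed.

Lemma nsqEl (z : C) : (nsq z)%:C%C = z^* * z.
Proof. by rewrite nsqE mulrC. Qed.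

Lemma nsqM (y z : C) : nsq (y * z) = nsq y * nsq z.
Proof. by case: y z => [a b] [c e]; rewrite /nsq /=; ring. Qed.

Lemma nsq_real (x : R) : nsq x%:C%C = x ^+ 2.
Proof. by rewrite /nsq /= expr0n addr0. Qed.

Lemma nsqN z : nsq (- z) = nsq z.
Proof. by case: z => a b; rewrite /nsq /= !sqrrN. Qed.

Lemma nsq0 : nsq 0 = 0.
Proof. by rewrite -[0 in LHS]/(0%:C)%C nsq_real expr0n. Qed.

Lemma nsq_eq0 z : (nsq z == 0) = (z == 0).
Proof.
by case: z => a b; rewrite /nsq /= paddr_eq0 ?sqr_ge0// !sqrf_eq0 eq_complex.
Qed.

Lemma nsq1 : nsq 1 = 1.
Proof. by have := nsq_real 1; rewrite expr1n. Qed.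

Lemma nsqV z : nsq z^-1 = (nsq z)^-1.
Proof.
have [->|z0] := eqVneq z 0; first by rewrite invr0 nsq0 invr0.
have n0 : nsq z != 0 by rewrite nsq_eq0.
by apply: (mulfI n0); rewrite -nsqM !mulfV// nsq1.
Qed.

Lemma nsqD_le (y z : C) : nsq (y + z) <= 2 * (nsq y + nsq z).
Proof.
case: y z => [a b] [c e]; rewrite /nsq /= -subr_ge0.
have -> : 2 * (a ^+ 2 + b ^+ 2 + (c ^+ 2 + e ^+ 2)) - ((a + c) ^+ 2 + (b + e) ^+ 2) =
  (a - c) ^+ 2 + (b - e) ^+ 2 by ring.
by rewrite addr_ge0 ?sqr_ge0.
Qed.

Lemma normc_sqr (z : C) : ComplexField.Normc.normc z ^+ 2 = nsq z.
Proof. by case: z => a b; rewrite /nsq /= sqr_sqrtr// addr_ge0 ?sqr_ge0. Qed.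

Lemma Re_sum (J : Type) (r : seq J) (Q : pred J) (F : J -> C) :
  complex.Re (\sum_(j <- r | Q j) F j) = \sum_(j <- r | Q j) complex.Re (F j).
Proof. by apply: (big_morph (@complex.Re R)) => // -[a b] [c e]. Qed.

Lemma Im_sum (J : Type) (r : seq J) (Q : pred J) (F : J -> C) :
  complex.Im (\sum_(j <- r | Q j) F j) = \sum_(j <- r | Q j) complex.Im (F j).
Proof. by apply: (big_morph (@complex.Im R)) => // -[a b] [c e]. Qed.

Lemma real_complex_sum (J : Type) (r : seq J) (Q : pred J) (F : J -> R) :
  (\sum_(j <- r | Q j) F j)%:C%C = \sum_(j <- r | Q j) (F j)%:C%C.
Proof.
apply: (big_morph (@real_complex R)) => // x y.
by apply/eqP; rewrite eq_complex /= addr0 !eqxx.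
Qed.

Lemma rcM (x y : R) : (x * y)%:C%C = x%:C%C * y%:C%C.
Proof. by apply/eqP; rewrite eq_complex /= !mulr0 !mul0r subr0 addr0 !eqxx. Qed.

Lemma rcD (x y : R) : (x + y)%:C%C = x%:C%C + y%:C%C.
Proof. by apply/eqP; rewrite eq_complex /= addr0 !eqxx. Qed.

Lemma rc_inj (x y : R) : x%:C%C = y%:C%C -> x = y.
Proof. by case. Qed.

Definition nsqv (n : nat) (v : 'cV[C]_n) : R := \sum_i nsq (v i 0).

Lemma nsqv_ge0 n (v : 'cV[C]_n) : 0 <= nsqv v.
Proof. by apply: sumr_ge0 => i _; exact: nsq_ge0. Qed.

Lemma nsqv_eq0 n (v : 'cV[C]_n) : (nsqv v == 0) = (v == 0).
Proof.
rewrite psumr_eq0; last by move=> i _; exact: nsq_ge0.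
apply/allP/eqP => [h|-> i _]; last by rewrite mxE nsq0 eqxx.
apply/matrixP => i k; rewrite ord1 mxE; apply/eqP; rewrite -nsq_eq0.
by have := h i (mem_index_enum _).
Qed.

Lemma nsqv0 n : nsqv (0 : 'cV[C]_n) = 0.
Proof. by apply/eqP; rewrite nsqv_eq0. Qed.

Lemma nsq_normalizer n (v : 'cV[C]_n) : nsq ((Num.sqrt (nsqv v))^-1)%:C%C = (nsqv v)^-1.
Proof. by rewrite nsq_real exprVn sqr_sqrtr// nsqv_ge0. Qed.

Lemma nsqvZ n (y : C) (v : 'cV[C]_n) : nsqv (y *: v) = nsq y * nsqv v.
Proof. by rewrite mulr_sumr; apply: eq_bigr => i _; rewrite mxE nsqM. Qed.

Lemma nsqvN n (v : 'cV[C]_n) : nsqv (- v) = nsqv v.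
Proof. by apply: eq_bigr => i _; rewrite mxE nsqN. Qed.

Lemma nsqvD_le n (u v : 'cV[C]_n) : nsqv (u + v) <= 2 * (nsqv u + nsqv v).
Proof.
by rewrite -big_split /= mulr_sumr; apply: ler_sum => i _; rewrite mxE nsqD_le.
Qed.

Lemma nsq_le_nsqv n (v : 'cV[C]_n) i : nsq (v i 0) <= nsqv v.
Proof.
rewrite /nsqv (bigD1 i)//= lerDl; apply: sumr_ge0 => k _; exact: nsq_ge0.
Qed.

Lemma l2norm_sqr n (v : 'cV[C]_n) : l2norm v ^+ 2 = nsqv v.
Proof.
rewrite /l2norm sqr_sqrtr; last by apply: sumr_ge0 => i _; exact: sqr_ge0.
by apply: eq_bigr => i _; rewrite normc_sqr.
Qed.

Lemma l2norm_ge0 n (v : 'cV[C]_n) : 0 <= l2norm v.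
Proof. exact: sqrtr_ge0. Qed.

Lemma l2normE n (v : 'cV[C]_n) : l2norm v = Num.sqrt (nsqv v).
Proof. by rewrite -l2norm_sqr sqrtr_sqr ger0_norm ?l2norm_ge0. Qed.

Definition ctr (m n : nat) (A : 'M[C]_(m, n)) : 'M[C]_(n, m) :=
  map_mx (fun z : C => z^*) A^T.

Lemma ctrE m n (A : 'M[C]_(m, n)) i j : ctr A i j = (A j i)^*.
Proof. by rewrite !mxE. Qed.

Lemma ctrK m n (A : 'M[C]_(m, n)) : ctr (ctr A) = A.
Proof. by apply/matrixP => i j; rewrite !ctrE conjCK. Qed.

Lemma ctrM m n p (A : 'M[C]_(m, n)) (B : 'M[C]_(n, p)) :
  ctr (A *m B) = ctr B *m ctr A.
Proof.
apply/matrixP => i j; rewrite ctrE !mxE rmorph_sum; apply: eq_bigr => k _.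
by rewrite !ctrE rmorphM mulrC.
Qed.

Lemma ctrB m n (A B : 'M[C]_(m, n)) : ctr (A - B) = ctr A - ctr B.
Proof. by apply/matrixP => i j; rewrite !(ctrE, mxE) rmorphB. Qed.

Lemma ctrZ m n (y : C) (A : 'M[C]_(m, n)) : ctr (y *: A) = y^* *: ctr A.
Proof. by apply/matrixP => i j; rewrite !(ctrE, mxE) rmorphM. Qed.

Lemma ctr_mul_vec n (v : 'cV[C]_n) : ctr v *m v = ((nsqv v)%:C%C)%:M.
Proof.
apply/matrixP => i j; rewrite !ord1 !mxE eqxx mulr1n real_complex_sum.
by apply: eq_bigr => k _; rewrite ctrE nsqEl.
Qed.

Section OrthogonalProjection.
Variable n : nat.
Implicit Types P : 'M[C]_n.

Definition oproj P := ctr P = P /\ P *m P = P.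

Definition coord_proj (S : {set 'I_n}) : 'M[C]_n := \matrix_(i, j) ((i == j) && (i \in S))%:R.

Lemma coord_projE S p (A : 'M[C]_(n, p)) i j :
  (coord_proj S *m A) i j = if i \in S then A i j else 0.
Proof.
rewrite mxE (bigD1 i)//= big1 ?addr0; last first.
  by move=> k ki; rewrite mxE eq_sym (negPf ki) mul0r.
by rewrite mxE eqxx /=; case: ifP; rewrite ?mul1r ?mul0r.
Qed.

Lemma oproj_coord S : oproj (coord_proj S).
Proof.
split.
  apply/matrixP => i j; rewrite ctrE !mxE eq_sym; case: eqP => [->|_] /=; last by rewrite conjC0.
  by case: (j \in S); rewrite ?conjC1 ?conjC0.
apply/matrixP => i j; rewrite coord_projE mxE.
by case: (i \in S); rewrite ?andbF.
Qed.

Lemma mxtrace_coord S : \tr (coord_proj S) = #|S|%:R.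
Proof.
rewrite /mxtrace -sum1_card natr_sum [RHS]big_mkcond /=; apply: eq_bigr => i _.
by rewrite mxE eqxx /=; case: ifP.
Qed.

Lemma oproj_nsqv P (v : 'cV[C]_n) : oproj P ->
  ((nsqv (P *m v))%:C%C)%:M = ctr v *m P *m v :> 'M[C]_(1, 1).
Proof.
move=> [hP PP]; rewrite -ctr_mul_vec ctrM hP.
by rewrite -!mulmxA (mulmxA P) PP.
Qed.

Lemma oproj_compl P : oproj P -> oproj (1%:M - P).
Proof.
move=> [hP PP]; split.
  rewrite ctrB hP; congr (_ - _); apply/matrixP => i j; rewrite ctrE !mxE eq_sym.
  by case: eqP => _; rewrite ?conjC1 ?conjC0.
by rewrite mulmxBl mul1mx mulmxBr mulmx1 PP subrr subr0.
Qed.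

Lemma nsqv_oproj P (v : 'cV[C]_n) : oproj P ->
  nsqv v = nsqv (P *m v) + nsqv ((1%:M - P) *m v).
Proof.
move=> hP; apply: rc_inj; rewrite rcD.
have h (Q : 'M[C]_n) : oproj Q -> (nsqv (Q *m v))%:C%C = (ctr v *m Q *m v) 0 0.
  by move=> hQ; rewrite -oproj_nsqv// mxE eqxx mulr1n.
rewrite !h//; last exact: oproj_compl.
have -> : (nsqv v)%:C%C = (ctr v *m v) 0 0 by rewrite ctr_mul_vec mxE eqxx mulr1n.
rewrite mulmxBr mulmx1 mulmxBl [X in _ = _ + X]mxE [X in _ = _ + (_ + X)]mxE.
by rewrite addrC subrK.
Qed.

Lemma nsqv_oproj_le P (v : 'cV[C]_n) : oproj P -> nsqv (P *m v) <= nsqv v.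
Proof. by move=> hP; rewrite [leRHS](nsqv_oproj v hP) lerDl nsqv_ge0. Qed.

Lemma oproj_diag P i : oproj P -> P i i = (nsqv (col i P))%:C%C.
Proof.
move=> [hP PP]; rewrite -[in LHS]PP mxE real_complex_sum; apply: eq_bigr => k _.
by rewrite mxE nsqEl -ctrE hP.
Qed.

(** For an orthogonal projection this is the squared length of the projection of the [i]-th basis
    vector; it vanishes exactly when the range is orthogonal to that vector. *)
Definition pdiag P i : R := complex.Re (P i i).

Lemma pdiagE P i : oproj P -> P i i = (pdiag P i)%:C%C.
Proof. by move=> hP; rewrite /pdiag oproj_diag. Qed.

Lemma pdiag_nsqv P i : oproj P -> pdiag P i = nsqv (col i P).
Proof. by move=> hP; rewrite /pdiag oproj_diag. Qed.

Lemma pdiag_ge0 P i : oproj P -> 0 <= pdiag P i.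
Proof. by move=> hP; rewrite pdiag_nsqv// nsqv_ge0. Qed.

Lemma pdiag_le1 P i : oproj P -> pdiag P i <= 1.
Proof.
move=> hP; have [->//|p0] := eqVneq (pdiag P i) 0.
have pp : 0 < pdiag P i by rewrite lt_def p0 pdiag_ge0.
rewrite -(ler_pM2l pp) mulr1 [leRHS]pdiag_nsqv// -expr2 -nsq_real -pdiagE//.
by have := nsq_le_nsqv (col i P) i; rewrite mxE.
Qed.

Lemma pdiag_eq0 P i : oproj P -> pdiag P i = 0 -> forall k, P k i = 0 /\ P i k = 0.
Proof.
move=> hP; rewrite pdiag_nsqv// => /eqP; rewrite nsqv_eq0 => /eqP ci k.
have Pki : P k i = 0 by move/matrixP: ci => /(_ k 0); rewrite !mxE.
by split => //; rewrite -(proj1 hP) ctrE Pki conjC0.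
Qed.

(** For an orthogonal projection this is the dimension of the range, in a form that can be averaged
    over coordinates. *)
Definition ptrace P : R := \sum_i pdiag P i.

Lemma ptraceE P : ptrace P = complex.Re (\tr P).
Proof. by rewrite Re_sum. Qed.

Lemma ptrace_le P : oproj P -> ptrace P <= n%:R.
Proof.
move=> hP; rewrite -[leRHS]mulr1 -[n in leRHS]card_ord mulrC mulr_natr -sumr_const.
by apply: ler_sum => i _; exact: pdiag_le1.
Qed.

(** For a nonzero [u] in the range of the orthogonal projection [P], this is the projection onto the
    part of the range orthogonal to [u]. *)
Definition deflate P (u : 'cV[C]_n) : 'M[C]_n :=
  P - ((nsqv u)^-1)%:C%C *: (u *m ctr u).

Section Deflate.
Variables (P : 'M[C]_n) (u : 'cV[C]_n).
Hypotheses (hP : oproj P) (Pu : P *m u = u) (u0 : u != 0).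

Let uP : ctr u *m P = ctr u.
Proof. by rewrite -[in LHS](proj1 hP) -ctrM Pu. Qed.

Let nu0 : nsqv u != 0.
Proof. by rewrite nsqv_eq0. Qed.

Let uuuu : (u *m ctr u) *m (u *m ctr u) = (nsqv u)%:C%C *: (u *m ctr u).
Proof.
by rewrite mulmxA -(mulmxA u) ctr_mul_vec mul_mx_scalar -scalemxAl.
Qed.

Lemma deflate_mulr : P *m deflate P u = deflate P u.
Proof. by rewrite mulmxBr (proj2 hP) -scalemxAr mulmxA Pu. Qed.

Lemma oproj_deflate : oproj (deflate P u).
Proof.
split.
  rewrite ctrB (proj1 hP) ctrZ ctrM ctrK; congr (_ - _ *: _).
  by apply/eqP; rewrite eq_complex /= oppr0 !eqxx.
rewrite {1}/deflate mulmxBl deflate_mulr -scalemxAl.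
suff -> : u *m ctr u *m deflate P u = 0 by rewrite scaler0 subr0.
rewrite mulmxBr -mulmxA uP -scalemxAr uuuu scalerA -rcM mulVf//.
by rewrite [X in X *: _]/(1 : C) scale1r subrr.
Qed.

Lemma ptrace_deflate : ptrace (deflate P u) = ptrace P - 1.
Proof.
rewrite !ptraceE linearB /= linearZ /= mxtrace_mulC ctr_mul_vec mxtrace_scalar mulr1n.
by rewrite -rcM mulVf//=; case: (\tr P).
Qed.

Lemma deflate_killed (h : 'cV[C]_n) : P *m h = 0 -> deflate P u *m h = 0.
Proof.
move=> Ph; rewrite mulmxBl Ph sub0r -scalemxAl -mulmxA -uP -mulmxA Ph.
by rewrite !mulmx0 scaler0 oppr0.
Qed.

Lemma deflate_pdiag0 i : pdiag P i = 0 -> pdiag (deflate P u) i = 0.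
Proof.
move=> Pi0; have ui : u i 0 = 0.
  rewrite -Pu mxE big1// => k _.
  by have [_ ->] := pdiag_eq0 hP Pi0 k; rewrite mul0r.
rewrite /pdiag !mxE big1 ?mulr0 ?subr0//; last by move=> k _; rewrite ord1 ui mul0r.
Qed.

Lemma nsqv_deflate (v : 'cV[C]_n) :
  nsqv (P *m v) = nsq ((ctr u *m v) 0 0) / nsqv u + nsqv (deflate P u *m v).
Proof.
apply: rc_inj; rewrite rcD rcM.
have h (Q : 'M[C]_n) : oproj Q -> (nsqv (Q *m v))%:C%C = (ctr v *m Q *m v) 0 0.
  by move=> hQ; rewrite -oproj_nsqv// mxE eqxx mulr1n.
rewrite !h//; last exact: oproj_deflate.
rewrite mulmxBr mulmxBl [X in _ = _ + X]mxE.
have addK (x y z : C) : y = z -> x = z + (x - y) by move=> ->; ring.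
rewrite [X in _ = _ + (_ + X)]mxE; apply: addK; apply/eqP.
rewrite -scalemxAr -scalemxAl mxE mulrC; apply/eqP; congr (_ * _).
rewrite mulmxA -(mulmxA (ctr v *m u)) mxE big_ord1 nsqEl; congr (_ * _).
by rewrite -ctrE ctrM ctrK.
Qed.

End Deflate.

(** Pigeonhole: the [n] diagonal entries have average at least [q / n]. *)
Lemma exists_pdiag P (q : R) : 0 < q -> oproj P -> q <= ptrace P ->
  exists i, q / n%:R <= pdiag P i.
Proof.
move=> q0 hP qP.
apply/not_existsP => /= h.
have n0 : (0 < n)%N.
  rewrite lt0n; apply/eqP => n0; have := lt_le_trans q0 (le_trans qP (ptrace_le hP)).
  by rewrite n0 ltxx.
have n0' : 0 < n%:R :> R by rewrite ltr0n.
have : ptrace P < q.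
  have -> : q = \sum_(i < n) q / n%:R.
    by rewrite sumr_const card_ord -[RHS]mulr_natr divfK// gt_eqF.
  apply: ltr_sum; last by move=> i _; rewrite ltNge; apply/negP/h.
  by apply/hasP; exists (Ordinal n0); rewrite ?mem_index_enum.
by rewrite ltNge qP.
Qed.

(** Gram-Schmidt by deflation: starting from the coordinate projection on [S], each [h] in turn is
    killed by deflating with [P *m h], which lies in the current range and lowers the trace by at
    most 1. *)
Lemma complement_proj (S : {set 'I_n}) (hs : seq 'cV[C]_n) :
  exists P, [/\ oproj P, forall i, i \notin S -> pdiag P i = 0,
    forall h, h \in hs -> P *m h = 0 & #|S|%:R - (size hs)%:R <= ptrace P].
Proof.
elim: hs => [|h hs [P [hP PS Ph tP]]].
  exists (coord_proj S); split => //.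
  - exact: oproj_coord.
  - by move=> i /negPf iS; rewrite /pdiag mxE iS andbF.
  - rewrite /= subr0 ptraceE mxtrace_coord.
    suff -> k : complex.Re (k%:R : C) = k%:R by [].
    by elim: k => // k IH; rewrite -!natr1 -IH; case: (k%:R : C).
have [u0|u0] := eqVneq (P *m h) 0.
  exists P; split => //.
    by move=> g; rewrite inE => /orP[/eqP ->//|/Ph].
  by apply: le_trans tP; rewrite lerD2l lerN2 ler_nat.
have Pu : P *m (P *m h) = P *m h by rewrite mulmxA (proj2 hP).
exists (deflate P (P *m h)); split => //.
- exact: oproj_deflate.
- by move=> i /PS; exact: deflate_pdiag0.
- move=> g; rewrite inE => /orP[/eqP ->|/Ph Pg]; last exact: deflate_killed.
  rewrite /deflate mulmxBl -scalemxAl -[_ *m _ *m _ *m h]mulmxA.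
  have -> : ctr (P *m h) *m h = ((nsqv (P *m h))%:C%C)%:M.
    by rewrite ctrM (proj1 hP) oproj_nsqv.
  rewrite mul_mx_scalar scalerA -rcM mulVf ?nsqv_eq0// [X in X *: _]/(1 : C).
  by rewrite scale1r subrr.
- rewrite ptrace_deflate// /= -natr1; move: tP; lra.
Qed.

End OrthogonalProjection.
End SquaredNorm.

(** Everything the probabilistic estimates use about the entries. Of the bounded density only the
    interval estimate is kept; [tr] stands for transposition. *)
Record entry_model (R : realType) (I : finType) (tr : I -> I) (K : R)
    (d : measure_display) (T : measurableType d) (P : probability T R)
    (X : T -> config R I) : Prop := EntryModel {
  em_measurable : forall p, measurable_fun [set: T] (fun t => X t p);
  em_indep : forall p B E, measurable B ->
    coord_sigma X [set q | q <> p /\ q <> tr p] E ->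
    P ((fun t => X t p) @^-1` B `&` E) = (P ((fun t => X t p) @^-1` B) * P E)%E;
  em_density : forall p u r, 0 <= r ->
    (P [set t | `|X t p - u| <= r]%R <= (2 * K * r)%:E)%E;
  em_K : 1 <= K }.

(** * Small ball estimate for the projection of a random vector *)

Section AffineForms.
Context (R : realType) (I : finType).
Local Notation C := R[i].

Lemma measurable_nsq_affine (J : finType) (e : J -> I) (alpha beta : J -> C) :
  measurable_fun [set: config R I]
    (fun a : config R I => nsq (\sum_j alpha j * ((a (e j))%:C%C + beta j))).
Proof.
have mc j : measurable_fun [set: config R I] (fun a : config R I => a (e j)).
  exact: measurable_coord.
rewrite /nsq; apply: measurable_funD; apply: measurable_funX.
- rewrite (_ : (fun _ => _) = (fun a : config R I => \sum_j
    (complex.Re (alpha j) * (a (e j) + complex.Re (beta j)) -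
     complex.Im (alpha j) * complex.Im (beta j)))); last first.
    apply/funext => a; rewrite Re_sum; apply: eq_bigr => j _.
    by case: (alpha j) (beta j) => [x y] [z w] /=; rewrite add0r.
  apply: measurable_sum => j; apply: measurable_funB => //.
  by apply: measurable_funM => //; apply: measurable_funD.
- rewrite (_ : (fun _ => _) = (fun a : config R I => \sum_j
    (complex.Re (alpha j) * complex.Im (beta j) +
     complex.Im (alpha j) * (a (e j) + complex.Re (beta j))))); last first.
    apply/funext => a; rewrite Im_sum; apply: eq_bigr => j _.
    by case: (alpha j) (beta j) => [x y] [z w] /=; rewrite add0r.
  apply: measurable_sum => j; apply: measurable_funD => //.
  by apply: measurable_funM => //; apply: measurable_funD.
Qed.

(** As [c] and [x] are real, the real part alone confines [x]; the imaginary part of [gamma] is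
    simply dropped. *)
Lemma affine_interval (c : R) (gamma : C) (x rho : R) :
  0 < c -> 0 <= rho -> nsq (c%:C%C * x%:C%C + gamma) <= rho ^+ 2 * c ->
  `|x - (- (complex.Re gamma / c))| <= rho / Num.sqrt c.
Proof.
move=> c0 r0; case: gamma => g h /= Hle.
rewrite -ler_sqr ?nnegrE ?divr_ge0 ?sqrtr_ge0// real_normK ?num_real//.
rewrite expr_div_n sqr_sqrtr ?(ltW c0)// opprK.
rewrite -(ler_pM2r (exprn_gt0 2 c0)).
have -> : (x + g / c) ^+ 2 * c ^+ 2 = (c * x + g) ^+ 2 by field; rewrite gt_eqF.
have -> : rho ^+ 2 / c * c ^+ 2 = rho ^+ 2 * c by field; rewrite gt_eqF.
apply: le_trans Hle; rewrite /nsq /= !mul0r !mulr0 subr0 addr0 add0r.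
by rewrite lerDl sqr_ge0.
Qed.

End AffineForms.

Section SmallBall.
Context (R : realType) (I : finType) (tr : I -> I) (K : R).
Context (d : measure_display) (T : measurableType d) (P : probability T R).
Variable X : T -> config R I.
Hypothesis M : entry_model tr K P X.
Local Notation C := R[i].

Lemma em_decoupling_le (Q Z1 Z2 : {set I}) (g1 g2 : config R I -> R) (beta : R) :
  free_set tr Q -> (forall p, p \in Q -> tr p \in Z1 -> tr p \in Q) ->
  (forall p, p \in Q -> (p \notin Z2) && (tr p \notin Z2)) ->
  measurable_fun [set: config R I] g1 -> measurable_fun [set: config R I] g2 ->
  (forall a, 0 <= g1 a) -> (forall a, 0 <= g2 a) -> 0 <= beta ->
  depends_on Z1 g1 -> depends_on Z2 g2 ->
  (forall a, \int[P]_t (g1 (mix Q a (X t)))%:E <= beta%:E)%E ->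
  (\int[P]_t (g1 (X t) * g2 (X t))%:E <= beta%:E * \int[P]_t (g2 (X t))%:E)%E.
Proof.
move=> Qf QZ1 QZ2 m1 m2 g10 g20 b0 d1 d2 hb.
have := @decoupling_le R I tr _ T P X (em_measurable M) (em_indep M) Q Z1 Z2
  (fun a => (g1 a)%:E) (fun a => (g2 a)%:E) beta%:E Qf QZ1 QZ2.
have -> : (\int[P]_t (g1 (X t) * g2 (X t))%:E =
    \int[P]_t ((g1 (X t))%:E * (g2 (X t))%:E))%E.
  by apply: eq_integral => t _; rewrite EFinM.
apply => //.
- exact/measurable_EFinP.
- exact/measurable_EFinP.
- by move=> a b ab; rewrite (d1 a b).
- by move=> a b ab; rewrite (d2 a b).
Qed.

Lemma integral_prob_cst (r : R) : (\int[P]_t r%:E = r%:E)%E.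
Proof. by rewrite integral_cst// [X in (_ * X)%E](probability_setT P) mule1. Qed.

Lemma integral_set_fun (F : set (config R I)) (h : T -> config R I) :
  measurable F -> measurable_fun [set: T] h ->
  (\int[P]_t (\1_F (h t) : R)%:E = P (h @^-1` F))%E.
Proof.
move=> mF mh; have mhF : measurable (h @^-1` F) by rewrite -[X in measurable X]setTI; exact: mh.
by rewrite -[in RHS](setIT (h @^-1` F)) -integral_indic.
Qed.

Section ProjectionSmallBall.
Variables (n : nat) (e : 'I_n -> I).
Hypothesis e_inj : injective e.
Variable w : 'cV[C]_n.

Definition entry_vec (a : config R I) : 'cV[C]_n := \col_i (a (e i))%:C%C + w.

Definition supp (Pm : 'M[C]_n) : {set I} := [set p | [exists i, (p == e i) && (pdiag Pm i != 0)]].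

Lemma mem_supp Pm i : (e i \in supp Pm) = (pdiag Pm i != 0).
Proof.
rewrite inE; apply/existsP/idP => [[k /andP[/eqP /e_inj -> //]]|h].
by exists i; rewrite eqxx.
Qed.

Variables (rho : R).
Hypothesis rho0 : 0 < rho.
Let eta := 2 * K * rho.

Let K0 : 0 < K. Proof. exact: lt_le_trans ltr01 (em_K M). Qed.
Let eta0 : 0 < eta. Proof. by rewrite !mulr_gt0. Qed.

Lemma proj_small_ball (q : nat) (Pm : 'M[C]_n) :
  oproj Pm -> q%:R <= ptrace Pm -> free_set tr (supp Pm) ->
  exists g : config R I -> R,
    [/\ measurable_fun [set: config R I] g, (forall a, 0 <= g a),
        depends_on (supp Pm) g,
        (\int[P]_t (g (X t))%:E <=
           ((2 * eta) ^+ q * \prod_(c < q) Num.sqrt (n%:R / c.+1%:R))%:E)%E &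
        forall a, exists x : nat, [/\ (x <= q)%N, eta ^+ x <= g a &
          x%:R * rho ^+ 2 <= nsqv (Pm *m entry_vec a)]].
Proof.
elim: q Pm => [|q IH] Pm hP tP fP.
  exists (fun=> 1); split => //.
    by rewrite integral_prob_cst big_ord0 mulr1 expr0.
  by move=> a; exists 0%N; rewrite expr0 mul0r nsqv_ge0.
have [j jP] := exists_pdiag (ltr0Sn R q) hP tP.
have n0 : 0 < n%:R :> R by rewrite ltr0n (leq_ltn_trans _ (ltn_ord j)).
have c0 : 0 < pdiag Pm j.
  by apply: lt_le_trans jP; rewrite divr_gt0// ltr0Sn.
pose u := col j Pm.
have u0 : u != 0 by rewrite -nsqv_eq0 -pdiag_nsqv// gt_eqF.
have Pu : Pm *m u = u by rewrite /u colE mulmxA (proj2 hP).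
have hP' := oproj_deflate hP Pu u0.
(* Removing the projection of [e_j] leaves a range orthogonal to [e_j], so the deflated projection
   no longer sees entry [j]. *)
have diagj : pdiag (deflate Pm u) j = 0.
  rewrite {1}/pdiag.
  have uj : u j 0 = (pdiag Pm j)%:C%C by rewrite mxE pdiagE.
  have -> : deflate Pm u j j =
      (pdiag Pm j)%:C%C - ((nsqv u)^-1)%:C%C * (u j 0 * (u j 0)^*).
    rewrite /deflate mxE [X in _ + X]mxE [X in _ + - X]mxE [X in _ * X]mxE big_ord1.
    by rewrite ctrE -pdiagE.
  rewrite -nsqE -rcM uj nsq_real -pdiag_nsqv// expr2 mulKf ?gt_eqF//.
  by rewrite subrr.
have supp' : supp (deflate Pm u) \subset supp Pm :\ e j.
  apply/fintype.subsetP => p; rewrite inE => /existsP[i /andP[/eqP -> pi]].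
  rewrite in_setD1 mem_supp (inj_eq e_inj).
  apply/andP; split; first by apply: contraNneq pi => ->; rewrite diagj.
  by apply: contraNneq pi => pi0; rewrite deflate_pdiag0.
have [|p r /(fintype.subsetP supp') + /(fintype.subsetP supp')|g' [mg' g'0 dg' Eg' bg']] := IH (deflate Pm u) hP'.
- by rewrite ptrace_deflate// -natr1 in tP *; move: tP; rewrite -lerBrDr.
- by rewrite !in_setD1 => /andP[_ ?] /andP[_ ?]; exact: fP.
pose form (a : config R I) := nsq ((ctr u *m entry_vec a) 0 0).
have formE a : form a = nsq (\sum_i (u i 0)^* * ((a (e i))%:C%C + w i 0)).
  by rewrite /form mxE; congr nsq; apply: eq_bigr => i _; rewrite ctrE !mxE.
pose F := [set a : config R I | form a <= rho ^+ 2 * pdiag Pm j].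
have mform : measurable_fun [set: config R I] form.
  rewrite (_ : form = (fun a : config R I => nsq (\sum_i (u i 0)^* * ((a (e i))%:C%C + w i 0)))); last exact/funext.
  exact: measurable_nsq_affine.
have mF : measurable F by exact: measurable_sublevel.
have ui i : pdiag Pm i = 0 -> u i 0 = 0.
  by move=> /(pdiag_eq0 hP) /(_ j) [_]; rewrite mxE.
have dform : depends_on (supp Pm) form.
  move=> a b ab; rewrite !formE; congr nsq; apply: eq_bigr => i _.
  have [/ui ->|pi] := eqVneq (pdiag Pm i) 0; first by rewrite conjC0 !mul0r.
  by rewrite ab// mem_supp.
pose g1 a : R := \1_F a + eta.
exists (fun a => g1 a * g' a).
have g10 a : 0 <= g1 a by rewrite /g1 indicE addr_ge0 ?ler0n// ltW.
have mg1 : measurable_fun [set: config R I] g1.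
  by apply: measurable_funD => //; exact: measurable_indic.
have dg1 : depends_on (supp Pm) g1.
  have dF : depends_on (supp Pm) F by move=> a b ab; rewrite /F /= (dform a b ab).
  by move=> a b ab; rewrite /g1 (depends_indic dF ab).
pose s : R := Num.sqrt (n%:R / q.+1%:R).
have s1 : 1 <= s.
  rewrite -sqrtr1 ler_wsqrtr// ler_pdivlMr ?ltr0Sn// mul1r.
  exact: le_trans tP (ptrace_le hP).
have mixb a : (\int[P]_t (g1 (mix [set e j] a (X t)))%:E <= (2 * eta * s)%:E)%E.
  rewrite /g1; under eq_integral do rewrite EFinD.
  have mm : measurable_fun [set: T] (fun t => mix [set e j] a (X t)).
    exact: (measurable_mixX (em_measurable M)).
  rewrite ge0_integralD//; last 2 first.
  - apply/measurable_EFinP; apply: (measurableT_comp (g := fun t => mix [set e j] a (X t))) mm.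
    exact: measurable_indic.
  - by move=> t _; rewrite lee_fin ltW.
  rewrite integral_set_fun// integral_prob_cst.
  have -> : 2 * eta * s = eta * s + eta * s by ring.
  rewrite EFinD leeD//; last by rewrite lee_fin -[leLHS]mulr1 ler_pM2l.
  (* Given the other entries, the form is [c * x + gamma] in the fresh entry [x], with the real
     coefficient [c = pdiag Pm j]. So [F] confines [x] to an interval of half-length [rho / sqrt c],
     and [c] is at least [q.+1 / n]. *)
  pose gamma := \sum_(i | i != j) (u i 0)^* * ((a (e i))%:C%C + w i 0) +
     (pdiag Pm j)%:C%C * w j 0.
  have sub : (fun t => mix [set e j] a (X t)) @^-1` F `<=`
     [set t | `|X t (e j) - (- (complex.Re gamma / pdiag Pm j))| <=
        rho / Num.sqrt (pdiag Pm j)].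
    move=> t; rewrite /F /= formE => Ft; apply: affine_interval => //; first exact: ltW.
    apply: le_trans Ft; rewrite le_eqVlt; apply/orP; left; apply/eqP; congr nsq.
    rewrite [RHS](bigD1 j)//= /mix inE eqxx.
    have -> : (u j 0)^* = (pdiag Pm j)%:C%C.
      by rewrite mxE pdiagE//; apply/eqP; rewrite eq_complex /= oppr0 !eqxx.
    rewrite mulrDr -addrA; congr (_ + _); rewrite /gamma addrC; congr (_ + _).
    apply: eq_bigr => i ij; rewrite inE (inj_eq e_inj) (negPf ij)//.
  apply: (@le_trans _ _ (P [set t | `|X t (e j) - (- (complex.Re gamma / pdiag Pm j))| <=
        rho / Num.sqrt (pdiag Pm j)])).
    apply: le_measure => //; rewrite ?inE; first by rewrite -[X in measurable X]setTI; exact: mm.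
    apply: measurable_sublevel; apply: measurableT_comp => //; apply: measurable_funB => //.
    exact: (em_measurable M).
  apply: le_trans (em_density M _ _ _) _; first by rewrite divr_ge0 ?sqrtr_ge0// ltW.
  rewrite lee_fin /eta mulrA ler_pM2l ?mulr_gt0// /s -[leLHS]mul1r -(sqrtrV (ltW c0)).
  rewrite mul1r ler_wsqrtr// -[n%:R / _]invf_div lef_pV2 ?posrE// ?divr_gt0 ?ltr0Sn//.
split.
- exact: measurable_funM.
- by move=> a; rewrite mulr_ge0.
- move=> a b ab; rewrite (dg1 a b ab) (dg' a b)// => p /(fintype.subsetP supp').
  by rewrite in_setD1 => /andP[_]; exact: ab.
- apply: le_trans (em_decoupling_le (Q := [set e j]) (Z1 := supp Pm) (Z2 := supp (deflate Pm u)) _ _ _ mg1 mg' g10 g'0 _ dg1 dg' mixb) _.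
  + by move=> p r; rewrite !inE => /eqP -> /eqP ->.
  + move=> p; rewrite finset.in_set1 => /eqP -> tj; rewrite finset.in_set1; apply/eqP.
    by apply: fP => //; rewrite mem_supp gt_eqF.
  + move=> p; rewrite finset.in_set1 => /eqP ->.
    have eS : e j \notin supp (deflate Pm u) by rewrite mem_supp diagj eqxx.
    rewrite eS /=; apply/negP => ts; have /(fintype.subsetP supp') := ts.
    rewrite in_setD1 => /andP[/negP + ts']; apply; apply/eqP.
    by apply: fP => //; rewrite mem_supp gt_eqF.
  + by rewrite !mulr_ge0// ?sqrtr_ge0// ltW.
  + rewrite big_ord_recr /= -/s.
    apply: (@le_trans _ _ ((2 * eta * s)%:E * ((2 * eta) ^+ q * \prod_(c < q) Num.sqrt (n%:R / c.+1%:R))%:E)%E).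
      by rewrite lee_pmul2l// lte_fin !mulr_gt0// (lt_le_trans ltr01).
    by rewrite -EFinM lee_fin exprS le_eqVlt; apply/orP; left; apply/eqP; ring.
- move=> a; have [x [xq xg xr]] := bg' a.
  rewrite (nsqv_deflate hP Pu u0).
  have [aF|aF] := boolP (a \in F).
    exists x; split; first exact: leqW.
      rewrite /g1 indicE aF (le_trans xg)// ler_peMl//.
      by rewrite lerDl ltW.
    by apply: le_trans xr _; rewrite lerDr divr_ge0 ?nsq_ge0 ?nsqv_ge0.
  exists x.+1; split => //.
    by rewrite /g1 indicE (negPf aF) add0r exprS ler_pM2l.
  rewrite -natr1 mulrDl mul1r addrC lerD//.
  rewrite -pdiag_nsqv// ler_pdivlMr// ltW//.
  by move: aF; rewrite notin_setE /F /= => /negP; rewrite -ltNge.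
Qed.

End ProjectionSmallBall.
End SmallBall.

(** * Continuity and measurability of complex-valued maps *)

Section ComplexValued.
Context (R : realType).
Local Notation C := R[i].

Section Continuity.
Variable V : topologicalType.
Implicit Types f g : V -> C.

(** Phrased through real and imaginary parts, so that only the topology of [R] enters; [cmeas] does
    the same for measurability. *)
Definition ccont f := continuous (fun x => complex.Re (f x)) /\
  continuous (fun x => complex.Im (f x)).

Lemma ccont_cst (c : C) : ccont (fun=> c).
Proof. by split => x; exact: cvg_cst. Qed.

Lemma ccontD f g : ccont f -> ccont g -> ccont (fun x => f x + g x).
Proof.
move=> [f1 f2] [g1 g2]; split => x.
  rewrite (_ : (fun _ => _) = (fun x => complex.Re (f x) + complex.Re (g x))).
    by apply: cvgD; [exact: f1|exact: g1].
  by apply/funext => y; case: (f y) (g y) => [? ?] [].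
rewrite (_ : (fun _ => _) = (fun x => complex.Im (f x) + complex.Im (g x))).
  by apply: cvgD; [exact: f2|exact: g2].
by apply/funext => y; case: (f y) (g y) => [? ?] [].
Qed.

Lemma ccontM f g : ccont f -> ccont g -> ccont (fun x => f x * g x).
Proof.
move=> [f1 f2] [g1 g2]; split => x.
  rewrite (_ : (fun _ => _) = (fun x => complex.Re (f x) * complex.Re (g x) -
     complex.Im (f x) * complex.Im (g x))).
    by apply: cvgB; apply: cvgM; [exact: f1|exact: g1|exact: f2|exact: g2].
  by apply/funext => y; case: (f y) (g y) => [? ?] [].
rewrite (_ : (fun _ => _) = (fun x => complex.Re (f x) * complex.Im (g x) +
     complex.Im (f x) * complex.Re (g x))).
  by apply: cvgD; apply: cvgM; [exact: f1|exact: g2|exact: f2|exact: g1].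
by apply/funext => y; case: (f y) (g y) => [? ?] [].
Qed.

Lemma ccontB f g : ccont f -> ccont g -> ccont (fun x => f x - g x).
Proof.
move=> cf cg; rewrite (_ : (fun _ => _) = (fun x => f x + (- 1) * g x)).
  by apply: ccontD => //; apply: ccontM => //; exact: ccont_cst.
by apply/funext => x; rewrite mulN1r.
Qed.

Lemma ccont_sum (J : Type) (r : seq J) (Q : pred J) (F : J -> V -> C) :
  (forall j, Q j -> ccont (F j)) -> ccont (fun x => \sum_(j <- r | Q j) F j x).
Proof.
move=> cF; elim: r => [|j r IH].
  by rewrite (_ : (fun _ => _) = fun=> 0); [exact: ccont_cst|apply/funext => x; rewrite big_nil].
case Qj : (Q j).
  rewrite (_ : (fun _ => _) = fun x => F j x + \sum_(j <- r | Q j) F j x).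
    by apply: ccontD => //; exact: cF.
  by apply/funext => x; rewrite big_cons Qj.
by under [X in ccont X]eq_fun do rewrite big_cons Qj.
Qed.

Lemma continuous_sum (J : Type) (r : seq J) (Q : pred J) (F : J -> V -> R) :
  (forall j, Q j -> continuous (F j)) -> continuous (fun x => \sum_(j <- r | Q j) F j x).
Proof.
move=> cF; elim: r => [|j r IH].
  have -> : (fun x => \sum_(j <- [::] | Q j) F j x) = fun=> 0.
    by apply/funext => x; rewrite big_nil.
  by move=> x; exact: cvg_cst.
case Qj : (Q j).
  have -> : (fun x => \sum_(j <- j :: r | Q j) F j x) =
      (fun x => F j x + \sum_(j <- r | Q j) F j x).
    by apply/funext => y; rewrite big_cons Qj.
  by move=> x; apply: cvgD; [exact: cF|exact: IH].
have -> : (fun x => \sum_(j <- j :: r | Q j) F j x) =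
    (fun x => \sum_(j <- r | Q j) F j x).
  by apply/funext => y; rewrite big_cons Qj.
exact: IH.
Qed.

Lemma continuous_nsq f : ccont f -> continuous (fun x => nsq (f x)).
Proof.
move=> [f1 f2].
have -> : (fun x => nsq (f x)) = (fun x => complex.Re (f x) * complex.Re (f x) +
    complex.Im (f x) * complex.Im (f x)).
  by apply/funext => x; rewrite /nsq !expr2.
by move=> x; apply: cvgD; apply: cvgM; [exact: f1|exact: f1|exact: f2|exact: f2].
Qed.

End Continuity.

Section Measurability.
Context (dS : measure_display) (S : measurableType dS).
Implicit Types f g : S -> C.

Definition cmeas f := measurable_fun [set: S] (fun x => complex.Re (f x)) /\
  measurable_fun [set: S] (fun x => complex.Im (f x)).

Lemma cmeas_cst (c : C) : cmeas (fun=> c).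
Proof. by split; exact: measurable_cst. Qed.

Lemma cmeasD f g : cmeas f -> cmeas g -> cmeas (fun x => f x + g x).
Proof.
move=> [f1 f2] [g1 g2]; split.
  rewrite (_ : (fun _ => _) = (fun x => complex.Re (f x) + complex.Re (g x))).
    exact: measurable_funD.
  by apply/funext => y; case: (f y) (g y) => [? ?] [].
rewrite (_ : (fun _ => _) = (fun x => complex.Im (f x) + complex.Im (g x))).
  exact: measurable_funD.
by apply/funext => y; case: (f y) (g y) => [? ?] [].
Qed.

Lemma cmeasM f g : cmeas f -> cmeas g -> cmeas (fun x => f x * g x).
Proof.
move=> [f1 f2] [g1 g2]; split.
  rewrite (_ : (fun _ => _) = (fun x => complex.Re (f x) * complex.Re (g x) -
     complex.Im (f x) * complex.Im (g x))).
    by apply: measurable_funB; exact: measurable_funM.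
  by apply/funext => y; case: (f y) (g y) => [? ?] [].
rewrite (_ : (fun _ => _) = (fun x => complex.Re (f x) * complex.Im (g x) +
     complex.Im (f x) * complex.Re (g x))).
  by apply: measurable_funD; exact: measurable_funM.
by apply/funext => y; case: (f y) (g y) => [? ?] [].
Qed.

Lemma cmeasB f g : cmeas f -> cmeas g -> cmeas (fun x => f x - g x).
Proof.
move=> cf cg; rewrite (_ : (fun _ => _) = (fun x => f x + (- 1) * g x)).
  by apply: cmeasD => //; apply: cmeasM => //; exact: cmeas_cst.
by apply/funext => x; rewrite mulN1r.
Qed.

Lemma cmeas_sum (J : Type) (r : seq J) (Q : pred J) (F : J -> S -> C) :
  (forall j, Q j -> cmeas (F j)) -> cmeas (fun x => \sum_(j <- r | Q j) F j x).
Proof.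
move=> cF; elim: r => [|j r IH].
  by rewrite (_ : (fun _ => _) = fun=> 0); [exact: cmeas_cst|apply/funext => x; rewrite big_nil].
case Qj : (Q j).
  rewrite (_ : (fun _ => _) = fun x => F j x + \sum_(j <- r | Q j) F j x).
    by apply: cmeasD => //; exact: cF.
  by apply/funext => x; rewrite big_cons Qj.
by under [X in cmeas X]eq_fun do rewrite big_cons Qj.
Qed.

Lemma measurable_sum_cond (J : Type) (r : seq J) (Q : pred J) (F : J -> S -> R) :
  (forall j, Q j -> measurable_fun [set: S] (F j)) ->
  measurable_fun [set: S] (fun x => \sum_(j <- r | Q j) F j x).
Proof.
move=> mF; have -> : (fun x => \sum_(j <- r | Q j) F j x) =
    (fun x => \sum_(j <- r) if Q j then F j x else 0).
  by apply/funext => x; rewrite big_mkcond.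
apply: measurable_sum => j; have := mF j.
by case: (Q j) => [/(_ isT)|_] //; exact: measurable_cst.
Qed.

Lemma measurable_nsq f : cmeas f -> measurable_fun [set: S] (fun x => nsq (f x)).
Proof. by move=> [f1 f2]; apply: measurable_funD; exact: measurable_funX. Qed.

End Measurability.
End ComplexValued.

(** * Measurability of events that assert the existence of a vector *)

Section MeasurableProjection.
Context (R : realType) (dS : measure_display) (S : measurableType dS).
Variables (k : nat) (Z : set 'rV[R]_k) (g : S -> 'rV[R]_k -> R).
Hypothesis mg : forall x, measurable_fun [set: S] (g ^~ x).
Hypothesis cg : forall s, continuous (g s).

Let ratrv (c : 'rV[rat]_k) : 'rV[R]_k := map_mx ratr c.

Let near_pt (cm : 'rV[rat]_k * nat) (x : 'rV[R]_k) :=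
  Z x /\ ball (ratrv cm.1) cm.2.+1%:R^-1 x.

(** For each rational centre and each radius [1 / (m + 1)] a point of [Z] in the ball is selected,
    if there is one. These points form a countable dense subset of [Z]; the default 0 may lie
    outside [Z] and is excluded by an explicit existence condition below. *)
Let pt (cm : 'rV[rat]_k * nat) : 'rV[R]_k := xget 0 (near_pt cm).

(** Continuity carries a strict inequality from a point of [Z] to a selected point close to it, so
    the existential over [Z] becomes a countable union. *)
Lemma measurable_exists_lt (r : R) :
  measurable [set s | exists2 x, Z x & g s x < r].
Proof.
rewrite (_ : [set s | _] = \bigcup_cm
    [set s | (exists x, near_pt cm x) /\ g s (pt cm) < r]).
  apply: countable_bigcupT_measurable => // cm.
  have [h|h] := pselect (exists x, near_pt cm x); last first.
    by rewrite (_ : [set s | _] = set0)//; apply/seteqP; split => // s [].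
  rewrite (_ : [set s | _] = [set s | g s (pt cm) < r]).
    exact: (measurable_strict_sublevel (mg _)).
  by apply/seteqP; split => s /=; [case|split].
apply/seteqP; split => [s [x Zx gx]|s [cm _ [[x hx] gx]]]; last first.
  by exists (pt cm) => //; have [] := xgetI 0 hx.
have : \forall y \near x, g s y < r.
  by have := @cg s x; move/(_ [set y | y < r]); apply; exact: lt_nbhsl.
move=> /nbhs_ballP[e /= e0 eb].
pose m := Num.truncn (2 / e).
have m0 : 0 < m.+1%:R^-1 :> R by rewrite invr_gt0 ltr0Sn.
have me : m.+1%:R^-1 + m.+1%:R^-1 <= e.
  have h : 2 / e < m.+1%:R by apply: truncnS_gt.
  rewrite -mulr2n -[_ *+ 2]mulr_natl ler_pdivrMr ?ltr0Sn// -ler_pdivrMl// mulrC.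
  exact: ltW.
have [c hc] : exists c : 'rV[rat]_k, ball (ratrv c) m.+1%:R^-1 x.
  have cc (y e' : R) : 0 < e' -> exists q : rat, `|ratr q - y| < e'.
    move=> e'0; have /rat_in_itvoo[q] : y - e' < y + e' by rewrite ltrD2l gtrN.
    rewrite in_itv /= => /andP[q1 q2]; exists q.
    by rewrite ltr_norml; apply/andP; split; move: q1 q2; lra.
  exists (\row_j projT1 (cid (cc (x 0 j) _ m0))); split => // i j; rewrite !mxE ord1.
  by case: cid.
exists (c, m) => //.
have hx : near_pt (c, m) x by [].
split; first by exists x.
apply: eb; apply: le_ball me _ _; apply: (@ball_triangle _ _ (ratrv c)).
  exact: ball_sym.
by have [] := xgetI 0 hx.
Qed.

(** On a compact set the minimum is attained, so the weak inequality is the countable intersection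
    of strict ones with [r + 1 / (m + 1)]. *)
Lemma measurable_exists_le (r : R) : compact Z ->
  measurable [set s | exists2 x, Z x & g s x <= r].
Proof.
move=> cZ; rewrite (_ : [set s | _] = \bigcap_m
    [set s | exists2 x, Z x & g s x < r + m.+1%:R^-1]).
  by apply: bigcap_measurable => // m _; exact: measurable_exists_lt.
apply/seteqP; split => [s [x Zx gx] m _|s h].
  by exists x => //; rewrite (le_lt_trans gx)// ltrDl invr_gt0 ltr0Sn.
have Z0 : Z !=set0 by have [x Zx _] := h 0%N I; exists x.
have [c /set_mem Zc hc] := EVT_min_rV Z0 cZ (continuous_subspaceT (@cg s)).
exists c => //; apply/ler_addgt0Pr => e e0.
pose m := Num.truncn (e^-1).
have [x Zx gx] := h m I.
apply: le_trans (hc x (mem_set Zx)) _; apply: le_trans (ltW gx) _.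
rewrite lerD2l invf_ple ?posrE ?ltr0Sn//; apply/ltW; exact: truncnS_gt.
Qed.

End MeasurableProjection.

(** * Distance from a column to the span of other columns *)

Section MatrixConfig.
Context (R : realType) (n : nat).
Local Notation C := R[i].
Local Notation cfg := (config R ('I_n * 'I_n)%type).

Definition transpose_pair (p : 'I_n * 'I_n) : 'I_n * 'I_n := (p.2, p.1).

(** [S] gathers the deterministic part of the matrix: the fixed imaginary parts and the shift by a
    point of the eigenvalue net. *)
Definition cmx (S : 'M[C]_n) (a : cfg) : 'M[C]_n := \matrix_(i, j) ((a (i, j))%:C%C + S i j).

Definition nsqr (Rw : {set 'I_n}) (v : 'cV[C]_n) : R := \sum_(i in Rw) nsq (v i 0).

Lemma nsqr_sub (Rw Rw' : {set 'I_n}) v : Rw \subset Rw' -> nsqr Rw v <= nsqr Rw' v.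
Proof.
move=> sub; rewrite /nsqr [leLHS]big_mkcond [leRHS]big_mkcond /=; apply: ler_sum => i _.
by case: ifPn => [/(fintype.subsetP sub) ->//|_]; case: ifP => // _; exact: nsq_ge0.
Qed.

Lemma nsqr_ge0 Rw v : 0 <= nsqr Rw v.
Proof. by apply: sumr_ge0 => i _; exact: nsq_ge0. Qed.

Lemma nsqr_le_nsqv Rw v : nsqr Rw v <= nsqv v.
Proof.
rewrite /nsqr big_mkcond /=; apply: ler_sum => i _; case: ifP => // _; exact: nsq_ge0.
Qed.

Lemma nsqr_coord Rw v : nsqr Rw v = nsqv (coord_proj R Rw *m v).
Proof.
rewrite /nsqr big_mkcond /=; apply: eq_bigr => i _; rewrite coord_projE.
by case: ifP; rewrite ?nsq0.
Qed.

Lemma nsqr_setT v : nsqr [set: 'I_n]%SET v = nsqv v.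
Proof. by apply: eq_bigl => i; rewrite finset.inE. Qed.

Lemma nsqrZ Rw (y : C) v : nsqr Rw (y *: v) = nsq y * nsqr Rw v.
Proof. by rewrite !nsqr_coord -scalemxAr nsqvZ. Qed.

(* Vectors of [C^n] are encoded by real rows of length [2n], for which the
   library provides the topology. *)
Definition decode (x : 'rV[R]_(n + n)) : 'cV[C]_n :=
  \col_i (x 0 (lshift n i) +i* x 0 (rshift n i))%C.

Definition encode (z : 'cV[C]_n) : 'rV[R]_(n + n) :=
  row_mx (\row_i complex.Re (z i 0)) (\row_i complex.Im (z i 0)).

Lemma encodeK : cancel encode decode.
Proof.
move=> z; apply/matrixP => i k; rewrite ord1 mxE /encode row_mxEl row_mxEr !mxE.
by case: (z i 0).
Qed.

Lemma ccont_decode i : ccont (fun x => decode x i 0).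
Proof.
split.
  rewrite (_ : (fun _ => _) = (fun x : 'rV[R]_(n + n) => x 0 (lshift n i))).
    exact: coord_continuous.
  by apply/funext => x; rewrite mxE.
rewrite (_ : (fun _ => _) = (fun x : 'rV[R]_(n + n) => x 0 (rshift n i))).
  exact: coord_continuous.
by apply/funext => x; rewrite mxE.
Qed.

Lemma cmeas_cmx (S : 'M[C]_n) i j : cmeas (fun a : cfg => cmx S a i j).
Proof.
split.
  rewrite (_ : (fun _ => _) = (fun a : cfg => a (i, j) + complex.Re (S i j))).
    by apply: measurable_funD => //; exact: measurable_coord.
  by apply/funext => a; rewrite mxE; case: (S i j).
rewrite (_ : (fun _ => _) = (fun a : cfg => complex.Im (S i j))).
  exact: measurable_cst.
by apply/funext => a; rewrite mxE; case: (S i j) => x y /=; rewrite add0r.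
Qed.

Lemma measurable_nsqr (S : 'M[C]_n) (Rw : {set 'I_n}) (z : 'cV[C]_n) :
  measurable_fun [set: cfg] (fun a => nsqr Rw (cmx S a *m z)).
Proof.
apply: measurable_sum_cond => i _; apply: measurable_nsq.
have -> : (fun a : cfg => (cmx S a *m z) i 0) = (fun a => \sum_j cmx S a i j * z j 0).
  by apply/funext => a; rewrite mxE.
by apply: cmeas_sum => j _; apply: cmeasM; [exact: cmeas_cmx|exact: cmeas_cst].
Qed.

Lemma continuous_nsqr (B : 'M[C]_n) (Rw : {set 'I_n}) :
  continuous (fun x : 'rV[R]_(n + n) => nsqr Rw (B *m decode x)).
Proof.
apply: continuous_sum => i _; apply: continuous_nsq.
rewrite (_ : (fun _ => _) = (fun x => \sum_j B i j * decode x j 0)).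
  by apply: ccont_sum => j _; apply: ccontM; [exact: ccont_cst|exact: ccont_decode].
by apply/funext => a; rewrite mxE.
Qed.

Lemma continuous_nsqv_decode : continuous (fun x : 'rV[R]_(n + n) => nsqv (decode x)).
Proof. by apply: continuous_sum => i _; apply: continuous_nsq; exact: ccont_decode. Qed.

Lemma measurable_exists_vec (S : 'M[C]_n) (Rw : {set 'I_n}) (Z : set 'cV[C]_n)
    (h : 'cV[C]_n -> R) (r : R) : continuous (fun x => h (decode x)) ->
  measurable [set a : cfg | exists2 z, Z z & nsqr Rw (cmx S a *m z) < r + h z].
Proof.
move=> ch; rewrite (_ : [set a | _] = [set a : cfg | exists2 x : 'rV[R]_(n + n),
    Z (decode x) & nsqr Rw (cmx S a *m decode x) - h (decode x) < r]).
  apply: (@measurable_exists_lt _ _ _ _ [set x | Z (decode x)]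
    (fun (a : cfg) x => nsqr Rw (cmx S a *m decode x) - h (decode x))).
    by move=> x; apply: measurable_funB => //; exact: measurable_nsqr.
  by move=> a x; apply: (cvgB (@continuous_nsqr (cmx S a) Rw x) (@ch x)).
apply/seteqP; split => [a [z Zz hz]|a [x Zx hx]].
  by exists (encode z); rewrite encodeK// ltrBlDr.
by exists (decode x) => //; rewrite -ltrBlDr.
Qed.

Section CloseColumn.
Variable S : 'M[C]_n.

(* On the rows [Rw], column [j] is at distance less than [sqrt r] from the
   span of the columns in [Cs]. *)
Definition close_column (Rw Cs : {set 'I_n}) (j : 'I_n) (r : R) : set cfg :=
  [set a | exists2 z : 'cV[C]_n, z j 0 = 1 /\ (forall i, i \notin j |: Cs -> z i 0 = 0) &
     nsqr Rw (cmx S a *m z) < r].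

Definition block (Rw Cs : {set 'I_n}) : {set 'I_n * 'I_n} := [set p | (p.1 \in Rw) && (p.2 \in Cs)].

Lemma mem_block Rw Cs p : (p \in block Rw Cs) = (p.1 \in Rw) && (p.2 \in Cs).
Proof. by rewrite inE. Qed.

Lemma measurable_close_column Rw Cs j r : measurable (close_column Rw Cs j r).
Proof.
rewrite (_ : close_column _ _ _ _ = [set a : cfg | exists2 z : 'cV[C]_n,
   (z j 0 = 1 /\ (forall i, i \notin j |: Cs -> z i 0 = 0)) &
   nsqr Rw (cmx S a *m z) < r + 0]).
  apply: (@measurable_exists_vec _ _ _ (fun=> 0)).
  exact: (@cst_continuous _ _ (0 : R)).
by rewrite addr0.
Qed.

Lemma depends_mulmx Rw Cs (a b : cfg) (z : 'cV[C]_n) :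
  (forall p, p \in block Rw Cs -> a p = b p) ->
  (forall i, i \notin Cs -> z i 0 = 0) ->
  nsqr Rw (cmx S a *m z) = nsqr Rw (cmx S b *m z).
Proof.
move=> ab z0; apply: eq_bigr => i iR; congr nsq; rewrite !mxE; apply: eq_bigr => j _.
have [jC|/z0 ->] := boolP (j \in Cs); last by rewrite !mulr0.
by rewrite !mxE ab// mem_block iR.
Qed.

Lemma depends_close_column Rw Cs j r :
  depends_on (block Rw (j |: Cs)) (close_column Rw Cs j r).
Proof.
move=> a b ab; apply/propext; split => -[z [zj z0] hz].
  by exists z; [exact: conj zj z0|rewrite -(depends_mulmx ab z0)].
by exists z; [exact: conj zj z0|rewrite (depends_mulmx ab z0)].
Qed.

Context (K : R).
Context (d : measure_display) (T : measurableType d) (P : probability T R).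
Variable X : T -> cfg.
Hypothesis M : entry_model transpose_pair K P X.

(** [q] is the codimension of the span inside the rows, and [e] is the number of directions allowed
    to be large, each of which forfeits one factor [2 * K * rho]. *)
Definition close_bound (q e : nat) (rho : R) : R :=
  2 ^+ q * (2 * K * rho) ^+ (q - e) * \prod_(c < q) Num.sqrt (n%:R / c.+1%:R).

(** The columns in [Cs] are kept in [a], so the projection [Pm] onto the complement of their span in
    the rows [Rw] is deterministic, with trace at least [q]. Closeness bounds the projected column
    strictly by [e.+1 * rho ^+ 2], so at most [e] directions are large and the certificate of
    [proj_small_ball] is at least [eta ^+ e]. As [j] is not in [Rw], the refreshed part of column
    [j] contains no transposed pair. *)
Lemma close_column_prob (Rw Cs : {set 'I_n}) (j : 'I_n) (q e : nat) (rho : R) (a : cfg) :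
  0 < rho -> (e <= q)%N -> j \notin Rw -> j \notin Cs -> (#|Cs| + q <= #|Rw|)%N ->
  (P [set t | close_column Rw Cs j (e.+1%:R * rho ^+ 2)
        (mix (block Rw [set j]) a (X t))] <= (close_bound q e rho)%:E)%E.
Proof.
move=> rho0 eq jR jC CR.
have K0 : 0 < K by apply: lt_le_trans ltr01 (em_K M).
pose eta := 2 * K * rho; have eta0 : 0 < eta by rewrite !mulr_gt0.
have qn : (q <= n)%N.
  by rewrite -[leqRHS]card_ord (leq_trans _ (max_card (mem Rw)))// (leq_trans _ CR)// leq_addl.
set F := close_column _ _ _ _.
have mF : measurable F by exact: measurable_close_column.
have mm : measurable_fun [set: T] (fun t => mix (block Rw [set j]) a (X t)).
  exact: (measurable_mixX (em_measurable M)).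
have mFt : measurable [set t | F (mix (block Rw [set j]) a (X t))].
  by rewrite -[X in measurable X]setTI; exact: mm.
have prod1 : 1 <= \prod_(c < q) Num.sqrt (n%:R / c.+1%:R) :> R.
  apply: (big_ind (fun x : R => 1 <= x)) => // [x y|c _]; first exact: mulr_ege1.
  rewrite -[leLHS]sqrtr1 ler_wsqrtr// ler_pdivlMr ?ltr0Sn// mul1r ler_nat.
  exact: leq_trans (ltn_ord c) qn.
(* For [eta > 1] the claimed bound is at least 1; otherwise [eta ^+ x] decreases in [x], which is
   needed to pass from [x <= e] to [eta ^+ e]. *)
have [eta1|eta1] := ltP 1 eta.
  apply: le_trans (probability_le1 P mFt) _; rewrite lee_fin /close_bound -/eta.
  by rewrite !mulr_ege1// exprn_ege1// ?ler1n// ltW.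
(* These columns are those of the resampled matrix as well, because [j] is not in [Cs]. *)
pose hs := [seq cmx S a *m (delta_mx k 0 : 'cV[C]_n) | k <- enum Cs].
have [Pm [hP PR Phs tP]] := complement_proj Rw hs.
have free : free_set transpose_pair (supp (fun i => (i, j)) Pm).
  move=> p r; rewrite !inE => /existsP[i /andP[/eqP -> pi]] /existsP[k /andP[/eqP -> pk]].
  case=> kj _; move: pk; rewrite kj PR ?eqxx//.
have e_inj : injective (fun i : 'I_n => (i, j)) by move=> i k [].
have tq : q%:R <= ptrace Pm.
  apply: le_trans tP; rewrite /hs size_map -cardE lerBrDr -natrD ler_nat addnC.
  exact: CR.
pose w : 'cV[C]_n := \col_i S i j.
have [g [mg g0 dg Eg bg]] := proj_small_ball M e_inj w rho0 hP tq free.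
have -> : P [set t | F (mix (block Rw [set j]) a (X t))] =
    (\int[P]_t (\1_F (mix (block Rw [set j]) a (X t)) : R)%:E)%E.
  by rewrite integral_set_fun.
have EX : measurable_fun [set: T] (fun t => g (X t)).
  by apply: (measurableT_comp mg); exact: (measurable_X (em_measurable M)).
apply: (@le_trans _ _ (\int[P]_t ((eta ^- e)%:E * (g (X t))%:E))%E); last first.
  rewrite ge0_integralZl//; last 3 first.
  - exact/measurable_EFinP.
  - by move=> t _; rewrite lee_fin.
  - by rewrite lee_fin invr_ge0 exprn_ge0// ltW.
  apply: (@le_trans _ _ ((eta ^- e)%:E * ((2 * eta) ^+ q * \prod_(c < q) Num.sqrt (n%:R / c.+1%:R))%:E)%E).
    by rewrite lee_wpmul2l// lee_fin invr_ge0 exprn_ge0// ltW.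
  have key (y B : R) : y != 0 -> y ^- e * ((2 * y) ^+ q * B) = 2 ^+ q * y ^+ (q - e) * B.
    move=> y0; rewrite exprMn; have -> : y ^+ q = y ^+ (q - e) * y ^+ e by rewrite -exprD subnK.
    by field; rewrite expf_neq0.
  by rewrite -EFinM lee_fin key ?gt_eqF.
apply: ge0_le_integral => //.
- apply/measurable_EFinP; apply: (measurableT_comp (g := fun t => mix (block Rw [set j]) a (X t))) mm.
  exact: measurable_indic.
- by apply: measurable_funeM; exact/measurable_EFinP.
move=> t _; rewrite -EFinM lee_fin indicE.
have [aF|_] := boolP (_ \in F); last first.
  by rewrite mulr_ge0// invr_ge0 exprn_ge0// ltW.
have [x [xq xg xr]] := bg (X t).
suff xe : (x <= e)%N.
  rewrite mulrC ler_pdivlMr ?exprn_gt0// mul1r (le_trans _ xg)//.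
  by rewrite ler_wiXn2l// ltW.
rewrite -ltnS -(ltr_nat R) -(ltr_pM2r (exprn_gt0 2 rho0)).
apply: le_lt_trans xr _.
move: aF; rewrite inE => -[z [zj z0]]; apply: le_lt_trans.
set a' := mix _ a (X t).
have -> : Pm *m entry_vec (fun i => (i, j)) w (X t) = Pm *m (cmx S a' *m z).
  have Pcol (u v : 'cV[C]_n) : (forall i, i \in Rw -> u i 0 = v i 0) -> Pm *m u = Pm *m v.
    move=> uv; apply/matrixP => i k; rewrite ord1 !mxE; apply: eq_bigr => l _.
    have [lR|/PR/(pdiag_eq0 hP) h] := boolP (l \in Rw); first by rewrite uv.
    by have [_ _] := h i; have [-> _] := h i; rewrite !mul0r.
  have -> : z = delta_mx j 0 + \sum_(k in Cs) z k 0 *: delta_mx k 0.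
    apply/matrixP => i k; rewrite !mxE summxE !ord1 eqxx andbT.
    under eq_bigr do rewrite !mxE eqxx andbT.
    have [->|ij] := eqVneq i j.
      rewrite big1 ?addr0// => l lC; rewrite (_ : (j == l) = false) ?mulr0//.
      by apply/negbTE; apply: contraNneq jC => ->.
    rewrite add0r; have [iC|iC] := boolP (i \in Cs).
      rewrite (bigD1 i)//= eqxx mulr1 big1 ?addr0// => l /andP[_ li].
      by rewrite eq_sym (negPf li) mulr0.
    rewrite z0 ?in_setU1 ?negb_or ?ij// big1// => l lC.
    by rewrite (_ : (i == l) = false) ?mulr0//; apply/negbTE; apply: contraNneq iC => ->.
  rewrite mulmxDr mulmxDr mulmx_sumr mulmx_sumr [X in _ = _ + X]big1 ?addr0.
    apply: Pcol => i iR; rewrite -colE !mxE /a' /mix mem_block /= iR inE eqxx.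
    by [].
  move=> k kC; rewrite -scalemxAr -scalemxAr.
  rewrite (_ : Pm *m (cmx S a' *m delta_mx k 0) = 0) ?scaler0//.
  rewrite -[RHS](Phs (cmx S a *m delta_mx k 0)); last first.
    by apply/mapP; exists k => //; rewrite mem_enum.
  apply: Pcol => i iR; rewrite -!colE !mxE /a' /mix mem_block /= iR inE /=.
  by case: eqP => // kj; rewrite -kj kC in jC.
have -> : Pm *m (cmx S a' *m z) = Pm *m (coord_proj R Rw *m (cmx S a' *m z)).
  apply/matrixP => i k; rewrite ord1 mxE [RHS]mxE; apply: eq_bigr => l _.
  rewrite coord_projE; case: ifPn => // /PR/(pdiag_eq0 hP) h.
  by have [-> _] := h i; rewrite !mul0r.
rewrite nsqr_coord; set v := coord_proj R Rw *m _.
exact: nsqv_oproj_le.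
Qed.

End CloseColumn.
End MatrixConfig.

(** * Expected number of sequences of close columns *)

Section ManyCloseColumns.
Context (R : realType) (n : nat).
Local Notation C := R[i].
Local Notation cfg := (config R ('I_n * 'I_n)%type).
Variables (S : 'M[C]_n) (Rw Cs : {set 'I_n}) (r : R).

(** The rows in [j |: D] are dropped along with the columns: the transposes of column [j] lie in row
    [j], so the events for later columns do not see them and column [j] can be refreshed. *)
Definition next_close (D : {set 'I_n}) (j : 'I_n) : set cfg :=
  close_column S (Rw :\: (j |: D)) (Cs :\: (j |: D)) j r.

(* Number of sequences of [l] columns, outside [D], each of which is close to
   the span of the columns that are neither in [D] nor chosen so far. *)
Fixpoint close_count (l : nat) (D : {set 'I_n}) (a : cfg) : R :=
  if l is l'.+1 then
    \sum_(j in Cs :\: D) \1_(next_close D j) a * close_count l' (j |: D) a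
  else 1.

Lemma close_count_ge0 l D a : 0 <= close_count l D a.
Proof.
elim: l D => [|l IH] D //=; apply: sumr_ge0 => j _.
by rewrite mulr_ge0// indicE ler0n.
Qed.

Lemma measurable_close_count l D : measurable_fun [set: cfg] (close_count l D).
Proof.
elim: l D => [|l IH] D /=; first exact: measurable_cst.
apply: measurable_sum_cond => j _; apply: measurable_funM => //.
by apply: measurable_indic; exact: measurable_close_column.
Qed.

Lemma depends_close_count l D :
  depends_on (block (Rw :\: D) (Cs :\: D)) (close_count l D).
Proof.
elim: l D => [|l IH] D a b ab //=.
apply: eq_bigr => j jCD.
have dj := depends_indic (@depends_close_column _ _ S (Rw :\: (j |: D)) (Cs :\: (j |: D)) j r).
rewrite (dj a b); last first.
  move=> p; rewrite mem_block => /andP[p1 p2]; apply: ab; rewrite mem_block.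
  move: p1 p2 jCD; rewrite !inE negb_or => /andP[/andP[_ ->] ->] /=.
  by move=> /orP[/eqP -> //|/andP[/norP[_ ->] ->]].
rewrite (IH _ a b)// => p; rewrite mem_block => /andP[p1 p2]; apply: ab; rewrite mem_block.
by move: p1 p2; rewrite !inE !negb_or => /andP[/andP[_ ->] ->] /andP[/andP[_ ->] ->].
Qed.

(** Diagonal entries below [D / (2 n)] add up to at most [D / 2], and the others are at most 1
    each. *)
Lemma card_pdiag_ge (Pm : 'M[C]_n) (D : R) : (0 < n)%N -> oproj Pm -> D <= ptrace Pm ->
  D / 2 <= #|[set j | D / (2 * n%:R) <= pdiag Pm j]%SET|%:R.
Proof.
move=> n0 hP DP; have n0' : 0 < n%:R :> R by rewrite ltr0n.
have [D0|D0] := leP D 0; first by rewrite (le_trans _ (ler0n _ _))// ler_pdivrMr// mul0r.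
set U := [set j | _]%SET.
have : ptrace Pm <= #|U|%:R + D / 2.
  rewrite /ptrace (bigID (mem U)) /=; apply: lerD.
    by rewrite -sum1_card natr_sum; apply: ler_sum => j _; exact: pdiag_le1.
  apply: (@le_trans _ _ (\sum_(j | j \notin U) D / (2 * n%:R))).
    by apply: ler_sum => j; rewrite /U finset.inE -ltNge => /ltW.
  rewrite sumr_const -[leLHS]mulr_natr.
  apply: (@le_trans _ _ (D / (2 * n%:R) * n%:R)).
    apply: ler_wpM2l; first by rewrite divr_ge0// ltW// mulr_gt0.
    by rewrite ler_nat -[leqRHS]card_ord max_card.
  by rewrite le_eqVlt; apply/orP; left; apply/eqP; field; rewrite gt_eqF.
by move: DP; lra.
Qed.

(* A subspace (the range of [Pm]) on which the matrix is small yields many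
   close columns: if [e_j] has a large projection [x] on the subspace then [x],
   normalized so that [x_j = 1], witnesses that column [j] is close; deflating
   the subspace by [x] and iterating produces the sequences. *)
Lemma close_count_ge (l : nat) (D : {set 'I_n}) (a : cfg) (Pm : 'M[C]_n) (dmin tau2 : R) :
  (0 < n)%N -> 0 < dmin -> 0 <= tau2 -> oproj Pm -> dmin + l%:R <= ptrace Pm ->
  (forall j, j \notin Cs :\: D -> pdiag Pm j = 0) ->
  (forall v, nsqr (Rw :\: D) (cmx S a *m (Pm *m v)) <= tau2 * nsqv (Pm *m v)) ->
  tau2 * (2 * n%:R) / dmin < r ->
  (dmin / 2) ^+ l <= close_count l D a.
Proof.
move=> n0 d0 t0; have n0' : 0 < n%:R :> R by rewrite ltr0n.
elim: l D Pm => [|l IH] D Pm hP tP PD small tr; first by rewrite expr0.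
have dP : dmin <= ptrace Pm by apply: le_trans tP; rewrite lerDl ler0n.
set U := [set j | dmin / (2 * n%:R) <= pdiag Pm j]%SET.
have UC j : j \in U -> j \in Cs :\: D.
  rewrite /U finset.inE => jU; apply: contraTT jU => /PD ->; rewrite -ltNge.
  by rewrite divr_gt0// mulr_gt0.
have UP j : j \in U -> 0 < pdiag Pm j.
  by rewrite /U finset.inE; apply: lt_le_trans; rewrite divr_gt0// mulr_gt0.
have UE : U \subset Cs :\: D by apply/fintype.subsetP.
apply: (@le_trans _ _ (\sum_(j in U) (dmin / 2) ^+ l)).
  rewrite sumr_const -[leRHS]mulr_natr exprS mulrC.
  apply: ler_wpM2l; first by rewrite exprn_ge0// divr_ge0// ltW.
  exact: card_pdiag_ge.
rewrite /= [leRHS](bigID (mem U)) /=; apply: le_trans (_ : _ <= _ + 0) _; first by rewrite addr0.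
apply: lerD; last first.
  by apply: sumr_ge0 => j _; rewrite mulr_ge0 ?close_count_ge0// indicE ler0n.
rewrite [leRHS](eq_bigl (mem U)); last first.
  by move=> j; apply/idP/idP => [/andP[]//|jU]; apply/andP; split => //; exact: UC.
apply: ler_sum => j jU.
have pj := UP j jU.
pose u := col j Pm.
have nu : nsqv u = pdiag Pm j by rewrite pdiag_nsqv.
have u0 : u != 0 by rewrite -nsqv_eq0 nu gt_eqF.
have uE : u = Pm *m delta_mx j 0 by rewrite /u colE.
have Pu : Pm *m u = u by rewrite uE mulmxA (proj2 hP).
have aF : a \in next_close D j.
  rewrite inE; exists (((pdiag Pm j)^-1)%:C%C *: u).
    split; first by rewrite 2!mxE pdiagE// -rcM mulVf ?gt_eqF.
    move=> i; rewrite in_setU1 negb_or => /andP[ij iCD].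
    rewrite mxE [u i 0]mxE; have -> : Pm i j = 0; last by rewrite mulr0.
    suff /pdiag_eq0 h : pdiag Pm i = 0 by have [_ ->] := h hP j.
    by apply: PD; move: iCD; rewrite !inE negb_or ij.
  rewrite -scalemxAr nsqrZ nsq_real.
  apply: (@le_lt_trans _ _ ((pdiag Pm j)^-1 ^+ 2 * (tau2 * pdiag Pm j))).
    rewrite ler_wpM2l ?sqr_ge0// -nu -[u in leRHS]Pu -[in leLHS]Pu.
    apply: le_trans (small u); apply: nsqr_sub; apply: finset.setDS.
    exact: finset.subsetUr.
  apply: le_lt_trans tr; rewrite [leLHS](_ : _ = tau2 * (pdiag Pm j)^-1); last first.
    by field; rewrite gt_eqF.
  rewrite -mulrA ler_wpM2l// -[_ / dmin]invf_div lef_pV2 ?posrE ?divr_gt0 ?mulr_gt0//.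
  by move: jU; rewrite /U finset.inE.
rewrite indicE aF mul1r; apply: (IH (j |: D) (deflate Pm u)) => //.
- exact: oproj_deflate.
- by rewrite ptrace_deflate//; move: tP; rewrite -natr1; lra.
- move=> i iCD; have [->|ij] := eqVneq i j.
    have u_j : u j 0 = (pdiag Pm j)%:C%C by rewrite mxE pdiagE.
    rewrite /pdiag /deflate mxE [X in _ + X]mxE [X in _ + - X]mxE [X in _ * X]mxE big_ord1.
    rewrite ctrE -nsqE u_j nsq_real nu -rcM pdiagE// expr2 mulKf ?gt_eqF//.
    by rewrite subrr.
  apply: deflate_pdiag0 => //; apply: PD; move: iCD; rewrite !inE negb_or ij.
  by [].
- move=> v; rewrite -(deflate_mulr hP Pu) -mulmxA.
  apply: le_trans (small _); apply: nsqr_sub; apply: finset.setDS.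
  exact: finset.subsetUr.
Qed.

Context (K : R).
Context (d : measure_display) (T : measurableType d) (P : probability T R).
Variable X : T -> cfg.
Hypothesis M : entry_model (@transpose_pair n) K P X.

(** Induction on [l]: the first column of the sequence is refreshed on the remaining rows, which the
    count of the later columns does not see, so [close_column_prob] factors out; the choice of the
    column costs a factor [n]. *)
Lemma close_count_expectation (l q e : nat) (rho : R) (D : {set 'I_n}) :
  Cs \subset Rw -> (#|Cs| + q <= #|Rw|)%N -> (e <= q)%N -> 0 < rho ->
  r = e.+1%:R * rho ^+ 2 ->
  D \subset Cs -> (\int[P]_t (close_count l D (X t))%:E <= ((n%:R * close_bound n K q e rho) ^+ l)%:E)%E.
Proof.
move=> CR qCR eq rho0 rE.
have K0 : 0 < K by apply: lt_le_trans ltr01 (em_K M).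
have b0 : 0 <= close_bound n K q e rho.
  rewrite /close_bound !mulr_ge0 ?exprn_ge0 ?mulr_ge0 ?(ltW K0) ?(ltW rho0)//.
  by apply: prodr_ge0 => c _; exact: sqrtr_ge0.
elim: l D => [|l IH] D DC /=; first by rewrite integral_prob_cst expr0.
have mX := measurable_X (em_measurable M).
have mcc D' : measurable_fun [set: T] (fun t => close_count l D' (X t)).
  by apply: (measurableT_comp _ mX); exact: measurable_close_count.
have mnc D' j : measurable_fun [set: T] (fun t => \1_(next_close D' j) (X t) : R).
  by apply: (measurableT_comp (g := X)) => //; apply: measurable_indic; exact: measurable_close_column.
under eq_integral do rewrite big_mkcond -sumEFin /=.
rewrite ge0_integral_sum//; last 2 first.
- move=> j; apply/measurable_EFinP; case: (j \in _); last exact: measurable_cst.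
  exact: measurable_funM.
- move=> j t _; rewrite lee_fin; case: ifP => // _.
  by rewrite mulr_ge0 ?close_count_ge0// indicE ler0n.
rewrite exprS -mulrA mulr_natl -[n in (_ *+ n)]card_ord -sumr_const -sumEFin.
apply: lee_sum => j _; case: (boolP (j \in Cs :\: D)) => jCD; last first.
  by rewrite integral_prob_cst lee_fin mulr_ge0// exprn_ge0// mulr_ge0.
have jC : j \in Cs by move: jCD; rewrite inE => /andP[].
have jD : j \notin D by move: jCD; rewrite inE => /andP[].
have jDC : j |: D \subset Cs by rewrite finset.subUset finset.sub1set jC.
apply: (@le_trans _ _ ((close_bound n K q e rho)%:E * \int[P]_t (close_count l (j |: D) (X t))%:E)%E).
  apply: (em_decoupling_le M (Q := block (Rw :\: (j |: D)) [set j])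
     (Z1 := block (Rw :\: (j |: D)) (j |: (Cs :\: (j |: D))))
     (Z2 := block (Rw :\: (j |: D)) (Cs :\: (j |: D))) (g1 := \1_(next_close D j))
     (g2 := close_count l (j |: D))).
  - move=> [i1 i2] [k1 k2]; rewrite !mem_block !inE /= => /andP[_ /eqP ->] /andP[h /eqP ->].
    by case=> k1j; move: h; rewrite k1j eqxx.
  - move=> [i1 i2]; rewrite !mem_block !inE /= => /andP[h /eqP ->].
    by rewrite eqxx.
  - by move=> [i1 i2]; rewrite !mem_block !inE /= => /andP[h /eqP ->]; rewrite !eqxx /= !andbF.
  - by apply: measurable_indic; exact: measurable_close_column.
  - exact: measurable_close_count.
  - by move=> a; rewrite indicE ler0n.
  - by move=> a; exact: close_count_ge0.
  - exact: b0.
  - by apply: depends_indic; exact: depends_close_column.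
  - exact: depends_close_count.
  move=> a; rewrite integral_set_fun//.
  - rewrite /next_close rE; apply: (close_column_prob S M) => //.
    + by rewrite !inE eqxx.
    + by rewrite !inE eqxx.
    (* As many rows as columns are deleted, so the codimension [q] survives every step. *)
    have sub : (j |: D) \subset Rw by exact: fintype.subset_trans CR.
    rewrite !cardsD (finset.setIidPr jDC) (finset.setIidPr sub).
    by rewrite addnBAC ?subset_leq_card// leq_sub2r.
  - exact: measurable_close_column.
  - exact: (measurable_mixX (em_measurable M)).
rewrite [X in (_ <= X)%E]EFinM; apply: lee_wpmul2l; first by rewrite lee_fin.
exact: IH.
Qed.

End ManyCloseColumns.

(** * The LYM inequality and central binomial coefficients *)

Section Antichains.
Variable J : finType.

(** Induction on [D] in place of counting maximal chains. If [D] is in [F], it is the only member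
    inside [D]. Otherwise the inequality is averaged over the sets [D :\ i]: a member [Q] survives
    for [|D| - |Q|] choices of [i], and [(|D| - |Q|) C(|D|, |Q|) = |D| C(|D| - 1, |Q|)]. *)
Lemma LYM_inequality (R : realFieldType) (F : {set {set J}}) (D : {set J}) :
  {in F &, forall Q Q' : {set J}, ~~ (Q \proper Q')} ->
  \sum_(Q in F | Q \subset D) ('C(#|D|, #|Q|)%:R : R)^-1 <= 1.
Proof.
move=> anti; have [h] := ubnP #|D|; elim: h D => // h IH D Dh.
have [DF|DF] := boolP (D \in F).
  rewrite (bigD1 D) ?DF ?fintype.subxx//= binn invr1 big1 ?addr0// => Q /andP[/andP[QF QD] QnD].
  have := anti Q D QF DF; rewrite finset.properEneq QnD QD//.
have [D0|D0] := posnP #|D|.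
  rewrite big1 ?ler01// => Q /andP[QF QD]; move: QD DF.
  by rewrite (cards0_eq D0) finset.subset0 => /eqP <-; rewrite QF.
have hD : 0 < #|D|%:R :> R by rewrite ltr0n.
rewrite -(ler_pM2l hD) mulr1 mulr_sumr.
apply: (@le_trans _ _ (\sum_(Q in F | Q \subset D) \sum_(i in D | i \notin Q)
    ('C(#|D|.-1, #|Q|)%:R : R)^-1)).
  apply: ler_sum => Q /andP[QF QD].
  have QnD : Q != D by apply: contraNneq DF => <-.
  have QltD : (#|Q| < #|D|)%N.
    by apply: proper_card; rewrite finset.properEneq QnD.
  have -> : \sum_(i in D | i \notin Q) ('C(#|D|.-1, #|Q|)%:R : R)^-1 =
      (#|D| - #|Q|)%:R * ('C(#|D|.-1, #|Q|)%:R)^-1.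
    rewrite (eq_bigl [in D :\: Q]); last by move=> i; rewrite !inE andbC.
    by rewrite sumr_const cardsDS// [RHS]mulr_natl.
  have c1 : 0 < 'C(#|D|, #|Q|)%:R :> R by rewrite ltr0n bin_gt0 ltnW.
  have c2 : 0 < 'C(#|D|.-1, #|Q|)%:R :> R by rewrite ltr0n bin_gt0 -ltnS prednK.
  rewrite ler_pdivlMr// mulrAC ler_pdivrMr// -!natrM ler_nat.
  by rewrite mul_bin_down mulnC.
rewrite (exchange_big_dep (mem D)) /=; last by move=> Q i _ /andP[].
rewrite [leRHS](_ : _ = \sum_(i in D) 1); last by rewrite sumr_const.
apply: ler_sum => i iD.
have Di : #|D :\ i| = #|D|.-1 by rewrite (cardsD1 i D) iD.
rewrite -Di; apply: le_trans (IH (D :\ i) _); last by rewrite Di prednK.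
rewrite le_eqVlt; apply/orP; left; apply/eqP; apply: eq_bigl => Q.
by rewrite iD finset.subsetD1 /= andbA.
Qed.

Lemma bin_le_half n k : ('C(n, k) <= 'C(n, n./2))%N.
Proof.
have low j : (j <= n./2)%N -> ('C(n, n./2 - j) <= 'C(n, n./2))%N.
  elim: j => [|j IH] jn; first by rewrite subn0.
  apply: leq_trans (IH (ltnW jn)).
  have e : (n./2 - j = (n./2 - j.+1).+1)%N by lia.
  rewrite e -(leq_pmul2l (ltn0Sn (n./2 - j.+1))) mul_bin_left leq_mul2r; lia.
have [kn|kn] := leqP k n./2; first by rewrite -[k](subKn kn) low// leq_subr.
have [nk|nk] := ltnP n k; first by rewrite bin_small.
rewrite -bin_sub//.
have kn' : (n - k <= n./2)%N by lia.
by rewrite -[(n - k)%N](subKn kn') low// leq_subr.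
Qed.

(** Squaring keeps the bound of order [4^m / sqrt m] inside the naturals; the induction step reduces
    to [4 (2m + 1)(2m + 3) <= 16 (m + 1)^2]. *)
Lemma bin_central m : ('C(m.*2, m) ^ 2 * m.*2.+1 <= 16 ^ m)%N.
Proof.
elim: m => [|m IH] //.
have step : (m.+1 * 'C(m.+1.*2, m.+1) = 2 * (m.*2.+1 * 'C(m.*2, m)))%N.
  rewrite doubleS binS -(@bin_sub m.*2.+1 m.+1); last by lia.
  have -> : (m.*2.+1 - m.+1 = m)%N by lia.
  rewrite addnn -muln2 mulnA mulnC; congr (2 * _)%N.
  have <- : 'C(m.*2.+1, m.+1) = 'C(m.*2.+1, m).
    have mm : (m <= m.*2.+1)%N by lia.
    rewrite -(bin_sub mm); congr 'C(_, _); lia.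
  by have /= -> := mul_bin_diag m.*2.+1 m; rewrite mulnC.
rewrite -(@leq_pmul2l (m.+1 ^ 2)) ?expn_gt0// mulnA -expnMn step [(16 ^ m.+1)%N]expnS.
have h1 : (4 * (m.*2.+1 * m.+1.*2.+1) <= 16 * m.+1 ^ 2)%N by rewrite -!muln2; nia.
have -> : ((2 * (m.*2.+1 * 'C(m.*2, m))) ^ 2 * m.+1.*2.+1 =
    4 * (m.*2.+1 * m.+1.*2.+1) * ('C(m.*2, m) ^ 2 * m.*2.+1))%N.
  by rewrite -!mulnn; move: (m.*2.+1) (m.+1.*2.+1) 'C(_, _) => a b c; ring.
have -> : (m.+1 ^ 2 * (16 * 16 ^ m) = 16 * m.+1 ^ 2 * 16 ^ m)%N.
  by rewrite mulnCA mulnA.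
exact: leq_mul.
Qed.

Lemma bin_sqr_le n k : ('C(n, k) ^ 2 * n.+1 <= 4 ^ n)%N.
Proof.
apply: (@leq_trans ('C(n, n./2) ^ 2 * n.+1)); first by rewrite leq_mul2r leq_sqr bin_le_half orbT.
have [m [->|->]] : exists m, n = m.*2 \/ n = m.*2.+1.
- by exists n./2; case o: (odd n); [right|left]; lia.
- have -> : (m.*2)./2 = m by lia.
  by apply: leq_trans (bin_central m) _; rewrite -mul2n expnM.
have -> : (m.*2.+1)./2 = m by lia.
have e : ('C(m.+1.*2, m.+1) = 'C(m.*2.+1, m) * 2)%N.
  rewrite doubleS binS; have <- : 'C(m.*2.+1, m.+1) = 'C(m.*2.+1, m).
    have mm : (m <= m.*2.+1)%N by lia.
    by rewrite -(bin_sub mm); congr 'C(_, _); lia.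
  by rewrite addnn muln2.
have := bin_central m.+1; rewrite e doubleS.
have -> : (16 ^ m.+1 = 4 * 4 ^ m.*2.+1)%N.
  by rewrite expnS -mul2n [(4 ^ (2 * m).+1)%N]expnS expnM mulnA.
move: 'C(_, _) (4 ^ _)%N => c p.
have -> : ((c * 2) ^ 2 * m.*2.+3 = 4 * (c ^ 2 * m.*2.+3))%N.
  by rewrite expnMn mulnAC mulnC.
rewrite leq_mul2l /=; apply: leq_trans; rewrite leq_mul2l; apply/orP; right; lia.
Qed.

End Antichains.

(** * The Littlewood-Offord inequality for subset sums *)

Section SubsetSums.
Context (R : realType) (J : finType).
Implicit Types (d : J -> R) (D Q : {set J}).

Lemma big_powersetU1 (V : nmodType) (j : J) D (F : {set J} -> V) : j \notin D ->
  \sum_(Q in powerset (j |: D)) F Q = \sum_(Q in powerset D) (F Q + F (j |: Q)).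
Proof.
move=> jD; rewrite (bigID (fun Q : {set J} => j \in Q)) /= addrC big_split /=; congr (_ + _).
  apply: eq_bigl => Q; rewrite !powersetE.
  apply/andP/idP => [[QjD jQ]|QD].
    by rewrite -(finset.setU1K jD) finset.subsetD1 QjD.
  split; first by apply: fintype.subset_trans QD (finset.subsetUr _ _).
  by apply: contraNN jD; apply: (fintype.subsetP QD).
rewrite (reindex_onto (fun Q => j |: Q) (fun Q => Q :\ j)) /=; last first.
  by move=> Q /andP[_ jQ]; rewrite finset.setD1K.
apply: eq_bigl => Q; rewrite !powersetE setU11 andbT.
apply/andP/idP => [[QD /eqP e]|QD].
  have jQ : j \notin Q by rewrite -e in_setD1 eqxx.
  by rewrite -e -(finset.setU1K jD) finset.setSD.
have jQ : j \notin Q by apply: contraNN jD; apply: (fintype.subsetP QD).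
by rewrite finset.setUS// finset.setU1K.
Qed.

Lemma big_powersetU (V : nmodType) (D E : {set J}) (F : {set J} -> V) : ([disjoint D & E])%B ->
  \sum_(Q in powerset (D :|: E)) F Q =
  \sum_(Q1 in powerset D) \sum_(Q2 in powerset E) F (Q1 :|: Q2).
Proof.
have [h] := ubnP #|D|; elim: h D F => // h IH D F Dh DE.
have [->|/set0Pn[j jD]] := eqVneq D finset.set0.
  rewrite finset.set0U powerset0 finset.big_set1; apply: eq_bigr => Q _.
  by rewrite finset.set0U.
have jD' : j \notin D :\ j by rewrite in_setD1 eqxx.
have DE' : ([disjoint D :\ j & E])%B.
  by apply: disjointWl DE; rewrite finset.subD1set.
have jE : j \notin E by apply: contraTN jD => jE; rewrite (disjointFl DE jE).
have Dh' : (#|D :\ j| < h)%N by move: Dh; rewrite (cardsD1 j D) jD.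
have -> : D :|: E = j |: (D :\ j :|: E) by rewrite finset.setUA finset.setD1K.
rewrite big_powersetU1; last by rewrite finset.in_setU negb_or jD'.
rewrite IH// -[in RHS](finset.setD1K jD) big_powersetU1//; apply: eq_bigr => Q1 _.
by rewrite -big_split; apply: eq_bigr => Q2 _; rewrite finset.setUA.
Qed.

(** The real part of expanding the product of the factors [1 + e^(i d_j) = e^(i d_j / 2) * 2 cos
    (d_j / 2)], carried out with addition formulas. *)
Lemma sum_cos_subsets d D (v : R) :
  \sum_(Q in powerset D) cos (v + \sum_(j in Q) d j) =
  cos (v + \sum_(j in D) d j / 2) * \prod_(j in D) (2 * cos (d j / 2)).
Proof.
have [h] := ubnP #|D|; elim: h D v => // h IH D v Dh.
have [->|/set0Pn[j jD]] := eqVneq D finset.set0.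
  by rewrite powerset0 !finset.big_set1 !finset.big_set0 mulr1 !addr0.
have jD' : j \notin D :\ j by rewrite in_setD1 eqxx.
have Dh' : (#|D :\ j| < h)%N by move: Dh; rewrite (cardsD1 j D) jD.
rewrite -[in LHS](finset.setD1K jD) big_powersetU1// big_split /=.
rewrite IH//.
have -> : \sum_(Q in powerset (D :\ j)) cos (v + \sum_(i in j |: Q) d i) =
    \sum_(Q in powerset (D :\ j)) cos ((v + d j) + \sum_(i in Q) d i).
  apply: eq_bigr => Q; rewrite powersetE => QD; congr cos.
  rewrite finset.big_setU1 ?addrA//=; apply: contraNN jD'; exact: (fintype.subsetP QD).
rewrite IH// -mulrDl (big_setD1 j jD) [in RHS](big_setD1 j jD) /= mulrA; congr (_ * _).
set s := \sum_(i in _) _.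
have -> : v + s = (v + (d j / 2 + s)) - d j / 2 by ring.
have -> : v + d j + s = (v + (d j / 2 + s)) + d j / 2 by field.
by set x := v + (_ + s); rewrite (cosB x) (cosD x); ring.
Qed.


Lemma sum_indic_card (D : {set J}) (p : pred {set J}) :
  \sum_(Q in powerset D) (p Q)%:R = #|[set Q in powerset D | p Q]%SET|%:R :> R.
Proof.
rewrite -natr_sum -sum1_card; congr _%:R.
rewrite [LHS]big_mkcond [RHS]big_mkcond; apply: eq_bigr => Q _.
by rewrite [in RHS]finset.inE; case: (Q \in powerset D) => //=; case: (p Q).
Qed.

Lemma bin_le_sqrt n k : 'C(n, k)%:R * Num.sqrt n.+1%:R <= 2 ^+ n :> R.
Proof.
rewrite -ler_sqr ?nnegrE ?mulr_ge0 ?sqrtr_ge0 ?exprn_ge0// exprMn sqr_sqrtr//.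
by rewrite -exprM mulnC exprM -!natrX -natrM ler_nat bin_sqr_le.
Qed.

(* Erdos' argument: subset sums in a window shorter than every step form an
   antichain. *)
Lemma count_window d D (T v : R) : (forall j, j \in D -> T <= d j) -> 0 < T ->
  (\sum_(Q in powerset D) ((v <= \sum_(j in Q) d j) && (\sum_(j in Q) d j < v + T))%:R)
    * Num.sqrt #|D|.+1%:R <= 2 ^+ #|D| :> R.
Proof.
move=> dT T0; pose p (Q : {set J}) := (v <= \sum_(j in Q) d j) && (\sum_(j in Q) d j < v + T).
rewrite (sum_indic_card D p); set F := [set Q in powerset D | p Q]%SET.
have anti : {in F &, forall Q Q' : {set J}, ~~ (Q \proper Q')}.
  move=> Q Q'; rewrite !inE => /andP[_ /andP[vQ _]] /andP[Q'D /andP[_ Q'v]].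
  apply/negP => /properP[QQ' [j jQ' jQ]].
  move: Q'v; apply/negP; rewrite -leNgt (bigID (mem Q)) /=.
  apply: lerD.
    rewrite (eq_bigl (mem Q)) // => i /=.
    by apply/andP/idP => [[]//|iQ]; split => //; exact: (fintype.subsetP QQ').
  rewrite (bigD1 j) ?jQ' ?jQ//= -[T]addr0; apply: lerD.
    by apply: dT; exact: (fintype.subsetP Q'D).
  apply: sumr_ge0 => i /andP[/andP[iQ' _] _]; apply: le_trans (ltW T0) _.
  by apply: dT; exact: (fintype.subsetP Q'D).
have := LYM_inequality R D anti.
have -> : \sum_(Q in F | Q \subset D) ('C(#|D|, #|Q|)%:R : R)^-1 =
    \sum_(Q in F) ('C(#|D|, #|Q|)%:R : R)^-1.
  apply: eq_bigl => Q; rewrite andb_idr// inE => /andP[+ _].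
  by rewrite powersetE.
move=> lym; rewrite -[leRHS]mulr1.
apply: le_trans (_ : _ <= 2 ^+ #|D| * \sum_(Q in F) ('C(#|D|, #|Q|)%:R : R)^-1) _; last first.
  by rewrite ler_wpM2l// exprn_ge0.
rewrite mulr_sumr -sum1_card natr_sum mulr_suml.
apply: ler_sum => Q; rewrite inE powersetE => /andP[QD _].
by rewrite mul1r ler_pdivlMr ?ltr0n ?bin_gt0 ?subset_leq_card// mulrC bin_le_sqrt.
Qed.

Lemma sin_le_self (x : R) : 0 <= x -> sin x <= x.
Proof.
move=> x0; have [|c _] := @MVT_segment R sin cos 0 x x0.
  by apply: continuous_subspaceT => y; exact: continuous_sin.
rewrite sin0 !subr0 => ->; rewrite -[leRHS]mul1r ler_wpM2r// cos_le1.
Qed.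

Lemma norm_sin_le (x : R) : `|sin x| <= `|x|.
Proof.
wlog x0 : x / 0 <= x.
  move=> h; have [|/ltW x0] := leP 0 x; first exact: h.
  by rewrite -normrN -sinN -(normrN x) h// oppr_ge0.
have [x1|x1] := leP x 1; last by rewrite (le_trans (sin_max _))// ger0_norm// ltW.
rewrite !ger0_norm ?sin_le_self// sin_ge0_pi// x0 /= (le_trans x1)//.
by rewrite (le_trans _ (pi_ge2 _))// ler1n.
Qed.

Lemma cos_ge_half (x : R) : `|x| <= 1 -> 2^-1 <= cos x.
Proof.
move=> x1; have -> : x = (x / 2) *+ 2 by rewrite -mulr_natr divfK.
rewrite cos_mulr2n cos2sin2.
have : sin (x / 2) ^+ 2 <= 4^-1.
  rewrite -real_normK ?num_real//; apply: (@le_trans _ _ (2^-1 ^+ 2)); last by lra.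
  rewrite ler_sqr ?nnegrE//; apply: le_trans (norm_sin_le _) _.
  by rewrite normrM [`|2^-1|]ger0_norm// ler_pdivrMr// mulVf.
by rewrite -mulr_natr; lra.
Qed.

Lemma norm_sin_ge (x : R) : `|x| <= 1 -> `|x| / 2 <= `|sin x|.
Proof.
wlog x0 : x / 0 <= x.
  move=> h; have [|/ltW x0] := leP 0 x; first exact: h.
  by rewrite -(normrN x) -(normrN (sin x)) -sinN => /h; apply; rewrite oppr_ge0.
move=> x1; apply: le_trans (ler_norm _).
have [|c /itvP c0] := @MVT_segment R sin cos 0 x x0.
  by apply: continuous_subspaceT => y; exact: continuous_sin.
rewrite sin0 !subr0 => ->; rewrite (ger0_norm x0) mulrC ler_wpM2r//.
apply: cos_ge_half; rewrite ger0_norm ?c0// (le_trans _ x1)//.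
by rewrite (ger0_norm x0) c0.
Qed.

(** [cos^2 = 1 - sin^2 <= exp (- sin^2)], and [|sin x| >= |x| / 2] for [|x| <= 1], the range ensured
    by the bound on [phi]. The Gaussian bound is then weakened to a rational one, whose sum over
    frequencies is elementary. *)
Lemma prod_cos_le d D (T phi sigma2 : R) : 0 <= sigma2 ->
  (forall j, j \in D -> 0 <= d j <= T) -> `|phi| * T <= 1 ->
  sigma2 <= \sum_(j in D) d j ^+ 2 ->
  \prod_(j in D) `|cos (phi * d j / 2)| <= (1 + phi ^+ 2 * sigma2 / 32)^-1.
Proof.
move=> s0 dT phiT sD.
have V0 : 0 <= phi ^+ 2 * sigma2 / 32 by rewrite divr_ge0// mulr_ge0// sqr_ge0.
apply: (@le_trans _ _ (\prod_(j in D) expR (- (sin (phi * d j / 2) ^+ 2 / 2)))).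
  apply: ler_prod => j _; rewrite normr_ge0 /=.
  rewrite -ler_sqr ?nnegrE ?expR_ge0// real_normK ?num_real// cos2sin2 [leRHS]expr2 -expRD.
  have := expR_ge1Dx (- sin (phi * d j / 2) ^+ 2).
  set s := sin _ ^+ 2; have -> : - (s / 2) + - (s / 2) = - s by field.
  by [].
rewrite -expR_sum sumrN expRN lef_pV2 ?posrE ?expR_gt0 ?ltr_wpDr//.
apply: le_trans (expR_ge1Dx _); rewrite lerD2l.
apply: (@le_trans _ _ (\sum_(j in D) phi ^+ 2 * d j ^+ 2 / 32)).
  rewrite -mulr_suml -mulr_sumr ler_wpM2r ?invr_ge0// ler_wpM2l// sqr_ge0//.
apply: ler_sum => j jD; have /andP[d0 d1] := dT j jD.
have x1 : `|phi * d j / 2| <= 1.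
  rewrite !normrM (ger0_norm d0) [`|2^-1|]ger0_norm// ler_pdivrMr// mul1r.
  by rewrite (le_trans _ (_ : 1 <= 2 :> R)) ?ler1n// (le_trans _ phiT)// ler_wpM2l.
have h : (phi * d j / 2 / 2) ^+ 2 <= sin (phi * d j / 2) ^+ 2.
  rewrite -[leLHS]real_normK ?num_real// -[leRHS]real_normK ?num_real//.
  rewrite ler_sqr ?nnegrE// normrM [`|2^-1|]ger0_norm//.
  exact: norm_sin_ge.
apply: le_trans (_ : _ <= (phi * d j / 2 / 2) ^+ 2 / 2) _; last by rewrite ler_wpM2r.
by rewrite le_eqVlt; apply/orP; left; apply/eqP; field.
Qed.

(** The summable kernel [1 / ((k + 1)(k + 2))] is used because it telescopes; each side of [r]
    contributes at most 1. *)
Lemma sum_kernel_le (N r : nat) : (r < N)%N ->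
  \sum_(0 <= i < N) (((`|(r%:Z - i%:Z)|%N).+1 * (`|(r%:Z - i%:Z)|%N).+2)%:R)^-1 <= 2 :> R.
Proof.
have tele m : \sum_(0 <= k < m) ((k.+1 * k.+2)%:R)^-1 <= 1 :> R.
  rewrite (@telescope_sumr_eq _ _ _ (fun k => - (k.+1%:R)^-1))//.
    by rewrite opprK invr1 gerDr oppr_le0 invr_ge0.
  move=> k _; rewrite natrM opprK addrC.
  have : 0 < k.+1%:R :> R by rewrite ltr0n.
  rewrite -[k.+2%:R]natr1; move: (k.+1%:R : R) => x x0.
  have x1 : x + 1 != 0 by rewrite gt_eqF// ltr_wpDr.
  have x2 : x != 0 by rewrite gt_eqF.
  by field; rewrite ?x1 ?x2.
move=> rN; rewrite (@big_cat_nat _ _ _ r)//=; last exact: ltnW.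
have -> : 2 = 1 + 1 :> R by [].
apply: lerD.
  rewrite big_nat_rev /= add0n.
  apply: (@le_trans _ _ (\sum_(0 <= k < r) ((k.+2 * k.+3)%:R)^-1)).
    rewrite [leLHS]big_nat_cond [leRHS]big_nat_cond; apply: ler_sum => k /andP[/andP[_ kr] _].
    by have -> : `|(r%:Z - (r - k.+1)%N%:Z)|%N = k.+1 by lia.
  apply: le_trans (tele r.+1); rewrite big_nat_recl// lerDr invr_ge0 ler0n//.
rewrite -{1}[r]add0n big_addn.
apply: le_trans (tele (N - r)%N); apply: ler_sum => k _.
by have -> : `|(r%:Z - (k + r)%N%:Z)|%N = k by lia.
Qed.

Lemma sum_cos_le d D (T u phi sigma2 : R) : 0 <= sigma2 ->
  (forall j, j \in D -> 0 <= d j <= T) -> `|phi| * T <= 1 ->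
  sigma2 <= \sum_(j in D) d j ^+ 2 ->
  \sum_(Q in powerset D) cos (phi * (\sum_(j in Q) d j - u)) <=
    2 ^+ #|D| * (1 + phi ^+ 2 * sigma2 / 32)^-1.
Proof.
move=> s0 dT phiT sD.
have -> : \sum_(Q in powerset D) cos (phi * (\sum_(j in Q) d j - u)) =
    \sum_(Q in powerset D) cos (- (phi * u) + \sum_(j in Q) phi * d j).
  by apply: eq_bigr => Q _; rewrite -mulr_sumr mulrBr addrC.
rewrite (sum_cos_subsets (fun j => phi * d j)); apply: le_trans (ler_norm _) _.
rewrite normrM -[leRHS]mul1r ler_pM ?normr_ge0 ?cos_max// big_split /= normrM.
rewrite prodr_const normrX [`|2|]ger0_norm// ler_wpM2l ?exprn_ge0// normr_prod.
exact: (@prod_cos_le d D T phi sigma2).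
Qed.

Lemma kernel_le (k : nat) : (1 + k%:R ^+ 2 / 128)^-1 <= 256 / (k.+1 * k.+2)%:R :> R.
Proof.
have k1 : 0 < (k.+1 * k.+2)%:R :> R by rewrite ltr0n.
have k2 : 0 < 1 + k%:R ^+ 2 / 128 :> R.
  by rewrite ltr_pwDl// divr_ge0// sqr_ge0.
rewrite ler_pdivlMr// mulrC ler_pdivrMr//.
rewrite natrM -[k.+2%:R]natr1 -[k.+1%:R]natr1; have : 0 <= k%:R :> R by [].
move: (k%:R : R) => x x0.
have : 0 <= (x - 3 / 2) ^+ 2 by exact: sqr_ge0.
by nra.
Qed.

Lemma norm_natrB (a b : nat) : `|a%:R - b%:R : R| = (`|(a%:Z - b%:Z)|%N)%:R.
Proof.
have [ab|/ltnW ab] := leqP b a.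
  by rewrite ger0_norm ?subr_ge0 ?ler_nat// -natrB//; congr _%:R; lia.
by rewrite ler0_norm ?subr_le0 ?ler_nat// opprB -natrB//; congr _%:R; lia.
Qed.

Lemma absz_sub_le (a b c : nat) : (a < c)%N -> (b < c)%N -> (`|(a%:Z - b%:Z)|%N <= c)%N.
Proof. lia. Qed.

(* Esseen's argument with a discrete Fejer kernel instead of an integral. *)
Lemma count_small_steps d D (T u sigma : R) : 0 < T -> 0 < sigma ->
  (forall j, j \in D -> 0 <= d j <= T) -> sigma ^+ 2 <= \sum_(j in D) d j ^+ 2 ->
  (\sum_(Q in powerset D) (`|\sum_(j in Q) d j - u| <= T)%R%:R) * sigma <=
    2 ^+ 11 * T * 2 ^+ #|D| :> R.
Proof.
move=> T0 s0 dT sD.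
set cnt := \sum_(Q in _) _.
have cnt0 : 0 <= cnt by apply: sumr_ge0 => Q _; rewrite ler0n.
have cnt_le : cnt <= 2 ^+ #|D|.
  rewrite /cnt (sum_indic_card D (fun Q : {set J} => `|\sum_(j in Q) d j - u| <= T)).
  rewrite -natrX ler_nat -card_powerset; apply: subset_leq_card.
  by apply/fintype.subsetP => Q; rewrite inE => /andP[].
have [sT|sT] := ltP sigma T.
  rewrite mulrC; apply: ler_pM => //; first exact: ltW.
  apply: le_trans (ltW sT) _; apply: ler_peMl; first exact: ltW.
  by apply: exprn_ege1; rewrite ler1n.
pose N := (Num.truncn (sigma / T)).+1.
have N0 : 0 < N%:R :> R by rewrite ltr0n.
have NsT : sigma / T < N%:R by exact: truncnS_gt.
have N2 : N%:R <= 2 * (sigma / T).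
  have sT1 : 1 <= sigma / T by rewrite ler_pdivlMr// mul1r.
  rewrite /N -natr1; have /andP[h _] := truncn_itv (le_trans ler01 sT1).
  by move: h sT1; lra.
(* The frequencies are multiples of [theta] up to [1 / T]. Inside the window all phases are then at
   most 1, so every cosine is at least [1 / 2], and [prod_cos_le] applies to all frequency
   differences. Moreover [N <= 2 * sigma / T] gives [theta * sigma >= 1 / 2]. *)
pose theta := (N%:R * T)^-1.
have th0 : 0 < theta by rewrite invr_gt0 mulr_gt0.
have thNT : theta * N%:R * T = 1 by rewrite /theta; field; rewrite !gt_eqF.
pose s (Q : {set J}) := \sum_(j in Q) d j - u.
(* The squared modulus of the sum of [e^(i r theta s)]: nonnegative everywhere, at least [(N / 2)^2]
   on the window, and a sum of cosines of frequency differences. *)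
pose fej (Q : {set J}) := (\sum_(0 <= r < N) cos (r%:R * theta * s Q)) ^+ 2 +
  (\sum_(0 <= r < N) sin (r%:R * theta * s Q)) ^+ 2.
have fej_ge Q : (N%:R / 2) ^+ 2 * (`|s Q| <= T)%R%:R <= fej Q.
  have [sQ|_] := leP `|s Q| T; last by rewrite mulr0 addr_ge0// sqr_ge0.
  have h : N%:R / 2 <= \sum_(0 <= r < N) cos (r%:R * theta * s Q).
    have -> : N%:R / 2 = \sum_(0 <= r < N) 2^-1 :> R.
      by rewrite sumr_const_nat subn0 mulr_natl.
    rewrite [leLHS]big_nat_cond [leRHS]big_nat_cond; apply: ler_sum => r /andP[/andP[_ rN] _].
    apply: cos_ge_half; rewrite !normrM (ger0_norm (ltW th0)) ger0_norm//.
    rewrite -[leRHS]thNT [theta * _]mulrC; apply: ler_pM => //.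
      by rewrite mulr_ge0// ltW.
    by rewrite ler_wpM2r ?ltW// ltr_nat.
  rewrite mulr1 -[leLHS]addr0; apply: lerD; last exact: sqr_ge0.
  by rewrite ler_sqr ?nnegrE// (le_trans _ h) ?divr_ge0.
have fejE Q : fej Q = \sum_(0 <= r < N) \sum_(0 <= r' < N)
    cos ((r%:R - r'%:R) * theta * s Q).
  rewrite /fej !expr2 !big_distrlr /= -big_split /=; apply: eq_bigr => r _.
  rewrite -big_split /=; apply: eq_bigr => r' _.
  by rewrite -cosB; congr cos; ring.
have main : (N%:R / 2) ^+ 2 * cnt <= 2 ^+ #|D| * 256 * (2 * N%:R).
  rewrite /cnt mulr_sumr.
  apply: (@le_trans _ _ (\sum_(Q in powerset D) fej Q)).
    by apply: ler_sum => Q _; exact: fej_ge.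
  under eq_bigr do rewrite fejE.
  rewrite exchange_big /=.
  under eq_bigr do rewrite exchange_big /=.
  have -> : 2 ^+ #|D| * 256 * (2 * N%:R) = \sum_(0 <= r < N) 2 ^+ #|D| * 256 * 2 :> R.
    by rewrite sumr_const_nat subn0 -[RHS]mulr_natr mulrA.
  rewrite [leLHS]big_nat_cond [leRHS]big_nat_cond; apply: ler_sum => r /andP[/andP[_ rN] _].
  apply: le_trans (_ : _ <= 2 ^+ #|D| * 256 * \sum_(0 <= i < N)
    (((`|(r%:Z - i%:Z)|%N).+1 * (`|(r%:Z - i%:Z)|%N).+2)%:R)^-1) _; last first.
    by apply: ler_wpM2l; [rewrite mulr_ge0// exprn_ge0|exact: sum_kernel_le].
  rewrite mulr_sumr [leLHS]big_nat_cond [leRHS]big_nat_cond.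
  apply: ler_sum => r' /andP[/andP[_ r'N] _].
  set k := `|(r%:Z - r'%:Z)|%N.
  have kE : `|r%:R - r'%:R : R| = k%:R.
    exact: norm_natrB.
  have kN : (k <= N)%N by exact: absz_sub_le.
  apply: le_trans (@sum_cos_le d D T u ((r%:R - r'%:R) * theta) (sigma ^+ 2)
    (sqr_ge0 sigma) dT _ sD) _.
    rewrite normrM kE (ger0_norm (ltW th0)) -[leRHS]thNT [theta * _]mulrC.
    by rewrite ler_wpM2r ?(ltW T0)// ler_wpM2r ?(ltW th0)// ler_nat.
  rewrite -[leRHS]mulrA; apply: ler_wpM2l; first exact: exprn_ge0.
  apply: le_trans (kernel_le k).
  rewrite lef_pV2 ?posrE; last 2 first.
  - by rewrite ltr_wpDr// divr_ge0// mulr_ge0// sqr_ge0.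
  - by rewrite ltr_wpDr// divr_ge0// sqr_ge0.
  rewrite lerD2l exprMn -[_ ^+ 2 in leRHS]real_normK ?num_real// kE.
  have h : 4^-1 <= theta ^+ 2 * sigma ^+ 2.
    rewrite -exprMn; have -> : 4^-1 = (2^-1) ^+ 2 :> R by field.
    rewrite ler_sqr ?nnegrE ?mulr_ge0 ?(ltW th0) ?(ltW s0)//.
    rewrite /theta mulrC ler_pdivlMr ?mulr_gt0// mulrA.
    by rewrite -ler_pdivlMr// mulrC ler_pdivrMr//; move: N2; lra.
  have k0 : 0 <= k%:R ^+ 2 :> R by exact: sqr_ge0.
  move: (k%:R ^+ 2 : R) k0 h => x x0 h.
  have -> : x * theta ^+ 2 * sigma ^+ 2 / 32 = x * (theta ^+ 2 * sigma ^+ 2) / 32 by ring.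
  move: (theta ^+ 2 * sigma ^+ 2) h => y y0.
  by nra.
have m2 : N%:R * cnt <= 2 ^+ 11 * 2 ^+ #|D|.
  rewrite -(ler_pM2l N0); move: main; set p := 2 ^+ #|D|; move: (N%:R : R) => x.
  by lra.
apply: le_trans (_ : _ <= cnt * (T * N%:R)) _.
  apply: ler_wpM2l => //; rewrite mulrC -ler_pdivrMr//; exact: ltW.
rewrite [cnt * _]mulrC -[leLHS]mulrA [2 ^+ 11 * T]mulrC -[leRHS]mulrA.
apply: ler_wpM2l; first exact: ltW.
exact: m2.
Qed.

(** Steps of size at least [T] are separated from smaller ones, and the class that carries half of
    the truncated squares is used while the subsets of the other are fixed. Large steps fall under
    the antichain argument, small ones under the Fejer kernel. *)
Lemma littlewood_offord d (T u w : R) : (forall j, 0 <= d j) -> 0 < T -> 0 < w ->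
  w ^+ 2 <= \sum_j Num.min (d j) T ^+ 2 ->
  (\sum_(Q : {set J}) (`|\sum_(j in Q) d j - u| <= T)%R%:R) * w <=
    2 ^+ 12 * T * 2 ^+ #|J| :> R.
Proof.
move=> d0 T0 w0 wd.
pose B := [set j | T <= d j]%SET; pose S := (~: B)%SET.
have dBS : ([disjoint B & S])%B by rewrite finset.disjoints_subset finset.setCK fintype.subxx.
have BSJ : (B :|: S)%SET = [set: J]%SET by rewrite /S finset.setUCr.
have cBS : (#|B| + #|S| = #|J|)%N by rewrite cardsC.
pose f (Q : {set J}) : R := (`|\sum_(j in Q) d j - u| <= T)%R%:R.
have -> : \sum_(Q : {set J}) (`|\sum_(j in Q) d j - u| <= T)%R%:R =
    \sum_(Q1 in powerset B) \sum_(Q2 in powerset S) f (Q1 :|: Q2)%SET :> R.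
  rewrite -big_powersetU// BSJ; apply: eq_bigl => Q.
  by rewrite powersetE finset.subsetT.
have sumU Q1 Q2 : Q1 \subset B -> Q2 \subset S ->
    \sum_(j in (Q1 :|: Q2)%SET) d j = \sum_(j in Q1) d j + \sum_(j in Q2) d j.
  move=> Q1B Q2S; rewrite (eq_bigl [predU Q1 & Q2]); last by move=> j; rewrite !inE.
  rewrite bigU//=.
  by apply: disjointWl Q1B _; apply: disjointWr Q2S _.
have wBS : w ^+ 2 <= T ^+ 2 * #|B|%:R + \sum_(j in S) d j ^+ 2.
  apply: le_trans wd _; rewrite (bigID (mem B)) /=; apply: lerD.
    rewrite [leRHS]mulr_natr -sumr_const; apply: ler_sum => j.
    by rewrite inE => jB; rewrite (min_idPr jB).
  rewrite le_eqVlt; apply/orP; left; apply/eqP; apply: eq_big => [j|j]; rewrite !inE//.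
  by rewrite -ltNge => /ltW/min_idPl ->.
have [big|small] := leP (w ^+ 2) (2 * (T ^+ 2 * #|B|%:R)).
  rewrite exchange_big /= mulr_suml -cBS addnC exprD mulrA.
  have -> : 2 ^+ #|S| = \sum_(Q2 in powerset S) 1 :> R.
    by rewrite sumr_const card_powerset -natrX.
  rewrite mulrAC mulr_sumr; apply: ler_sum => Q2; rewrite powersetE => Q2S.
  rewrite mulr1.
  set v := u - \sum_(j in Q2) d j.
  (* The closed interval of radius [T] is covered by three half-open windows of length [T]; the
     third one only serves the right endpoint. *)
  pose win (v : R) (Q : {set J}) : R := ((v <= \sum_(j in Q) d j) && (\sum_(j in Q) d j < v + T))%:R.
  apply: (@le_trans _ _ ((\sum_(Q1 in powerset B)
     (win (v - T) Q1 + win v Q1 + win (v + T) Q1)) * w)).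
    apply: ler_wpM2r; first exact: ltW.
    apply: ler_sum => Q1; rewrite powersetE => Q1B.
    rewrite /f sumU//; set x := \sum_(j in Q1) _.
    have -> : x + \sum_(j in Q2) d j - u = x - v by rewrite /v; ring.
    rewrite /win -/x -!natrD ler_nat ler_norml.
    case: (leP (v - T) x) => h1; case: (ltP x (v - T + T)) => h2;
    case: (leP v x) => h3; case: (ltP x (v + T)) => h4;
    case: (leP (v + T) x) => h5; case: (ltP x (v + T + T)) => h6;
    case: (leP (- T) (x - v)) => h7; case: (leP (x - v) T) => h8 //=; exfalso;
    move: h1 h2 h3 h4 h5 h6 h7 h8 T0; clear; lra.
  have cw v' : (\sum_(Q1 in powerset B) win v' Q1) * w <= 2 * T * 2 ^+ #|B|.
    have := @count_window d B T v' _ T0; rewrite -/(win v' _).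
    case/(_ _)/wrap => [j|h]; first by rewrite inE.
    have wT : w <= 2 * T * Num.sqrt #|B|.+1%:R.
      rewrite -ler_sqr ?nnegrE ?mulr_ge0 ?sqrtr_ge0 ?(ltW w0) ?(ltW T0)//.
      rewrite !exprMn sqr_sqrtr//; apply: le_trans big _; rewrite -natr1.
      have T20 := sqr_ge0 T; have B0 : 0 <= #|B|%:R :> R by [].
      by have := mulr_ge0 T20 B0; move: T20; rewrite [2 ^+ 2]expr2; lra.
    apply: le_trans (ler_wpM2l _ wT) _.
      by apply: sumr_ge0 => Q _; rewrite ler0n.
    by rewrite mulrCA; apply: ler_wpM2l => //; rewrite mulr_ge0// ltW.
  rewrite !big_split /= !mulrDl.
  apply: le_trans (lerD (lerD (cw _) (cw _)) (cw _)) _.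
  have : 0 <= T * 2 ^+ #|B| by rewrite mulr_ge0 ?exprn_ge0// ltW.
  rewrite -!mulrA; move: (T * _) => x x0.
  by lra.
rewrite mulr_suml -cBS exprD.
have -> : 2 ^+ #|B| = \sum_(Q2 in powerset B) 1 :> R.
  by rewrite sumr_const card_powerset -natrX.
rewrite mulr_suml mulr_sumr; apply: ler_sum => Q1; rewrite powersetE => Q1B.
rewrite mul1r.
have Ssum : (w / 2) ^+ 2 <= \sum_(j in S) d j ^+ 2.
  by rewrite expr_div_n; move: wBS small (sqr_ge0 w); lra.
have dT j : j \in S -> 0 <= d j <= T.
  by rewrite !inE -ltNge d0 => /ltW ->.
have := count_small_steps (u - \sum_(j in Q1) d j) T0 (divr_gt0 w0 (ltr0n _ 2)) dT Ssum.
have -> : \sum_(Q2 in powerset S) f (Q1 :|: Q2)%SET = \sum_(Q in powerset S)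
    (`|\sum_(j in Q) d j - (u - \sum_(j in Q1) d j)| <= T)%R%:R.
  apply: eq_bigr => Q2; rewrite powersetE => Q2S; rewrite /f sumU//.
  by congr (nat_of_bool (`|_| <= _))%:R; ring.
rewrite mulrA ler_pdivrMr// => /le_trans; apply.
rewrite le_eqVlt; apply/orP; left; apply/eqP; rewrite [2 ^+ 12]exprS; ring.
Qed.

End SubsetSums.

Lemma card_sets (J : finType) : #|{set J}| = (2 ^ #|J|)%N.
Proof.
rewrite -(cardsT J) -card_powerset; apply: eq_card => Q.
by rewrite powersetE finset.subsetT.
Qed.

(** * Small ball estimate for linear forms in entries of bounded density *)

Section LinearForms.
Context (R : realType) (I : finType) (tr : I -> I) (K : R).
Context (d : measure_display) (T : measurableType d) (P : probability T R).
Variable X : T -> config R I.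
Hypothesis M : entry_model tr K P X.
Local Notation cfg := (config R I).

Let K0 : 0 < K. Proof. exact: lt_le_trans ltr01 (em_K M). Qed.

Lemma measurable_preX (F : set cfg) : measurable F -> measurable [set t | F (X t)].
Proof.
move=> mF; rewrite -[X in measurable X]setTI.
exact: (measurable_X (em_measurable M)).
Qed.

Lemma measurable_preMix Q (a : cfg) (F : set cfg) :
  measurable F -> measurable [set t | F (mix Q a (X t))].
Proof.
move=> mF; rewrite -[X in measurable X]setTI.
exact: (measurable_mixX (em_measurable M)).
Qed.

(** Each resampling pattern leaves the probability of [F] unchanged, so it equals the average over
    [l], and only the sum over [l] has to be bounded for fixed kept entries. With one pattern this
    is a conditional bound; with all subsets it yields a Rademacher sum. *)
Lemma decoupling_average (L : finType) (Qf : L -> {set I}) (Z : {set I}) (F : set cfg) (beta : R) :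
  (0 < #|L|)%N -> (forall l, free_set tr (Qf l)) ->
  (forall l p, p \in Qf l -> tr p \in Z -> tr p \in Qf l) ->
  measurable F -> depends_on Z F ->
  (forall a, \sum_(l : L) P [set t | F (mix (Qf l) a (X t))] <= (#|L|%:R * beta)%:E)%E ->
  (P [set t | F (X t)] <= beta%:E)%E.
Proof.
move=> L0 Qfree QZ mF dF hb.
have mI : measurable_fun [set: cfg] (fun a => (\1_F a : R)%:E).
  by apply/measurable_EFinP; exact: measurable_indic.
have dI : depends_on Z (fun a => (\1_F a : R)%:E).
  move=> a b /dF ab; rewrite !indicE; congr (nat_of_bool _)%:R%:E.
  by apply/idP/idP; rewrite !inE ab.
have PE : (P [set t | F (X t)] = \int[P]_t (\1_F (X t) : R)%:E)%E.
  by rewrite integral_set_fun//; exact: (measurable_X (em_measurable M)).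
have Pl l : (P [set t | F (X t)] = \int[P]_t' P [set t | F (mix (Qf l) (X t') (X t))])%E.
  have I0 (a : cfg) : (0 <= (\1_F a : R)%:E)%E by rewrite lee_fin indicE ler0n.
  rewrite PE (decoupling (em_measurable M) (em_indep M) (Qfree l) (QZ l) mI I0 dI).
  by apply: eq_integral => t' _; rewrite integral_set_fun//; exact: (measurable_mixX (em_measurable M)).
have mPl l : measurable_fun [set: T] (fun t' => P [set t | F (mix (Qf l) (X t') (X t))]).
  have -> : (fun t' => P [set t | F (mix (Qf l) (X t') (X t))]) =
      (fun t' => \int[P]_t (\1_F (mix (Qf l) (X t') (X t)) : R)%:E)%E.
    by apply/funext => t'; rewrite integral_set_fun//; exact: (measurable_mixX (em_measurable M)).
  apply: (@measurable_fun_fubini_tonelli_F _ _ _ _ _ P (fun z => (\1_F (mix (Qf l) (X z.1) (X z.2)) : R)%:E)).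
    by apply: (measurableT_comp mI); exact: (measurable_mixXX (em_measurable M)).
  by move=> z; rewrite lee_fin indicE ler0n.
have L0' : 0 < #|L|%:R :> R by rewrite ltr0n.
have pm : (P [set t | F (X t)] \is a fin_num)%E.
  by apply: fin_num_measure; exact: measurable_preX.
rewrite -(fineK pm) lee_fin -(ler_pM2l L0') -lee_fin.
apply: (@le_trans _ _ (\int[P]_t' (\sum_(l : L) P [set t | F (mix (Qf l) (X t') (X t))]))%E).
  rewrite ge0_integral_sum//.
  rewrite EFinM fineK// (eq_bigr (fun=> P [set t | F (X t)])); last by move=> l _; rewrite -Pl.
  by rewrite -(fineK pm) sumEFin sumr_const -EFinM mulr_natl.
rewrite -[leRHS](integral_prob_cst P); apply: ge0_le_integral => //.
- by move=> t _; apply: sume_ge0.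
- by apply: emeasurable_sum.
Qed.

Section OneForm.
Variables (J : finType) (e : J -> I) (y : J -> R).
Hypothesis e_inj : injective e.
Hypothesis e_free : free_set tr [set e j | j in J]%SET.

Definition form_event (u r : R) : set cfg := [set a | `|\sum_j y j * a (e j) - u| <= r].

Lemma measurable_form_event u r : measurable (form_event u r).
Proof.
apply: measurable_sublevel; apply: measurableT_comp => //; apply: measurable_funB => //.
by apply: measurable_sum => j; apply: measurable_funM => //; exact: measurable_coord.
Qed.

Lemma depends_form_event u r : depends_on [set e j | j in J]%SET (form_event u r).
Proof.
move=> a b ab; rewrite /form_event /=; congr (is_true (`|_ - _| <= _)).
by apply: eq_bigr => j _; rewrite ab// imset_f.
Qed.

Lemma free_sub (Q : {set J}) : free_set tr (e @: Q).
Proof.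
move=> p q /imsetP[i iQ ->] /imsetP[k kQ ->] h.
by apply: e_free h; rewrite imset_f.
Qed.

Lemma closed_sub (Q : {set J}) p : p \in e @: Q -> tr p \in [set e j | j in J]%SET ->
  tr p \in e @: Q.
Proof.
move=> pQ trJ; have pJ : p \in [set e j | j in J]%SET.
  by case/imsetP: pQ => j _ ->; rewrite imset_f.
by rewrite (e_free pJ trJ).
Qed.

Lemma entry_interval_prob p (x u r : R) : x != 0 -> 0 <= r ->
  (P [set t | `|x * X t p - u| <= r]%R <= (2 * K * (r / `|x|))%:E)%E.
Proof.
move=> x0 r0; have nx : 0 < `|x| by rewrite normr_gt0.
have -> : [set t | `|x * X t p - u| <= r] = [set t | `|X t p - u / x| <= r / `|x|].
  apply/seteqP; split => t /=; rewrite ler_pdivlMr// -normrM mulrBl divfK//;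
    by rewrite [X t p * x]mulrC.
by apply: (em_density M); rewrite divr_ge0.
Qed.

Lemma large_coefficient_prob j (u r : R) : y j != 0 -> 0 <= r ->
  (P [set t | form_event u r (X t)] <= (2 * K * (r / `|y j|))%:E)%E.
Proof.
move=> yj r0.
apply: (@decoupling_average unit (fun=> (e @: [set j])%SET) [set e j | j in J]%SET (form_event u r)).
- by rewrite card_unit.
- by move=> _; exact: free_sub.
- by move=> _ p; exact: closed_sub.
- exact: measurable_form_event.
- exact: depends_form_event.
move=> a; rewrite card_unit mul1r (big_pred1 tt); last by case.
have key t : \sum_i y i * mix (e @: [set j]%SET) a (X t) (e i) - u =
    y j * X t (e j) - (u - \sum_(i | i != j) y i * a (e i)).
  rewrite (bigD1 j)//= {1}/mix imset_f ?finset.inE//.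
  rewrite opprB addrA; congr (_ + _ - _).
  apply: eq_bigr => i ij; rewrite /mix mem_imset// finset.inE (negPf ij)//.
set W := [set t | _].
have -> : W = [set t | `|y j * X t (e j) - (u - \sum_(i | i != j) y i * a (e i))| <= r].
  by apply/seteqP; split => t; rewrite /W /form_event /= key.
exact: entry_interval_prob.
Qed.

Lemma mix_sum (a b : cfg) (Q : {set J}) :
  \sum_j y j * mix (e @: Q) a b (e j) = \sum_j y j * (if j \in Q then b (e j) else a (e j)).
Proof. by apply: eq_bigr => j _; rewrite /mix mem_imset. Qed.

(* Resampling independently each coordinate turns the form into a Rademacher
   sum with steps [|y_j (b_j - a_j)|]. *)
Lemma resampling_count (a b : cfg) (u r w : R) : 0 < r -> 0 < w ->
  w ^+ 2 <= \sum_j Num.min `|y j * (b (e j) - a (e j))| r ^+ 2 ->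
  \sum_(Q : {set J}) (\1_(form_event u r) (mix (e @: Q) a b) : R) <=
    2 ^+ #|J| * (2 ^+ 12 * r / w).
Proof.
move=> r0 w0 wd.
pose dj j : R := `|y j * (b (e j) - a (e j))|.
pose N0 := [set j | y j * (b (e j) - a (e j)) < 0]%SET.
pose lo j : R := Num.min (y j * a (e j)) (y j * b (e j)).
(* Toggling the coordinates whose increment is negative makes all steps nonnegative: the form
   becomes the sum of the smaller values plus a subset sum over [sd Q]. *)
pose sd (Q : {set J}) := [set j | (j \in Q) (+) (j \in N0)]%SET.
have sdK : involutive sd.
  by move=> Q; apply/setP => j; rewrite !inE -addbA addbb addbF.
have sE (Q : {set J}) : \sum_j y j * mix (e @: Q) a b (e j) = \sum_j lo j + \sum_(j in sd Q) dj j.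
  rewrite mix_sum [X in _ + X]big_mkcond -big_split /=; apply: eq_bigr => j _.
  rewrite finset.inE /lo /dj; have -> : (j \in N0) = (y j * (b (e j) - a (e j)) < 0) by rewrite finset.inE.
  rewrite mulrBr subr_lt0.
  case: (ltP (y j * b (e j)) (y j * a (e j))) => h.
    rewrite ler0_norm ?subr_le0 ?ltW//.
    by case: (j \in Q) => /=; ring.
  rewrite ger0_norm ?subr_ge0//.
  by case: (j \in Q) => /=; ring.
have := @littlewood_offord R J dj r (u - \sum_j lo j) w (fun j => normr_ge0 _) r0 w0 wd.
rewrite -ler_pdivlMr// => h.
have -> : 2 ^+ #|J| * (2 ^+ 12 * r / w) = 2 ^+ 12 * r * 2 ^+ #|J| / w :> R.
  by move: (2 ^+ #|J| : R) (2 ^+ 12 : R) => x z; field; rewrite gt_eqF.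
apply: le_trans h; rewrite le_eqVlt; apply/orP; left; apply/eqP.
rewrite [RHS](reindex_inj (inv_inj sdK)) /=; apply: eq_bigr => Q _.
rewrite indicE; congr (nat_of_bool _)%:R.
apply/idP/idP; rewrite inE /form_event /= sE; set x := \sum_j lo j; set z := \sum_(j in _) _;
  by have -> : x + z - u = z - (u - x) by ring.
Qed.

(** Two distinct entries of a free family are independent, hence the square off the diagonal. *)
Lemma near_pair_prob (a : cfg) (c : R) i j : 0 < c ->
  (\int[P]_t ((`|X t (e i) - a (e i)| <= c)%R%:R * (`|X t (e j) - a (e j)| <= c)%R%:R)%:E <=
    (if i == j then 2 * K * c else (2 * K * c) ^+ 2)%:E)%E.
Proof.
move=> c0.
pose Zs (j : J) : set cfg := [set b | `|b (e j) - a (e j)| <= c].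
have mZ k : measurable (Zs k).
  apply: measurable_sublevel; apply: measurableT_comp => //; apply: measurable_funB => //.
  exact: measurable_coord.
have ZE k (b : cfg) : (`|b (e k) - a (e k)| <= c)%R%:R = \1_(Zs k) b :> R.
  by rewrite indicE; congr (nat_of_bool _)%:R; apply/idP/idP; rewrite inE.
have PZ k : (\int[P]_t (\1_(Zs k) (X t) : R)%:E <= (2 * K * c)%:E)%E.
  rewrite integral_set_fun//; last exact: (measurable_X (em_measurable M)).
  by apply: (em_density M (e k) (a (e k))); exact: ltW.
under eq_integral do rewrite !ZE.
case: eqP => [->|ij].
  rewrite (eq_integral (fun t => (\1_(Zs j) (X t) : R)%:E))//.
  by move=> t _; rewrite indicE; case: (_ \in _); rewrite ?mulr1 ?mulr0.
apply: (@le_trans _ _ ((2 * K * c)%:E * \int[P]_t (\1_(Zs j) (X t) : R)%:E)%E); last first.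
  rewrite expr2 [X in (_ <= X)%E]EFinM; apply: lee_wpmul2l; last exact: PZ.
  by rewrite lee_fin !mulr_ge0// ltW.
have dZ k : depends_on [set e k]%SET (\1_(Zs k) : cfg -> R).
  by move=> b b' bb'; rewrite -!ZE bb'// finset.inE.
have eJ k : e k \in [set e j | j in J]%SET by rewrite imset_f.
apply: (em_decoupling_le M (Q := [set e i]%SET) (Z1 := [set e i]%SET) (Z2 := [set e j]%SET)
  (g1 := \1_(Zs i)) (g2 := \1_(Zs j))) => //.
- by move=> p q; rewrite !finset.inE => /eqP -> /eqP ->.
- move=> p; rewrite !finset.inE => /eqP ->; rewrite (inj_eq e_inj); apply/andP; split.
    exact/eqP.
  apply/eqP => h; apply: ij; apply: e_inj; apply/esym.
  by apply: e_free => //; rewrite h.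
- by rewrite !mulr_ge0// ltW.
move=> b; rewrite integral_set_fun//; last exact: (measurable_mixX (em_measurable M)).
have -> : (fun t => mix [set e i]%SET b (X t)) @^-1` Zs i = [set t | `|X t (e i) - a (e i)| <= c].
  by apply/seteqP; split => t; rewrite /Zs /mix /= finset.inE eqxx.
by apply: (em_density M); exact: ltW.
Qed.

(* Either one coefficient exceeds [c^3] and the density of a single entry is
   enough, or all are small and, resampling, the Littlewood-Offord bound at scale
   [c^3] applies unless too many entries move by less than [c], which has
   probability [O(K^2 c^2)] by a second moment. *)
Lemma linear_form_small_ball (u c : R) : \sum_j y j ^+ 2 = 1 -> 0 < c ->
  (P [set t | form_event u (c ^+ 5) (X t)] <= (2 ^+ 14 * K ^+ 2 * c ^+ 2)%:E)%E.
Proof.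
move=> y1 c0; have K1 := em_K M.
have K2 : 1 <= K ^+ 2 by exact: exprn_ege1.
have [c1|c1] := ltP 1 c.
  apply: le_trans (probability_le1 P _) _.
    by apply: measurable_preX; exact: measurable_form_event.
  rewrite lee_fin; apply: mulr_ege1; last by apply: exprn_ege1; exact: ltW.
  by apply: mulr_ege1 => //; apply: exprn_ege1; rewrite ler1n.
(* The threshold [c ^+ 3] balances the two cases: a coefficient of that size gives [c^5 / c^3], and
   Littlewood-Offord at scale [c^3] with total step size of order [c] gives [c^3 / c]. *)
have [[j yj]|small] := pselect (exists j, c ^+ 3 <= `|y j|).
  have c3 : 0 < c ^+ 3 by exact: exprn_gt0.
  have yj0 : y j != 0 by rewrite -normr_gt0 (lt_le_trans c3).
  apply: le_trans (large_coefficient_prob u yj0 (exprn_ge0 5 (ltW c0))) _.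
  rewrite lee_fin; apply: (@le_trans _ _ (2 * K * c ^+ 2)).
    apply: ler_wpM2l; first by rewrite mulr_ge0// ltW.
    rewrite ler_pdivrMr ?normr_gt0//.
    have -> : c ^+ 5 = c ^+ 2 * c ^+ 3 by rewrite -exprD.
    by rewrite ler_wpM2l// sqr_ge0.
  apply: ler_wpM2r; first exact: sqr_ge0.
  apply: ler_pM => //; first exact: ltW.
    by rewrite exprS ler_peMr// exprn_ege1// ler1n.
  by rewrite expr2 ler_peMl// ltW.
have ysmall j : `|y j| < c ^+ 3.
  by rewrite ltNge; apply/negP => h; apply: small; exists j.
apply: (@decoupling_average {set J} (fun Q : {set J} => e @: Q)%SET [set e j | j in J]%SET).
- by rewrite card_sets expn_gt0.
- exact: free_sub.
- by move=> Q p; exact: closed_sub.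
- exact: measurable_form_event.
- exact: depends_form_event.
move=> a; set F := form_event u _.
have -> : #|{set J}|%:R = 2 ^+ #|J| :> R.
  by rewrite card_sets natrX.
have mmix (Q : {set J}) : measurable_fun [set: T] (fun t => mix (e @: Q) a (X t)).
  exact: (measurable_mixX (em_measurable M)).
have mF : measurable F by exact: measurable_form_event.
pose zeta j t : R := (`|X t (e j) - a (e j)| <= c)%R%:R.
have mzeta j : measurable_fun [set: T] (zeta j).
  have mA : measurable [set t | `|X t (e j) - a (e j)| <= c].
    apply: measurable_sublevel; apply: measurableT_comp => //; apply: measurable_funB => //.
    exact: (em_measurable M).
  have -> : zeta j = \1_[set t | `|X t (e j) - a (e j)| <= c].
    apply/funext => t; rewrite indicE /zeta; congr (nat_of_bool _)%:R.
    by apply/idP/idP; rewrite inE.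
  exact: measurable_indic.
have zeta0 j t : 0 <= zeta j t by exact: ler0n.
pose S t := \sum_j y j ^+ 2 * zeta j t.
(* An entry that moves by more than [c] contributes at least [c^2 y_j^2] to the truncated squares,
   because [|y_j|] is below the truncation level [c^3]. So if these squares sum to less than
   [(c / 2)^2], the weight [S t] of the barely moving entries exceeds [3 / 4], and [4 * S t ^+ 2]
   pays for the trivial bound. *)
have pointwise t : \sum_(Q : {set J}) (\1_F (mix (e @: Q) a (X t)) : R) <=
    2 ^+ #|J| * (4 * S t ^+ 2 + 2 ^+ 13 * c ^+ 2).
  have p2 : 0 <= 2 ^+ #|J| :> R by exact: exprn_ge0.
  have c3 : 0 < c ^+ 3 by exact: exprn_gt0.
  have c2 : 0 < c / 2 by exact: divr_gt0.
  have c20 : 0 <= c ^+ 2 by exact: sqr_ge0.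
  have S20 := sqr_ge0 (S t).
  have [good|bad] := leP ((c / 2) ^+ 2)
      (\sum_j Num.min `|y j * (X t (e j) - a (e j))| (c ^+ 3) ^+ 2).
    apply: (@le_trans _ _ (\sum_(Q : {set J}) (\1_(form_event u (c ^+ 3)) (mix (e @: Q) a (X t)) : R))).
      apply: ler_sum => Q _; rewrite !indicE ler_nat.
      have [|//] := boolP (_ \in F); rewrite inE /F /form_event /= => h.
      rewrite (_ : _ \in _)// inE /=; apply: le_trans h _.
      by apply: ler_wiXn2l => //; exact: ltW.
    apply: le_trans (resampling_count u c3 c2 good) _; apply: ler_wpM2l => //.
    have -> : 2 ^+ 12 * c ^+ 3 / (c / 2) = 2 ^+ 13 * c ^+ 2.
      by rewrite [2 ^+ 13]exprS; move: (2 ^+ 12 : R) => x; field; rewrite gt_eqF.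
    by rewrite lerDr mulr_ge0.
  apply: (@le_trans _ _ (2 ^+ #|J| * 1)).
    rewrite mulr1; have -> : 2 ^+ #|J| = \sum_(Q : {set J}) 1 :> R.
      by rewrite sumr_const card_sets natrX.
    by apply: ler_sum => Q _; rewrite indicE; case: (_ \in _).
  apply: ler_wpM2l => //.
  have : c ^+ 2 * (1 - S t) <= \sum_j Num.min `|y j * (X t (e j) - a (e j))| (c ^+ 3) ^+ 2.
    rewrite -y1 /S -sumrB mulr_sumr; apply: ler_sum => j _.
    rewrite /zeta; have [zj|zj] := leP `|X t (e j) - a (e j)| c.
      by rewrite mulr1 subrr mulr0 sqr_ge0.
    rewrite mulr0 subr0 -exprMn -[_ ^+ 2 in leLHS]real_normK ?num_real//.
    rewrite ler_sqr ?nnegrE ?normr_ge0 ?le_min ?normr_ge0 ?(ltW c3)//.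
    rewrite !normrM (ger0_norm (ltW c0)) [c * _]mulrC; apply/andP; split.
      by rewrite ler_wpM2l// ltW.
    apply: le_trans (_ : _ <= `|y j| * 1) _; first by rewrite ler_wpM2l.
    by rewrite mulr1 ltW.
  move=> h; have : c ^+ 2 * (1 - S t) < (c / 2) ^+ 2 by exact: le_lt_trans h bad.
  have -> : (c / 2) ^+ 2 = c ^+ 2 * 4^-1 by field.
  rewrite ltr_pM2l ?exprn_gt0// => hS.
  have S1 : 2^-1 <= S t by lra.
  have : 4^-1 <= S t ^+ 2.
    have -> : 4^-1 = (2^-1) ^+ 2 :> R by field.
    by rewrite ler_sqr ?nnegrE// (le_trans _ S1).
  have : 0 <= 2 ^+ 13 * c ^+ 2 by rewrite mulr_ge0.
  by move: (2 ^+ 13 * _) => x; lra.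
have S2 : (\int[P]_t (S t ^+ 2)%:E <= (6 * K ^+ 2 * c ^+ 2)%:E)%E.
  have -> : (\int[P]_t (S t ^+ 2)%:E = \int[P]_t (\sum_i \sum_j
      (y i ^+ 2 * y j ^+ 2)%:E * (zeta i t * zeta j t)%:E))%E.
    apply: eq_integral => t _; rewrite expr2 /S big_distrlr /= -sumEFin.
    apply: eq_bigr => i _; rewrite -sumEFin; apply: eq_bigr => j _.
    by rewrite -EFinM; congr (_%:E); ring.
  have mij i j : measurable_fun [set: T] (fun t => ((y i ^+ 2 * y j ^+ 2)%:E * (zeta i t * zeta j t)%:E)%E).
    by apply: measurable_funeM; apply/measurable_EFinP; exact: measurable_funM.
  have yij i j : 0 <= y i ^+ 2 * y j ^+ 2 by rewrite mulr_ge0 ?sqr_ge0.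
  have zij i j t : 0 <= zeta i t * zeta j t by rewrite mulr_ge0.
  rewrite ge0_integral_sum//; last 2 first.
  - by move=> i; apply: emeasurable_sum.
  - by move=> i t _; apply: sume_ge0 => j _; rewrite mule_ge0 ?lee_fin.
  have -> : 6 * K ^+ 2 * c ^+ 2 = \sum_i \sum_j (y i ^+ 2 * y j ^+ 2 * (2 * K * c) ^+ 2 +
      (if j == i then y i ^+ 2 * (2 * K ^+ 2 * c ^+ 2) else 0)).
    under eq_bigr do rewrite big_split /= -big_mkcond /= big_pred1_eq -mulr_suml -mulr_sumr y1 mulr1.
    by rewrite big_split /= -!mulr_suml y1; ring.
  rewrite -sumEFin; apply: lee_sum => i _.
  rewrite ge0_integral_sum//; last by move=> j t _; rewrite mule_ge0 ?lee_fin.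
  rewrite -sumEFin; apply: lee_sum => j _.
  rewrite ge0_integralZl//; last 3 first.
  - by apply/measurable_EFinP; exact: measurable_funM.
  - by move=> t _; rewrite lee_fin.
  - by rewrite lee_fin.
  apply: (@le_trans _ _ ((y i ^+ 2 * y j ^+ 2)%:E *
    (if i == j then 2 * K * c else (2 * K * c) ^+ 2)%:E)%E).
    by apply: lee_wpmul2l; rewrite ?lee_fin//; exact: near_pair_prob.
  rewrite -EFinM lee_fin [j == i]eq_sym; case: eqP => [<-|_]; last by rewrite addr0.
  apply: ler_wpDl; first by rewrite mulr_ge0 ?sqr_ge0.
  (* A diagonal term has only probability [2 * K * c]; the spare factor [y_i^2] supplies the missing
     power of [c]. *)
  have y6 : y i ^+ 2 <= c.
    apply: (@le_trans _ _ ((c ^+ 3) ^+ 2)).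
      rewrite -[leLHS]real_normK ?num_real// ler_sqr ?nnegrE ?exprn_ge0 ?(ltW c0)//.
      exact: ltW.
    by rewrite -exprM -[leRHS]expr1 ler_wiXn2l// ltW.
  rewrite -[leLHS]mulrA; apply: ler_wpM2l; first exact: sqr_ge0.
  apply: (@le_trans _ _ (c * (2 * K * c))).
    by apply: ler_wpM2r => //; rewrite !mulr_ge0// ltW.
  have -> : c * (2 * K * c) = K * (2 * c ^+ 2) by ring.
  have -> : 2 * K ^+ 2 * c ^+ 2 = K ^+ 2 * (2 * c ^+ 2) by ring.
  apply: ler_wpM2r; first by rewrite mulr_ge0// sqr_ge0.
  by rewrite expr2 ler_peMl// ltW.
have mS : measurable_fun [set: T] S.
  by apply: measurable_sum => j; apply: measurable_funM.
apply: (@le_trans _ _ (\int[P]_t (2 ^+ #|J| * (4 * S t ^+ 2 + 2 ^+ 13 * c ^+ 2))%:E)%E).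
  rewrite (eq_bigr (fun Q : {set J} => \int[P]_t (\1_F (mix (e @: Q) a (X t)) : R)%:E)%E); last first.
    by move=> Q _; rewrite integral_set_fun.
  have mIQ (Q : {set J}) : measurable_fun [set: T] (fun t => (\1_F (mix (e @: Q) a (X t)) : R)%:E).
    by apply/measurable_EFinP; exact: (measurableT_comp (measurable_indic mF) (mmix Q)).
  rewrite -ge0_integral_sum//.
  apply: ge0_le_integral => //.
  - by move=> t _; apply: sume_ge0 => Q _; rewrite lee_fin indicE ler0n.
  - by apply: emeasurable_sum.
  - apply/measurable_EFinP; apply: measurable_funM => //; apply: measurable_funD => //.
    by apply: measurable_funM => //; exact: measurable_funX.
  by move=> t _; rewrite sumEFin lee_fin; exact: pointwise.
under eq_integral do rewrite EFinM EFinD EFinM.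
rewrite ge0_integralZl//; last 2 first.
- apply: emeasurable_funD => //; apply: measurable_funeM; apply/measurable_EFinP.
  exact: measurable_funX.
- by move=> t _; rewrite -EFinM -EFinD lee_fin addr_ge0// mulr_ge0// sqr_ge0.
rewrite [leRHS]EFinM; apply: lee_wpmul2l; first by rewrite lee_fin exprn_ge0.
rewrite ge0_integralD//; last 3 first.
- by move=> t _; rewrite -EFinM lee_fin mulr_ge0// sqr_ge0.
- by apply: measurable_funeM; apply/measurable_EFinP; exact: measurable_funX.
- by move=> t _; rewrite lee_fin mulr_ge0// sqr_ge0.
rewrite ge0_integralZl//; last 2 first.
- by apply/measurable_EFinP; exact: measurable_funX.
- by move=> t _; rewrite lee_fin sqr_ge0.
rewrite integral_prob_cst.
apply: (@le_trans _ _ (4%:E * (6 * K ^+ 2 * c ^+ 2)%:E + (2 ^+ 13 * c ^+ 2)%:E)%E).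
  by apply: leeD => //; apply: lee_wpmul2l.
rewrite -EFinM -EFinD lee_fin.
have : 0 <= c ^+ 2 by exact: sqr_ge0.
move: (c ^+ 2) => x x0.
have xK : x <= K ^+ 2 * x by rewrite ler_peMl.
have -> : 4 * (6 * K ^+ 2 * x) = 24 * (K ^+ 2 * x) by ring.
rewrite -[2 ^+ 14 * _ * _]mulrA; move: (K ^+ 2 * x) xK => z zx.
by lra.
Qed.

End OneForm.
End LinearForms.

(** * The space of small singular values of a block *)

Section SmallSingularSpace.
Context (R : realType) (n : nat).
Local Notation C := R[i].
Local Notation cfg := (config R ('I_n * 'I_n)%type).

Lemma hermitian_diagonalization (H : 'M[C]_n) : ctr H = H ->
  exists (U : 'M[C]_n) (D : 'I_n -> R), [/\ ctr U *m U = 1%:M, U *m ctr U = 1%:M &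
    U *m H = diag_mx (\row_i (D i)%:C%C) *m U].
Proof.
move=> hH.
have herm : H \is hermsymmx.
  by apply/is_hermitianmxP; rewrite expr0 scale1r; exact: esym hH.
have norm : H \is normalmx by exact: hermitian_normalmx.
have := elimT (@orthomx_spectralP _ _ H) norm.
have := hermitian_spectral_diag_real herm.
have := spectral_unitarymx H.
move: (spectralmx H) (spectral_diag H) => U D uU rD HE.
have uU1 : U *m ctr U = 1%:M by exact/unitarymxP.
exists U, (fun i => complex.Re (D 0 i)); split; [exact: mulmx1C|exact: uU1|].
have -> : \row_i (complex.Re (D 0 i))%:C%C = D.
  apply/rowP => i; rewrite mxE; have := mxOverP rD 0 i.
  by case: (D 0 i) => x y; rewrite complex_real => /eqP ->.
by rewrite HE !mulmxA mulmxV ?mul1mx// (unitarymx_unit uU).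
Qed.

(** For unitary [U], the projection onto the span of the columns of [ctr U] with index in [s]; in
    use these are eigenvectors. *)
Definition span_proj (U : 'M[C]_n) (s : {set 'I_n}) : 'M[C]_n :=
  ctr U *m coord_proj R s *m U.

Lemma nsqv_unitary (U : 'M[C]_n) v : ctr U *m U = 1%:M -> nsqv (U *m v) = nsqv v.
Proof.
move=> hU; apply: rc_inj.
have h (x : 'cV[C]_n) : (nsqv x)%:C%C = (ctr x *m x) 0 0 by rewrite ctr_mul_vec mxE eqxx mulr1n.
by rewrite !h ctrM -mulmxA (mulmxA (ctr U)) hU mul1mx.
Qed.

Lemma oproj_span (U : 'M[C]_n) s : U *m ctr U = 1%:M -> oproj (span_proj U s).
Proof.
move=> hU; have [h1 h2] := oproj_coord R s; split.
  by rewrite /span_proj !ctrM ctrK h1 mulmxA.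
rewrite /span_proj -!mulmxA; congr (_ *m _).
by rewrite (mulmxA U) hU mul1mx mulmxA h2.
Qed.

Lemma ptrace_span (U : 'M[C]_n) s : U *m ctr U = 1%:M -> ptrace (span_proj U s) = #|s|%:R.
Proof.
move=> hU; rewrite ptraceE /span_proj -mulmxA mxtrace_mulC -mulmxA hU mulmx1.
by rewrite mxtrace_coord; elim: #|s| => // k IH; rewrite -!natr1 -IH; case: (k%:R : C).
Qed.

(** What is diagonalized is [B^* B + L Q], where [Q] projects off [Cs] and [L > tau2]. Without the
    penalty, the coordinates off [Cs], on which [B] vanishes, would all count as singular
    directions; with it, eigenvectors of eigenvalue below [tau2] are supported in [Cs]. *)
Lemma small_singular_space (B : 'M[C]_n) (Cs : {set 'I_n}) (tau2 : R) : 0 < tau2 ->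
  (forall i k, i \notin Cs -> B k i = 0) ->
  exists (U : 'M[C]_n) (s : {set 'I_n}),
    [/\ ctr U *m U = 1%:M, U *m ctr U = 1%:M,
        forall k i, k \in s -> i \notin Cs -> U k i = 0,
        forall v : 'cV[C]_n, nsqv (B *m (span_proj U s *m v)) <= tau2 * nsqv (span_proj U s *m v) &
        forall v : 'cV[C]_n, (forall i, i \notin Cs -> v i 0 = 0) ->
          tau2 * \sum_(i in ~: s) nsq ((U *m v) i 0) <= nsqv (B *m v)].
Proof.
move=> t0 B0.
pose Q := coord_proj R (~: Cs).
have [hQ QQ] := oproj_coord R (~: Cs); rewrite -/Q in hQ QQ.
pose L : R := tau2 + 1.
pose H := ctr B *m B + L%:C%C *: Q.
have hH : ctr H = H.
  rewrite /H; apply/matrixP => i j; rewrite ctrE [in LHS]mxE [in RHS]mxE rmorphD.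
  congr (_ + _).
    have hB : ctr (ctr B *m B) = ctr B *m B by rewrite ctrM ctrK.
    by rewrite -[in RHS]hB [RHS]ctrE.
  rewrite [in LHS]mxE [in RHS]mxE rmorphM; congr (_ * _).
    by apply/eqP; rewrite eq_complex /= oppr0 !eqxx.
  by rewrite -[in RHS]hQ [RHS]ctrE.
have [U [D [U1 U2 UH]]] := hermitian_diagonalization hH.
pose s := [set i | D i < tau2]%SET.
have key v : nsqv (B *m v) + L * nsqv (Q *m v) = \sum_i D i * nsq ((U *m v) i 0).
  apply: rc_inj; rewrite rcD rcM.
  have h (x : 'cV[C]_n) : (nsqv x)%:C%C = (ctr x *m x) 0 0.
    by rewrite ctr_mul_vec mxE eqxx mulr1n.
  rewrite !h !ctrM hQ.
  transitivity ((ctr v *m H *m v) 0 0).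
    rewrite /H mulmxDr mulmxDl [RHS]mxE -!mulmxA; congr (_ + _).
    by rewrite (mulmxA Q) QQ -scalemxAl -scalemxAr [RHS]mxE.
  rewrite real_complex_sum -[H]mul1mx -U1 -(mulmxA (ctr U) U H) UH !mulmxA -ctrM -!mulmxA mxE.
  apply: eq_bigr => i _; rewrite ctrE mul_diag_mx rcM nsqE; move: (U *m v) => z; rewrite !mxE.
  by ring.
exists U, s; split => //.
- move=> k i; rewrite !finset.inE => Dk iC.
  have := congr1 (fun M => (M *m (delta_mx i 0 : 'cV[C]_n)) k 0) UH.
  rewrite -!mulmxA /=.
  (* A basis vector off [Cs] is an eigenvector for [L], hence orthogonal to every eigenvector with
     [D k < tau2 < L]. *)
  have -> : H *m (delta_mx i 0 : 'cV[C]_n) = L%:C%C *: delta_mx i 0.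
    rewrite /H mulmxDl -mulmxA.
    have -> : B *m (delta_mx i 0 : 'cV[C]_n) = 0.
      by rewrite -colE; apply/matrixP => a b; rewrite !mxE B0.
    rewrite mulmx0 add0r -scalemxAl; congr (_ *: _).
    apply/matrixP => a b; rewrite coord_projE !finset.inE.
    by case: ifPn => //; rewrite negbK => aC; rewrite mxE; case: eqP => // ai; rewrite ai (negPf iC) in aC.
  rewrite -scalemxAr -colE mul_diag_mx !mxE => /eqP.
  rewrite -subr_eq0 -mulrBl mulf_eq0 => /orP[|/eqP//].
  rewrite -[_ - _]/((L%:C - (D k)%:C)%C) subr_eq0 => /eqP/rc_inj LD.
  by exfalso; move: Dk; rewrite -LD /L; lra.
- move=> v; set x := span_proj U s *m v.
  have Ux : U *m x = coord_proj R s *m (U *m v).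
    by rewrite /x /span_proj !mulmxA U2 mul1mx.
  have : nsqv (B *m x) <= \sum_i D i * nsq ((U *m x) i 0).
    by rewrite -key lerDl mulr_ge0 ?nsqv_ge0// /L; lra.
  move=> /le_trans; apply; rewrite -(nsqv_unitary x U1) /nsqv mulr_sumr; apply: ler_sum => i _.
  rewrite Ux coord_projE; case: ifPn => [|_]; last by rewrite nsq0 !mulr0.
  by rewrite finset.inE => /ltW Di; rewrite ler_wpM2r ?nsq_ge0.
- move=> v v0.
  have -> : nsqv (B *m v) = nsqv (B *m v) + L * nsqv (Q *m v).
    have -> : Q *m v = 0.
      apply/matrixP => i k; rewrite ord1 coord_projE !finset.inE mxE.
      by case: ifPn => // /v0.
    by rewrite nsqv0 mulr0 addr0.
  rewrite key [leRHS](bigID (mem s)) /=.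
  apply: (@le_trans _ _ (\sum_(i | i \notin s) D i * nsq ((U *m v) i 0))).
    rewrite mulr_sumr (eq_bigl (fun i => i \notin s)); last by move=> i; rewrite finset.inE.
    by apply: ler_sum => i; rewrite finset.inE -leNgt => Di; rewrite ler_wpM2r ?nsq_ge0.
  rewrite lerDr; apply: sumr_ge0 => i _; rewrite mulr_ge0 ?nsq_ge0//.
  (* The quadratic form evaluated at the [i]-th eigenvector shows that [D i] is nonnegative. *)
  have -> : D i = \sum_j D j * nsq ((U *m (ctr U *m (delta_mx i 0 : 'cV[C]_n))) j 0).
    rewrite mulmxA U2 mul1mx (bigD1 i) //= mxE !eqxx big1 => [|j ji].
      by rewrite nsq_real expr1n mulr1 addr0.
    by rewrite mxE (negPf ji) nsq0 mulr0.
  by rewrite -key addr_ge0 ?nsqv_ge0// mulr_ge0 ?nsqv_ge0// /L; lra.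
Qed.
End SmallSingularSpace.

Definition lo_bound (R : realType) (K c : R) : R := 2 ^+ 14 * K ^+ 2 * c ^+ 2.

(** * Many small rows against a fixed vector *)

Section RowsProbability.
Context (R : realType) (n : nat).
Local Notation C := R[i].
Local Notation cfg := (config R ('I_n * 'I_n)%type).
Context (K : R).
Context (d : measure_display) (T : measurableType d) (P : probability T R).
Variable X : T -> cfg.
Hypothesis M : entry_model (@transpose_pair n) K P X.
Variables (S : 'M[C]_n) (J : {set 'I_n}) (z : 'cV[C]_n).
Hypothesis z0 : forall j, j \notin J -> z j 0 = 0.

Lemma nsqr_set1 i (v : 'cV[C]_n) : nsqr [set i]%SET v = nsq (v i 0).
Proof. by rewrite /nsqr big_set1. Qed.

Definition row_event (r : R) (i : 'I_n) : set cfg := [set a | nsq ((cmx S a *m z) i 0) <= r].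

Lemma measurable_row_event r i : measurable (row_event r i).
Proof.
have -> : row_event r i = [set a : cfg | nsqr [set i]%SET (cmx S a *m z) <= r].
  by apply/seteqP; split => a; rewrite /row_event /= nsqr_set1.
by apply: measurable_sublevel; exact: measurable_nsqr.
Qed.

Lemma depends_row_event r i : depends_on (block [set i] J) (row_event r i).
Proof.
move=> a b ab; rewrite /row_event /= -!nsqr_set1.
by rewrite (depends_mulmx S ab z0).
Qed.

(** The entries being real, the real and imaginary parts of row [i] are real forms with coefficients
    [Re z] and [Im z]. One of these vectors has squared norm at least [1 / 8], whence the factor 8;
    the other part is dropped. *)
Lemma row_event_prob r c i : 4^-1 <= nsqv z -> 0 <= r -> 0 < c -> 8 * r <= c ^+ 10 ->
  (P [set t | row_event r i (X t)] <= (lo_bound K c)%:E)%E.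
Proof.
move=> z4 r0 c0 rc.
pose N (f : C -> R) : R := \sum_j f (z j 0) ^+ 2.
have e_inj : injective (fun j : 'I_n => (i, j)) by move=> j k [].
have e_free : free_set (@transpose_pair n) [set (i, j) | j in 'I_n]%SET.
  by move=> _ _ /imsetP[j _ ->] /imsetP[k _ ->] [<- ->].
have key (f : C -> R) (u : R) : 8^-1 <= N f ->
    (forall a : cfg, row_event r i a -> (\sum_j f (z j 0) * a (i, j) + u) ^+ 2 <= r) ->
    (P [set t | row_event r i (X t)] <= (lo_bound K c)%:E)%E.
  move=> N8 hf; have N0 : 0 < N f by lra.
  pose s := Num.sqrt (N f); have s0 : 0 < s by rewrite sqrtr_gt0.
  have s2 : s ^+ 2 = N f by rewrite sqr_sqrtr// ltW.
  pose y j := f (z j 0) / s.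
  have y1 : \sum_j y j ^+ 2 = 1.
    rewrite (eq_bigr (fun j => f (z j 0) ^+ 2 / N f)).
      by rewrite -mulr_suml divff// gt_eqF.
    by move=> j _; rewrite /y expr_div_n s2.
  apply: le_trans (linear_form_small_ball M e_inj e_free (- (u / s)) y1 c0).
  apply: le_measure; rewrite ?inE.
  - by apply: (measurable_preX M); exact: measurable_row_event.
  - by apply: (measurable_preX M); exact: measurable_form_event.
  move=> t /hf ht; rewrite /form_event /=.
  have -> : \sum_j y j * X t (i, j) - - (u / s) = (\sum_j f (z j 0) * X t (i, j) + u) / s.
    rewrite opprK mulrDl mulr_suml; congr (_ + _); apply: eq_bigr => j _.
    by rewrite /y mulrAC.
  rewrite -ler_sqr ?nnegrE ?exprn_ge0 ?(ltW c0)// real_normK ?num_real//.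
  rewrite expr_div_n s2 ler_pdivrMr// -exprM.
  apply: le_trans ht _; apply: (@le_trans _ _ (c ^+ 10 * 8^-1)); first by lra.
  by rewrite ler_wpM2l// exprn_ge0// ltW.
have RI : nsqv z = N (@complex.Re R) + N (@complex.Im R).
  by rewrite /nsqv /N -big_split.
have E (a : cfg) : (cmx S a *m z) i 0 = \sum_j (z j 0) * (a (i, j))%:C%C + (S *m z) i 0.
  rewrite !mxE -big_split; apply: eq_bigr => j _ /=; rewrite mxE; ring.
have [N8|N8] := leP 8^-1 (N (@complex.Re R)).
  apply: (key (@complex.Re R) (complex.Re ((S *m z) i 0)) N8) => a; rewrite /row_event /= E.
  apply: le_trans; rewrite /nsq [leLHS](_ : _ = complex.Re (\sum_j z j 0 * (a (i, j))%:C%C + (S *m z) i 0) ^+ 2).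
    by rewrite lerDl sqr_ge0.
  congr (_ ^+ 2); rewrite raddfD /= Re_sum; congr (_ + _); apply: eq_bigr => j _.
  by case: (z j 0) => x y; rewrite /= mulr0 subr0.
apply: (key (@complex.Im R) (complex.Im ((S *m z) i 0))); first by lra.
move=> a; rewrite /row_event /= E.
apply: le_trans; rewrite /nsq [leLHS](_ : _ = complex.Im (\sum_j z j 0 * (a (i, j))%:C%C + (S *m z) i 0) ^+ 2).
  by rewrite lerDr sqr_ge0.
congr (_ ^+ 2); rewrite raddfD /= Im_sum; congr (_ + _); apply: eq_bigr => j _.
by case: (z j 0) => x y; rewrite /= mulr0 add0r.
Qed.

(* [E prod (1_F + beta)] factors over rows disjoint from [J], and bounds the
   probability that all but [e] of the row events occur. *)
Lemma rows_product (I2 : {set 'I_n}) (r beta : R) : [disjoint I2 & J]%B -> 0 <= beta ->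
  (forall i, (P [set t | row_event r i (X t)] <= beta%:E)%E) ->
  (\int[P]_t (\prod_(i in I2) (\1_(row_event r i) (X t) + beta))%:E <= ((2 * beta) ^+ #|I2|)%:E)%E.
Proof.
move=> IJ b0 hb; have mX := measurable_X (em_measurable M).
have m1 i : measurable_fun [set: cfg] (fun a : cfg => \1_(row_event r i) a + beta : R).
  by apply: measurable_funD => //; apply: measurable_indic; exact: measurable_row_event.
have dI i := depends_indic (@depends_row_event r i).
have ge0 i a : 0 <= \1_(row_event r i) a + beta :> R by rewrite addr_ge0// indicE ler0n.
move Em: #|I2| => m; elim: m I2 Em IJ => [|m IH] I2 Em IJ.
  by rewrite (cards0_eq Em) (eq_integral (fun=> 1%:E)) ?integral_prob_cst ?expr0// => t _; rewrite big_set0.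
have [i iI2] : exists i, i \in I2 by apply/set0Pn; rewrite -cards_eq0 Em.
have Em' : #|I2 :\ i| = m by have := cardsD1 i I2; rewrite iI2 Em => -[].
have IJ' : [disjoint I2 :\ i & J]%B by apply: disjointWl IJ; exact: subsetDl.
have iJ : i \notin J by rewrite (disjointFr IJ).
rewrite (eq_integral (fun t => ((\1_(row_event r i) (X t) + beta) *
   \prod_(j in I2 :\ i) (\1_(row_event r j) (X t) + beta))%:E)); last first.
  by move=> t _; rewrite (big_setD1 i).
pose Q := block [set i]%SET J.
apply: (@le_trans _ _ ((2 * beta)%:E * \int[P]_t (\prod_(j in I2 :\ i) (\1_(row_event r j) (X t) + beta))%:E)%E).
  pose g1 (a : cfg) : R := \1_(row_event r i) a + beta.
  pose g2 (a : cfg) : R := \prod_(j in I2 :\ i) (\1_(row_event r j) a + beta).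
  apply: (@em_decoupling_le _ _ _ _ _ _ _ _ M Q Q (block (I2 :\ i) J) g1 g2).
  - move=> p q; rewrite !mem_block !finset.in_set1 => /andP[/eqP pi pJ] /andP[/eqP qi qJ] qp.
    by move: qi pJ; rewrite qp /= => ->; rewrite (negPf iJ).
  - by move=> p _.
  - move=> [p1 p2]; rewrite !mem_block !finset.inE /= => /andP[/eqP-> pJ].
    by rewrite eqxx (negPf iJ) !andbF.
  - exact: m1.
  - rewrite (_ : g2 = fun a => \prod_(j <- enum (I2 :\ i)) (\1_(row_event r j) a + beta)).
      by apply: measurable_prod => j _; exact: m1.
    by apply/funext => a; rewrite /g2 big_enum.
  - exact: ge0.
  - by move=> a; apply: prodr_ge0 => j _; exact: ge0.
  - by rewrite mulr_ge0.
  - by move=> a b ab; rewrite /g1 (dI i a b ab).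
  - move=> a b ab; apply: eq_bigr => j jI; rewrite (dI j a b)// => p.
    rewrite mem_block finset.in_set1 => /andP[/eqP pj pJ]; apply: ab.
    by rewrite mem_block pj jI.
  - move=> a; rewrite (eq_integral (fun t => (\1_(row_event r i) (X t) : R)%:E + beta%:E)%E); last first.
      move=> t _; rewrite -EFinD /g1 (dI i _ (X t))// => p pQ.
      by rewrite /mix pQ.
    rewrite ge0_integralD//; last first.
      by apply/measurable_EFinP; apply: (measurableT_comp _ mX); apply: measurable_indic; exact: measurable_row_event.
    rewrite integral_prob_cst (integral_set_fun P (measurable_row_event r i) mX).
    by rewrite mulr_natl mulr2n EFinD; apply: leeD => //; exact: hb.
rewrite exprS [X in (_ <= X)%E]EFinM; apply: lee_wpmul2l; first by rewrite lee_fin mulr_ge0.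
exact: IH.
Qed.

(** If the rows sum to less than [e.+1 * r], at most [e] of them exceed [r], so the product in
    [rows_product] is at least [beta ^+ e] and Markov's inequality applies. *)
Lemma rows_prob (I2 : {set 'I_n}) (e : nat) (r c : R) :
  [disjoint I2 & J]%B -> (e <= #|I2|)%N -> 4^-1 <= nsqv z -> 0 <= r -> 0 < c -> 8 * r <= c ^+ 10 ->
  (P [set t | (nsqr I2 (cmx S (X t) *m z) < e.+1%:R * r)%R] <=
     (2 ^+ #|I2| * lo_bound K c ^+ (#|I2| - e))%:E)%E.
Proof.
move=> IJ eI z4 r0 c0 rc; set beta := lo_bound K c; have mX := measurable_X (em_measurable M).
have K1 := em_K M.
have b0 : 0 < beta by rewrite mulr_gt0 ?exprn_gt0// ?mulr_gt0 ?exprn_gt0//; lra.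
pose F : set cfg := [set a | nsqr I2 (cmx S a *m z) < e.+1%:R * r].
have mF : measurable F by apply: measurable_strict_sublevel; exact: measurable_nsqr.
have [b1|b1] := ltP 1 beta.
  apply: le_trans (probability_le1 P (measurable_preX M mF)) _.
  by rewrite lee_fin mulr_ege1// exprn_ege1// ?ler1n// ltW.
pose f t := \prod_(i in I2) (\1_(row_event r i) (X t) + beta).
have f0 t : 0 <= f t by apply: prodr_ge0 => i _; rewrite addr_ge0 ?(ltW b0)// indicE ler0n.
have mf : measurable_fun [set: T] f.
  rewrite (_ : f = fun t => \prod_(i <- enum I2) (\1_(row_event r i) (X t) + beta)); last first.
    by apply/funext => t; rewrite /f big_enum.
  apply: measurable_prod => i _; apply: measurable_funD => //.
  by apply: (measurableT_comp _ mX); apply: measurable_indic; exact: measurable_row_event.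
have Ff t : beta ^+ e * \1_F (X t) <= f t.
  rewrite indicE; case: (boolP (X t \in F)) => [|_]; last by rewrite mulr0.
  rewrite inE mulr1 /F /= => hF.
  pose B := [set i in I2 | r < nsq ((cmx S (X t) *m z) i 0)]%SET.
  have Be : (#|B| <= e)%N.
    rewrite leqNgt; apply/negP => eB.
    have : #|B|%:R * r <= nsqr I2 (cmx S (X t) *m z).
      rewrite -sum1_card natr_sum mulr_suml /nsqr.
      rewrite [leRHS](bigID (mem B)) /= -[leLHS]addr0; apply: lerD; last first.
        by apply: sumr_ge0 => i _; exact: nsq_ge0.
      rewrite [leRHS](eq_bigl (mem B)); last first.
        by move=> i; rewrite !finset.inE andb_idl// => /andP[].
      by apply: ler_sum => i; rewrite finset.inE mul1r => /andP[_ /ltW].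
    move=> /le_lt_trans/(_ hF); rewrite ltNge => /negP; apply.
    by rewrite ler_wpM2r// ler_nat.
  rewrite /f (bigID (mem B)) /= -[leLHS]mulr1; apply: ler_pM => //; first exact: exprn_ge0 (ltW b0).
    apply: (@le_trans _ _ (\prod_(i in B) beta)).
      by rewrite prodr_const; apply: ler_wiXn2l => //; exact: ltW.
    rewrite [leRHS](eq_bigl (mem B)); last first.
      by move=> i; rewrite !finset.inE andb_idl// => /andP[].
    by apply: ler_prod => i _; rewrite (ltW b0) lerDr indicE ler0n.
  apply: (@le_trans _ _ (\prod_(i | (i \in I2) && (i \notin B)) 1)); first by rewrite big1.
  apply: ler_prod => i.
  rewrite finset.inE => /andP[iI]; rewrite iI /= -leNgt => ir.
  by rewrite ler01 indicE mem_set// lerDl ltW.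
have PF : (P [set t | F (X t)] = \int[P]_t (\1_F (X t) : R)%:E)%E.
  by rewrite integral_set_fun.
have bE : ((beta ^+ e)%:E * P [set t | F (X t)] <= ((2 * beta) ^+ #|I2|)%:E)%E.
  rewrite PF -ge0_integralZl//; last 2 first.
  - by apply/measurable_EFinP; apply: (measurableT_comp _ mX); exact: measurable_indic.
  - by rewrite lee_fin exprn_ge0// ltW.
  apply: le_trans (rows_product IJ (ltW b0) (r := r) _); last first.
    by move=> i; exact: row_event_prob.
  apply: ge0_le_integral => //.
  - by move=> t _; rewrite lee_fin mulr_ge0// exprn_ge0// ltW.
  - apply/measurable_EFinP; apply: measurable_funM => //.
    by apply: (measurableT_comp _ mX); exact: measurable_indic.
  - by apply/measurable_EFinP.
  - by move=> t _; rewrite -EFinM lee_fin.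
have pm : (P [set t | F (X t)] \is a fin_num)%E by apply: fin_num_measure; exact: (measurable_preX M mF).
move: bE; rewrite -/F -[P _](fineK pm) -EFinM !lee_fin => bE.
have be0 : 0 < beta ^+ e by rewrite exprn_gt0.
rewrite -(ler_pM2l be0); apply: le_trans bE _.
by rewrite [leRHS]mulrCA -exprD subnKC// exprMn.
Qed.


End RowsProbability.

(** * Nets of Euclidean balls *)

Section Net.
Context (R : realType).
Local Notation C := R[i].

(** Cost per real coordinate: 2 for the sign, [p + 1] for a geometric series of ratio [p / (p + 1)],
    and [e] for [(1 + 1/p)^p]. *)
Definition net_base (p : nat) : R := 2 * expR 1 * p.+1%:R.

Lemma net_base_ge1 p : 1 <= net_base p.
Proof.
rewrite /net_base; have e1 := expR1_ge1 R.
by apply: mulr_ege1; [apply: mulr_ege1 => //; rewrite ler1n|rewrite ler1n].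
Qed.

Lemma exists_net_base (theta : R) : 0 < theta -> theta <= 1 ->
  exists p : nat, 1 <= theta * p%:R /\ net_base p * theta <= 6 * expR 1.
Proof.
move=> t0 t1; exists (Num.truncn theta^-1).+1; split.
  by rewrite -ler_pdivrMl// mulr1 ltW// truncnS_gt.
rewrite /net_base.
have pp : (Num.truncn theta^-1).+2%:R <= 3 * theta^-1.
  have th2 : 1 <= theta^-1 by rewrite invf_ge1.
  have := truncn_le theta^-1; rewrite invr_ge0 (ltW t0) => tt.
  by rewrite -!natr1; lra.
apply: (@le_trans _ _ (2 * expR 1 * (3 * theta^-1) * theta)).
  apply: ler_wpM2r; first exact: ltW.
  by apply: ler_wpM2l pp; apply: mulr_ge0 => //; exact: expR_ge0.
by rewrite le_eqVlt; apply/orP; left; apply/eqP; field; rewrite gt_eqF.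
Qed.

(* Weighting [f] by [lambda ^ (sum f - D p)], with [lambda = p / (p + 1)], the
   count factors over the coordinates. *)
Lemma card_l1_ball (J : finType) (N p : nat) : (0 < p)%N ->
  #|[set f : {ffun J -> bool * 'I_N} | (\sum_j (f j).2 <= #|J| * p)%N]%SET|%:R
    <= net_base p ^+ #|J| :> R.
Proof.
move=> p0; set D := #|J|; have p0' : 0 < p%:R :> R by rewrite ltr0n.
have pS : 0 < p.+1%:R :> R by rewrite ltr0n.
pose lam : R := p%:R / p.+1%:R.
have lam0 : 0 < lam by rewrite divr_gt0.
have lam1 : lam <= 1 by rewrite ler_pdivrMr// mul1r ler_nat.
have lamC : 1 - lam = p.+1%:R^-1.
  by rewrite /lam -natr1; field; rewrite natr1 gt_eqF.
have geo : \sum_(i < N) lam ^+ i <= p.+1%:R.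
  have h := subrX1 lam N; have hl : 0 <= lam ^+ N by rewrite exprn_ge0// ltW.
  rewrite -(ler_pM2l (_ : 0 < 1 - lam)); last by rewrite lamC invr_gt0.
  rewrite {2}lamC mulVf ?gt_eqF//.
  have -> : (1 - lam) * (\sum_(i < N) lam ^+ i) = 1 - lam ^+ N.
    by rewrite -[1 - lam]opprB mulNr -h opprB.
  by rewrite gerBl.
have lamp : lam ^- p <= expR 1.
  rewrite -exprVn; have -> : lam^-1 = 1 + p%:R^-1.
    by rewrite /lam invf_div -natr1; field; rewrite gt_eqF.
  have -> : expR 1 = expR (p%:R^-1) ^+ p :> R.
    by rewrite -expRM_natr mulVf// gt_eqF.
  by rewrite lerXn2r ?nnegrE ?expR_ge0 ?addr_ge0 ?invr_ge0// expR_ge1Dx.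
rewrite -sum1_card natr_sum.
apply: (@le_trans _ _ (\sum_(f : {ffun J -> bool * 'I_N}) lam ^- (D * p) * \prod_j lam ^+ (f j).2)).
  rewrite big_mkcond /=; apply: ler_sum => f _; case: ifPn => [|_]; last first.
    by rewrite mulr_ge0 ?invr_ge0 ?exprn_ge0 ?prodr_ge0// ?ltW// => j _; rewrite exprn_ge0// ltW.
  rewrite finset.inE => hf; rewrite prodrXr mulrC ler_pdivlMr ?exprn_gt0// mul1r.
  by apply: ler_wiXn2l => //; exact: ltW.
rewrite -mulr_sumr.
have <- : (\prod_(j : J) \sum_(a : bool * 'I_N) lam ^+ a.2) =
    \sum_(f : {ffun J -> bool * 'I_N}) \prod_j lam ^+ (f j).2.
  by rewrite (bigA_distr_bigA (fun (j : J) (a : bool * 'I_N) => lam ^+ a.2)).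
rewrite prodr_const -/D mulnC exprM -exprVn -exprMn.
apply: lerXn2r; rewrite ?nnegrE.
- rewrite mulr_ge0 ?invr_ge0 ?exprn_ge0// ?(ltW lam0)//.
  by apply: sumr_ge0 => a _; rewrite exprn_ge0// ltW.
- exact: le_trans ler01 (net_base_ge1 p).
have -> : \sum_(a : bool * 'I_N) lam ^+ a.2 = 2 * \sum_(i < N) lam ^+ i.
  rewrite -(pair_bigA _ (fun (b : bool) (i : 'I_N) => lam ^+ i)) /=.
  by rewrite sumr_const card_bool -[LHS]mulr_natl.
rewrite /net_base mulrA (mulrC _ 2); apply: ler_pM => //.
- by rewrite mulr_ge0// invr_ge0 exprn_ge0// ltW.
- by apply: sumr_ge0 => a _; rewrite exprn_ge0// ltW.
- by rewrite ler_wpM2l.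
Qed.

(** Rounding each coordinate toward 0 to a multiple of [h = theta / sqrt D] costs at most
    [D h^2 = theta^2]. As [|x|_1 <= sqrt D], the integer magnitudes sum to at most
    [D / theta <= D p], and [card_l1_ball] counts such points without volumes. *)
Lemma euclidean_net (J : finType) (theta : R) (p : nat) : 0 < theta -> 1 <= theta * p%:R ->
  exists s : seq {ffun J -> R}, (size s)%:R <= net_base p ^+ #|J| /\
    forall x : J -> R, \sum_j x j ^+ 2 <= 1 ->
      exists2 y, y \in s & \sum_j (x j - y j) ^+ 2 <= theta ^+ 2.
Proof.
move=> t0 tp; set D := #|J|.
have p0 : (0 < p)%N by rewrite lt0n; apply/eqP => p0; rewrite p0 mulr0 ler10 in tp.
pose N := (D * p).+1.
pose r := Num.sqrt (D%:R : R).
pose h := theta / r.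
pose G := [set f : {ffun J -> bool * 'I_N} | (\sum_j (f j).2 <= D * p)%N]%SET.
pose F (f : {ffun J -> bool * 'I_N}) : {ffun J -> R} :=
  [ffun j => (-1) ^+ (f j).1 * ((f j).2%:R * h)].
exists [seq F f | f <- enum G]; split.
  by rewrite size_map -cardE; exact: card_l1_ball.
move=> x x1; have [D0|D0] := posnP D.
  have J0 (j : J) : False by have := card0_eq D0 j; rewrite inE.
  exists (F [ffun=> (false, ord0)]); last by rewrite big1 ?sqr_ge0// => j; case: (J0 j).
  by apply/mapP; eexists => //; rewrite mem_enum finset.inE big1// => j; case: (J0 j).
have r0 : 0 < r by rewrite sqrtr_gt0 ltr0n.
have r2 : r ^+ 2 = D%:R by rewrite sqr_sqrtr// ler0n.
have h0 : 0 < h by rewrite divr_gt0.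
pose a j := Num.truncn (`|x j| / h).
have ah j : (a j)%:R * h <= `|x j| < (a j).+1%:R * h.
  rewrite -ler_pdivlMr// -ltr_pdivrMr// truncnS_gt andbT.
  by rewrite truncn_le divr_ge0// ltW.
have sa : (\sum_j a j <= D * p)%N.
  rewrite -(ler_nat R) natr_sum -(ler_pM2r h0) mulr_suml.
  (* Cauchy-Schwarz in the form [2 |x_j| <= r x_j^2 + 1 / r]. *)
  apply: (@le_trans _ _ (\sum_j (x j ^+ 2 * r / 2 + (r^-1) / 2))).
    apply: ler_sum => j _; apply: le_trans (proj1 (andP (ah j))) _.
    have -> : x j ^+ 2 * r / 2 + r^-1 / 2 = (x j ^+ 2 * r ^+ 2 + 1) / (2 * r).
      by field; rewrite gt_eqF.
    rewrite ler_pdivlMr ?mulr_gt0// -[x j ^+ 2]real_normK ?num_real//.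
    by have := sqr_ge0 (`|x j| * r - 1); lra.
  rewrite big_split /= -!mulr_suml sumr_const -/D -[r^-1 *+ D]mulr_natr.
  have -> : (D * p)%:R * h = r * (theta * p%:R).
    by rewrite natrM -r2 /h; field; rewrite gt_eqF.
  have -> : r^-1 * D%:R / 2 = r / 2 by rewrite -r2; field; rewrite gt_eqF.
  have h1 : (\sum_j x j ^+ 2) * r <= r by rewrite ger_pMl.
  have h2 : r <= r * (theta * p%:R) by rewrite ler_pMr.
  by lra.
have aN j : (a j < N)%N.
  by rewrite ltnS; apply: leq_trans sa; rewrite (bigD1 j)//= leq_addr.
pose f : {ffun J -> bool * 'I_N} := [ffun j => (x j < 0, Ordinal (aN j))].
exists (F f).
  apply/mapP; exists f => //; rewrite mem_enum finset.inE.
  by under eq_bigr => j _ do rewrite ffunE.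
apply: (@le_trans _ _ (\sum_(j : J) h ^+ 2)).
  apply: ler_sum => j _; rewrite /F !ffunE /=.
  have /andP[a1 a2] := ah j; move: a2; rewrite -natr1 mulrDl mul1r => a2.
  rewrite -real_normK ?num_real// -[leRHS]real_normK ?num_real//.
  rewrite lerXn2r ?nnegrE ?normr_ge0// [`|h|]ger0_norm ?(ltW h0)//.
  move: a1 a2; case: (ltP (x j) 0) => xj; rewrite ?expr0 ?expr1 ?mul1r ?mulN1r.
    rewrite (ltr0_norm xj) => a1 a2; rewrite ler_norml; apply/andP; split; lra.
  rewrite (ger0_norm xj) => a1 a2; rewrite ler_norml; apply/andP; split; lra.
rewrite sumr_const -/D -[leLHS]mulr_natr /h expr_div_n r2 mulfVK//.
by rewrite pnatr_eq0 -lt0n.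
Qed.

Lemma complex_net (n : nat) (s : {set 'I_n}) (theta : R) (p : nat) : 0 < theta -> 1 <= theta * p%:R ->
  exists N : seq 'cV[C]_n, (size N)%:R <= net_base p ^+ (2 * #|s|) /\
    forall z : 'cV[C]_n, nsqr s z <= 1 ->
      exists2 y, y \in N & (forall i, i \notin s -> y i 0 = 0) /\ nsqr s (z - y) <= theta ^+ 2.
Proof.
move=> t0 tp; pose J := ({i : 'I_n | i \in s} * bool)%type.
have cJ : #|{: J}| = (2 * #|s|)%N by rewrite card_prod card_sig card_bool mulnC.
have [N [N1 N2]] := @euclidean_net J theta p t0 tp.
pose F (y : {ffun J -> R}) : 'cV[C]_n := \col_i
  (if insub i is Some u then (y (u, false) +i* y (u, true))%C else 0).
have FE y (u : {i : 'I_n | i \in s}) : F y (val u) 0 = (y (u, false) +i* y (u, true))%C.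
  by rewrite mxE valK.
pose c (z : 'cV[C]_n) (j : J) := if j.2 then complex.Im (z (val j.1) 0) else complex.Re (z (val j.1) 0).
have sumJ z (y : J -> R) : \sum_j (c z j - y j) ^+ 2 =
   \sum_(u : {i : 'I_n | i \in s}) nsq (z (val u) 0 - (y (u, false) +i* y (u, true))%C).
  pose g (u : {i : 'I_n | i \in s}) b := (c z (u, b) - y (u, b)) ^+ 2.
  rewrite (eq_bigr (fun j => g j.1 j.2)); last by case.
  rewrite -(pair_bigA _ g) /=; apply: eq_bigr => u _; rewrite /g.
  by rewrite big_bool /c /nsq /= addrC; case: (z _ 0).
exists [seq F y | y <- N]; split; first by rewrite size_map -cJ.
move=> z z1; have [|y yN yz] := N2 (c z).
  rewrite (eq_bigr (fun j => (c z j - 0) ^+ 2)); last by move=> j _; rewrite subr0.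
  rewrite (sumJ z (fun=> 0)); apply: le_trans z1.
  by rewrite /nsqr (big_sub (mem s)); apply: ler_sum => u _; rewrite subr0.
exists (F y); first exact: map_f.
split=> [i iJ|]; first by rewrite mxE insubN.
apply: le_trans yz; rewrite sumJ /nsqr (big_sub (mem s)) /=; apply: ler_sum => u _.
by rewrite mxE [X in _ + X]mxE (FE y u).
Qed.

End Net.

Lemma union_bound (R : realType) (d : measure_display) (T : measurableType d)
    (P : probability T R) (I : choiceType) (s : seq I) (F : I -> set T) (E : set T) (b : R) :
  (forall i, measurable (F i)) -> measurable E ->
  (forall t, E t -> exists2 i, i \in s & F i t) ->
  (forall i, i \in s -> (P (F i) <= b%:E)%E) -> (P E <= ((size s)%:R * b)%:E)%E.
Proof.
move=> mF mE EF Fb; have mU s' : measurable (\big[setU/set0]_(i <- s') F i).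
  by apply: bigsetU_measurable => i _; exact: mF.
apply: (@le_trans _ _ (P (\big[setU/set0]_(i <- s) F i))).
  apply: le_measure; rewrite ?inE// => t /EF[i si Fi].
  by rewrite -bigcup_seq; exists i.
elim: s Fb {EF} => [|i s IH] Fb; first by rewrite big_nil measure0 mul0r.
rewrite big_cons; apply: (le_trans (@measureU2 _ _ _ P _ _ (mF i) (mU s))).
rewrite /= -natr1 mulrDl mul1r [_ * b + b]addrC EFinD; apply: leeD; first by apply: Fb; rewrite mem_head.
by apply: IH => j js; apply: Fb; rewrite in_cons js orbT.
Qed.

(** * Almost null vectors when there are few small singular directions *)

Section CompressedVectors.
Context (R : realType) (n : nat).
Local Notation C := R[i].
Local Notation cfg := (config R ('I_n * 'I_n)%type).
Variable S : 'M[C]_n.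

(** The strict inequality excludes [x = 0] and makes the event accessible to
    [measurable_exists_lt]. *)
Definition almost_null (Cs : {set 'I_n}) (t2 : R) : set cfg :=
  [set a | exists2 x : 'cV[C]_n, (forall i, i \notin Cs -> x i 0 = 0) &
     nsqr [set: 'I_n]%SET (cmx S a *m x) < t2 * nsqv x].

Definition rows_bounded (I2 Cs : {set 'I_n}) (L2 : R) : set cfg :=
  [set a | forall x : 'cV[C]_n, (forall i, i \notin Cs -> x i 0 = 0) ->
     nsqr I2 (cmx S a *m x) <= L2 * nsqv x].

Lemma continuous_scaled (r : R) : continuous (fun x : 'rV[R]_(n + n) => r * nsqv (decode x)).
Proof. by move=> x; apply: (cvgM (cvg_cst r) (@continuous_nsqv_decode R n x)). Qed.

Lemma measurable_almost_null Cs t2 : measurable (almost_null Cs t2).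
Proof.
rewrite (_ : almost_null _ _ = [set a : cfg | exists2 x : 'cV[C]_n,
    (forall i, i \notin Cs -> x i 0 = 0) &
    nsqr [set: 'I_n]%SET (cmx S a *m x) < 0 + t2 * nsqv x]).
  exact: (@measurable_exists_vec R n S _ [set x : 'cV[C]_n | forall i, i \notin Cs -> x i 0 = 0]
    (fun x => t2 * nsqv x) 0 (@continuous_scaled t2)).
by apply/seteqP; split => a -[x x0 hx]; exists x; rewrite // add0r in hx *.
Qed.

Lemma measurable_rows_bounded I2 Cs L2 : measurable (rows_bounded I2 Cs L2).
Proof.
rewrite (_ : rows_bounded _ _ _ = ~` [set a : cfg | exists2 x : 'rV[R]_(n + n),
    (forall i, i \notin Cs -> decode x i 0 = 0) &
    L2 * nsqv (decode x) - nsqr I2 (cmx S a *m decode x) < 0]).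
  apply: measurableC; apply: (@measurable_exists_lt _ _ _ _
    [set x | forall i, i \notin Cs -> decode x i 0 = 0]
    (fun (a : cfg) x => L2 * nsqv (decode x) - nsqr I2 (cmx S a *m decode x))).
    move=> x; apply: measurable_funB => //; exact: measurable_nsqr.
  by move=> a x; apply: (cvgB (@continuous_scaled L2 x) (@continuous_nsqr R n (cmx S a) I2 x)).
apply/seteqP; split => a /=.
  by move=> h [x x0]; rewrite subr_lt0 ltNge h.
by move=> h x x0; rewrite leNgt; apply/negP => hx; apply: h; exists (encode x);
  rewrite encodeK// subr_lt0.
Qed.

Context (K : R) (d : measure_display) (T : measurableType d) (P : probability T R).
Variable X : T -> cfg.
Hypothesis M : entry_model (@transpose_pair n) K P X.
Variables (Rw Cs I2 : {set 'I_n}).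
Hypothesis I2R : [disjoint I2 & Rw]%B.
Hypothesis I2C : [disjoint I2 & Cs]%B.
Variables (l k e p : nat) (r tau2 t2 L2 theta rho2 c : R).
Hypothesis n0 : (0 < n)%N.
Hypothesis lk : (l <= k)%N.
Hypothesis tau0 : 0 < tau2.
Hypothesis tau_r : tau2 * (2 * n%:R) / (k.+1 - l)%:R < r.

(** The block is padded with zeros to full size, so that all matrices and vectors keep one index
    type. *)
Definition restricted (a : cfg) : 'M[C]_n := coord_proj R Rw *m (cmx S a *m coord_proj R Cs).

Lemma coord_proj_id (A : {set 'I_n}) (v : 'cV[C]_n) :
  (forall i, i \notin A -> v i 0 = 0) -> coord_proj R A *m v = v.
Proof.
move=> v0; apply/matrixP => i j; rewrite ord1 coord_projE.
by case: ifPn => // /v0 ->.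
Qed.

Lemma nsqv_restricted a (v : 'cV[C]_n) : (forall i, i \notin Cs -> v i 0 = 0) ->
  nsqv (restricted a *m v) = nsqr Rw (cmx S a *m v).
Proof. by move=> v0; rewrite /restricted -!mulmxA (coord_proj_id v0) nsqr_coord. Qed.

Lemma restricted0 a i j : j \notin Cs -> restricted a i j = 0.
Proof.
move=> jC; have -> : restricted a i j = (restricted a *m (delta_mx j 0 : 'cV[C]_n)) i 0.
  by rewrite -colE [RHS]mxE.
rewrite /restricted -!mulmxA (_ : coord_proj R Cs *m delta_mx j 0 = 0) ?mulmx0 ?mxE//.
apply/matrixP => u v; rewrite coord_projE !mxE.
by case: ifPn => // uC; case: eqP => // uj; rewrite uj (negPf jC) in uC.
Qed.

(** With more than [k] small directions the projection onto their span would have trace at least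
    [(k.+1 - l) + l], and [close_count_ge] would contradict the assumed bound on the count. *)
Lemma few_small_directions a :
  close_count S Rw Cs r l finset.set0 a < ((k.+1 - l)%:R / 2) ^+ l ->
  exists (U : 'M[C]_n) (s : {set 'I_n}),
    [/\ ctr U *m U = 1%:M, U *m ctr U = 1%:M,
        forall q i, q \in s -> i \notin Cs -> U q i = 0, (#|s| <= k)%N &
        forall v : 'cV[C]_n, (forall i, i \notin Cs -> v i 0 = 0) ->
          tau2 * nsqr (~: s) (U *m v) <= nsqr Rw (cmx S a *m v)].
Proof.
move=> cc; have [U [s [U1 U2 U0 Us Uv]]] := small_singular_space tau0 (fun i q => @restricted0 a q i).
exists U, s; split=> //; last by move=> v v0; rewrite -nsqv_restricted//; exact: Uv.
rewrite leqNgt; apply/negP => ks; move: cc; rewrite ltNge => /negP; apply.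
have sC v i : i \notin Cs -> (span_proj U s *m v) i 0 = 0.
  move=> iC; rewrite /span_proj -!mulmxA mxE big1// => q _; rewrite coord_projE ctrE.
  by case: ifPn => [/U0 -> //|_]; rewrite ?rmorph0 ?mul0r ?mulr0.
apply: (@close_count_ge _ _ _ _ _ _ _ _ _ (span_proj U s) (k.+1 - l)%:R tau2) => //.
- by rewrite ltr0n subn_gt0 ltnS.
- exact: ltW.
- exact: oproj_span.
- by rewrite ptrace_span// -natrD ler_nat subnK// leqW.
- move=> j; rewrite finset.setD0 => jC.
  rewrite pdiag_nsqv; last exact: oproj_span.
  rewrite colE /span_proj -!mulmxA (_ : coord_proj R s *m _ = 0) ?mulmx0.
    by apply/eqP; rewrite nsqv_eq0.
  apply/matrixP => q i; rewrite coord_projE -colE !mxE.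
  by case: ifPn => // /U0 ->.
- by move=> v; rewrite finset.setD0 -nsqv_restricted//; exact: sC.
Qed.

Hypothesis theta0 : 0 < theta.
Hypothesis theta_p : 1 <= theta * p%:R.
Hypothesis theta_small : theta ^+ 2 <= 8^-1.
Hypothesis t2_le : t2 <= theta ^+ 2 * tau2.
Hypothesis L0 : 0 <= L2.

(** The net lives in the small singular directions of the block [Rw], [Cs], and therefore serves
    every [b] that agrees with [a] there. A normalized almost null vector has mass at most
    [t2 / tau2 <= theta ^+ 2] in the other directions, and [rows_bounded] controls the effect of
    replacing it by a net point. *)
Lemma compressed_net a :
  close_count S Rw Cs r l finset.set0 a < ((k.+1 - l)%:R / 2) ^+ l ->
  exists N : seq 'cV[C]_n, [/\ (size N)%:R <= net_base R p ^+ (2 * k),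
    forall y, y \in N -> (forall i, i \notin Cs -> y i 0 = 0) /\ 4^-1 <= nsqv y &
    forall b, (forall q, q \in block Rw Cs -> b q = a q) ->
      almost_null Cs t2 b -> rows_bounded I2 Cs L2 b ->
      exists2 y, y \in N & nsqr I2 (cmx S b *m y) < 2 * (t2 + 2 * L2 * theta ^+ 2)].
Proof.
move=> cc; have [U [s [U1 U2 U0 sk Uv]]] := few_small_directions cc.
have [N [N1 N2]] := @complex_net R n s theta p theta0 theta_p.
(* Only net points close to a unit vector matter: from [1 <= 2 (2 theta^2 + |z|^2)] and
   [theta^2 <= 1 / 8] they satisfy [|z|^2 >= 1 / 4]. *)
pose good (z : 'cV[C]_n) := (4^-1 <= nsqv z) && [forall i, (i \in s) || (z i 0 == 0)].
have zC z : good z -> forall i, i \notin Cs -> (ctr U *m z) i 0 = 0.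
  move=> /andP[_ /forallP zs] i iC; rewrite mxE big1// => q _; rewrite ctrE.
  have /orP[/U0 -> //|/eqP ->] := zs q; last by rewrite mulr0.
  by rewrite conjC0 mul0r.
exists [seq ctr U *m z | z <- N & good z]; split.
- rewrite size_map size_filter; apply: (@le_trans _ _ (size N)%:R).
    by rewrite ler_nat count_size.
  apply: le_trans N1 _; apply: ler_weXn2l; first exact: net_base_ge1.
  by rewrite leq_mul2l.
- move=> y /mapP[z]; rewrite mem_filter => /andP[gz _] ->; split; first exact: zC.
  by rewrite nsqv_unitary ?ctrK//; case/andP: gz.
move=> b ab [x x0 hx] hb.
have xpos : 0 < nsqv x.
  rewrite lt_def nsqv_ge0 andbT; apply/eqP => h; move: hx; rewrite h mulr0 ltNge.
  by rewrite nsqr_ge0.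
pose v := ((Num.sqrt (nsqv x))^-1)%:C%C *: x.
have nc := nsq_normalizer x.
have v0 i : i \notin Cs -> v i 0 = 0 by move=> /x0; rewrite mxE => ->; rewrite mulr0.
have v1 : nsqv v = 1 by rewrite nsqvZ nc mulVf// gt_eqF.
have hv : nsqr [set: 'I_n]%SET (cmx S b *m v) < t2.
  by rewrite -scalemxAr nsqrZ nc mulrC ltr_pdivrMr.
pose w := U *m v.
have w1 : nsqv w = 1 by rewrite nsqv_unitary.
have nsqrC z : nsqv z = nsqr s z + nsqr (~: s) z.
  rewrite /nsqv (bigID (mem s)) /=; congr (_ + _).
  by apply: eq_bigl => i; rewrite finset.inE.
have far : nsqr (~: s) w <= theta ^+ 2.
  have := Uv v v0; rewrite -(depends_mulmx S ab v0) => h1.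
  have h2 := nsqr_sub (cmx S b *m v) (finset.subsetT Rw).
  have h3 : tau2 * nsqr (~: s) w <= tau2 * theta ^+ 2.
    by apply: le_trans h1 _; apply: le_trans h2 _; apply: le_trans (ltW hv) _; rewrite mulrC.
  by rewrite ler_pM2l in h3.
have [z zN [z0 wz]] : exists2 y, y \in N & (forall i, i \notin s -> y i 0 = 0) /\ nsqr s (w - y) <= theta ^+ 2.
  by apply: N2; rewrite -w1 nsqr_le_nsqv.
have wz2 : nsqv (w - z) <= 2 * theta ^+ 2.
  rewrite nsqrC; have -> : nsqr (~: s) (w - z) = nsqr (~: s) w.
    apply: eq_bigr => i; rewrite finset.inE => /z0 zi.
    by rewrite mxE [X in _ + X]mxE zi subr0.
  by lra.
have gz : good z.
  apply/andP; split; last by apply/forallP => i; case: (boolP (i \in s)) => //= /z0 ->.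
  have := nsqvD_le (w - z) z; rewrite subrK w1 => h.
  have h8 := theta_small.
  suff : 1 <= 2 * (2 * 8^-1 + nsqv z) by lra.
  by apply: le_trans h _; rewrite ler_wpM2l// lerD2r; apply: le_trans wz2 _; rewrite ler_wpM2l.
exists (ctr U *m z); first by apply: map_f; rewrite mem_filter gz.
pose y := ctr U *m z.
have yE : y = v - ctr U *m (w - z) by rewrite mulmxBr /w mulmxA U1 mul1mx opprB addrC subrK.
have dv0 i : i \notin Cs -> (v - y) i 0 = 0.
  by move=> iC; rewrite mxE v0// add0r mxE zC// oppr0.
have dv : nsqv (v - y) <= 2 * theta ^+ 2.
  by rewrite yE opprB addrC subrK nsqv_unitary// ctrK.
have h1 : nsqr I2 (cmx S b *m v) < t2.
  by apply: le_lt_trans hv; apply: nsqr_sub; exact: finset.subsetT.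
have h2 : nsqr I2 (cmx S b *m (v - y)) <= 2 * L2 * theta ^+ 2.
  apply: le_trans (hb _ dv0) _; rewrite (mulrC 2) -mulrA.
  by rewrite ler_wpM2l.
have -> : cmx S b *m (ctr U *m z) = cmx S b *m v + - (cmx S b *m (v - y)).
  by rewrite -mulmxN -mulmxDr opprB addrC subrK.
rewrite nsqr_coord mulmxDr; apply: le_lt_trans (nsqvD_le _ _) _.
rewrite mulmxN nsqvN -!nsqr_coord.
by rewrite ltr_pM2l// ltr_leD.
Qed.

Hypothesis eI : (e <= #|I2|)%N.
Hypothesis c0 : 0 < c.
Hypothesis rho0 : 0 <= rho2.
Hypothesis rho_c : 8 * rho2 <= c ^+ 10.
Hypothesis rho_ge : 2 * (t2 + 2 * L2 * theta ^+ 2) <= e.+1%:R * rho2.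

Definition compressed_event : set cfg :=
  [set a | close_count S Rw Cs r l finset.set0 a < ((k.+1 - l)%:R / 2) ^+ l] `&`
    (almost_null Cs t2 `&` rows_bounded I2 Cs L2).

Lemma measurable_compressed_event : measurable compressed_event.
Proof.
apply: measurableI; last first.
  by apply: measurableI; [exact: measurable_almost_null|exact: measurable_rows_bounded].
by apply: measurable_strict_sublevel; exact: measurable_close_count.
Qed.

Lemma depends_compressed_event : depends_on (block [set: 'I_n]%SET Cs) compressed_event.
Proof.
have half a b : (forall q, q \in block [set: 'I_n]%SET Cs -> a q = b q) ->
    compressed_event a -> compressed_event b.
  move=> ab.
  have dm A (x : 'cV[C]_n) : (forall i, i \notin Cs -> x i 0 = 0) ->
      nsqr A (cmx S a *m x) = nsqr A (cmx S b *m x).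
    apply: depends_mulmx => q; rewrite mem_block => /andP[_ qC]; apply: ab.
    by rewrite mem_block finset.inE.
  have dc : close_count S Rw Cs r l finset.set0 a = close_count S Rw Cs r l finset.set0 b.
    apply: depends_close_count => q; rewrite mem_block !finset.setD0 => /andP[_ qC].
    by apply: ab; rewrite mem_block finset.inE.
  move=> [h1 [[x x0 hx] h2]]; split; last split.
  - by move: h1; rewrite /= dc.
  - by exists x; [exact: x0|rewrite -(dm _ x x0)].
  - by move=> y y0; rewrite -dm//; exact: h2.
by move=> a b ab; apply/propext; split; apply: half => // q /ab.
Qed.

(** Refreshing the rows [I2] on the columns [Cs] changes neither the count nor the net, and this
    block contains no transposed pair because [I2] and [Cs] are disjoint. With the net fixed, a
    union bound over it reduces to [rows_prob]. *)
Lemma compressed_prob : (P [set t | compressed_event (X t)] <=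
  (net_base R p ^+ (2 * k) * (2 ^+ #|I2| * lo_bound K c ^+ (#|I2| - e)))%:E)%E.
Proof.
set bound := 2 ^+ #|I2| * _.
have K1 := em_K M.
have lo0 : 0 <= lo_bound K c.
  by rewrite /lo_bound mulr_ge0 ?sqr_ge0// mulr_ge0 ?sqr_ge0// exprn_ge0.
have bound0 : 0 <= bound by rewrite mulr_ge0 ?exprn_ge0.
have C0 : 0 <= net_base R p ^+ (2 * k).
  by rewrite exprn_ge0// (le_trans ler01)// net_base_ge1.
pose Q := block I2 Cs.
apply: (@decoupling_average _ _ _ _ _ _ _ _ M unit (fun=> Q) (block [set: 'I_n]%SET Cs) compressed_event).
- by rewrite card_unit.
- move=> _ u v; rewrite !mem_block => /andP[_ uC] /andP[vI _] vu.
  by move: vI; rewrite vu /= => uI; rewrite (disjointFr I2C uI) in uC.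
- move=> _ u; rewrite !mem_block => /andP[uI _] /andP[_ uC].
  by rewrite (disjointFr I2C uI) in uC.
- exact: measurable_compressed_event.
- exact: depends_compressed_event.
move=> a; rewrite big_const card_unit /= adde0 mul1r.
have mixE b q : q \in block Rw Cs -> mix Q a b q = a q.
  rewrite mem_block /mix /Q mem_block => /andP[qR _].
  by case: (boolP (q.1 \in I2)) => // qI; rewrite (disjointFr I2R qI) in qR.
have ccE b : close_count S Rw Cs r l finset.set0 (mix Q a b) = close_count S Rw Cs r l finset.set0 a.
  by apply: depends_close_count => q; rewrite !finset.setD0; exact: mixE.
have [cc|cc] := ltP (close_count S Rw Cs r l finset.set0 a) (((k.+1 - l)%:R / 2) ^+ l); last first.
  have -> : [set t | compressed_event (mix Q a (X t))] = set0.
    by apply/seteqP; split => // t [/=]; rewrite ccE ltNge cc.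
  by rewrite measure0 lee_fin mulr_ge0.
have [N [N1 N2 N3]] := compressed_net cc.
pose F y := [set t | nsqr I2 (cmx S (X t) *m y) < e.+1%:R * rho2].
have mF y : measurable (F y).
  apply: measurable_strict_sublevel.
  exact: (measurableT_comp (@measurable_nsqr _ _ S I2 y) (measurable_X (em_measurable M))).
have Fb y : y \in N -> (P (F y) <= bound%:E)%E.
  by move=> yN; have [y0 y4] := N2 y yN; exact: (@rows_prob _ _ _ _ _ _ _ M S Cs y y0).
apply: (@le_trans _ _ ((size N)%:R * bound)%:E); last by rewrite lee_fin ler_wpM2r.
apply: union_bound mF _ _ Fb.
  by apply: (measurable_preMix M); exact: measurable_compressed_event.
move=> t [_ [h1 h2]]; have [y yN hy] := N3 _ (mixE (X t)) h1 h2.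
exists y => //; rewrite /F /=; apply: lt_le_trans rho_ge.
rewrite (@depends_mulmx _ _ S I2 Cs (X t) (mix Q a (X t)) y _ (proj1 (N2 y yN)))// => q qQ.
by rewrite /mix qQ.
Qed.

End CompressedVectors.

(** * Factorial and binomial estimates *)

Section Factorials.
Context (R : realType).
Local Notation E := (expR 1 : R).

Lemma expn_fact_le (q : nat) : q%:R ^+ q <= E ^+ q * q`!%:R.
Proof.
case: q => [|q]; first by rewrite !expr0 mul1r.
have f0 : 0 < q.+1`!%:R :> R by rewrite ltr0n fact_gt0.
rewrite -ler_pdivrMr// -expRM_natl mulr1.
apply: le_trans (expR_ge1Dxn q (ler0n R q.+1)); by rewrite lerDr.
Qed.

Lemma expn_div_fact_le (x : R) (q : nat) : 0 <= x -> (0 < q)%N ->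
  x ^+ q / q`!%:R <= (E * x / q%:R) ^+ q.
Proof.
move=> x0 q0; have q0' : 0 < q%:R :> R by rewrite ltr0n.
have f0 : 0 < q`!%:R :> R by rewrite ltr0n fact_gt0.
rewrite ler_pdivrMr// expr_div_n mulrAC ler_pdivlMr ?exprn_gt0// exprMn.
rewrite [leRHS]mulrAC -[leLHS]mulrC; apply: ler_wpM2r; first exact: exprn_ge0.
exact: expn_fact_le.
Qed.

Lemma prod_sqrt_sqr (n q : nat) :
  (\prod_(c < q) Num.sqrt (n%:R / c.+1%:R : R)) ^+ 2 = n%:R ^+ q / q`!%:R.
Proof.
elim: q => [|q IH]; first by rewrite big_ord0 !expr0 expr1n divr1.
rewrite big_ord_recr /= exprMn IH sqr_sqrtr ?divr_ge0// factS natrM exprSr.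
by rewrite mulf_div (mulrC q`!%:R).
Qed.

(** The square of the product is [n^q / q!], and [q! >= (q / e)^q]. *)
Lemma prod_sqrt_le (n q k : nat) (y : R) : (0 < q)%N -> 1 <= y -> E * n%:R / q%:R <= y ->
  (q <= 2 * k)%N -> \prod_(c < q) Num.sqrt (n%:R / c.+1%:R : R) <= y ^+ k.
Proof.
move=> q0 y1 ny qk; have y0 : 0 <= y by apply: le_trans y1.
rewrite -ler_sqr ?nnegrE ?exprn_ge0 ?prodr_ge0//.
rewrite prod_sqrt_sqr; apply: le_trans (expn_div_fact_le (ler0n R n) q0) _.
apply: (@le_trans _ _ (y ^+ q)).
  by apply: lerXn2r; rewrite ?nnegrE ?divr_ge0 ?mulr_ge0 ?expR_ge0.
by rewrite -exprM mulnC; apply: ler_weXn2l.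
Qed.

Lemma bin_le (n m : nat) : (0 < m)%N -> 'C(n, m)%:R <= (E * n%:R / m%:R) ^+ m.
Proof.
move=> m0; apply: le_trans (expn_div_fact_le (ler0n R n) m0).
have f0 : 0 < m`!%:R :> R by rewrite ltr0n fact_gt0.
rewrite ler_pdivlMr// -natrM bin_ffact -natrX ler_nat.
rewrite ffact_prod -[X in (_ <= _ ^ X)%N]card_ord -prod_nat_const.
by apply: leq_prod => i _; exact: leq_subr.
Qed.

End Factorials.

(** * Markov's inequality for the count, and index sets of bounded size *)

Section NullProbability.
Context (R : realType) (n : nat).
Local Notation C := R[i].
Local Notation cfg := (config R ('I_n * 'I_n)%type).
Local Notation E := (expR 1 : R).
Variable S : 'M[C]_n.
Context (K : R) (d : measure_display) (T : measurableType d) (P : probability T R).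
Variable X : T -> cfg.
Hypothesis M : entry_model (@transpose_pair n) K P X.

Lemma close_count_markov (Rw Cs : {set 'I_n}) (r : R) (l q e : nat) (rho thr : R) :
  Cs \subset Rw -> (#|Cs| + q <= #|Rw|)%N -> (e <= q)%N -> 0 < rho ->
  r = e.+1%:R * rho ^+ 2 -> 0 < thr ->
  (P [set t | (thr ^+ l <= close_count S Rw Cs r l finset.set0 (X t))%R] <=
    ((n%:R * close_bound n K q e rho / thr) ^+ l)%:E)%E.
Proof.
move=> CR qCR eq rho0 rE thr0.
have mX := measurable_X (em_measurable M).
have mcc : measurable_fun [set: T] (fun t => close_count S Rw Cs r l finset.set0 (X t)).
  by apply: (measurableT_comp _ mX); exact: measurable_close_count.
pose F := [set t | (thr ^+ l <= close_count S Rw Cs r l finset.set0 (X t))%R].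
have mF : measurable F by exact: measurable_superlevel.
have tl : 0 < thr ^+ l by exact: exprn_gt0.
have h := @close_count_expectation R n S Rw Cs r K d T P X M l q e rho finset.set0 CR qCR eq rho0 rE (finset.sub0set _).
have h2 : ((thr ^+ l)%:E * P F <= \int[P]_t (close_count S Rw Cs r l finset.set0 (X t))%:E)%E.
  have -> : P F = (\int[P]_t (\1_F t : R)%:E)%E by rewrite integral_indic// setIT.
  rewrite -ge0_integralZl//; last 2 first.
  - by apply/measurable_EFinP; exact: measurable_indic.
  - by rewrite lee_fin ltW.
  apply: ge0_le_integral => //.
  - by move=> t _; rewrite lee_fin mulr_ge0// ltW.
  - by apply/measurable_EFinP; apply: measurable_funM => //; exact: measurable_indic.
  - exact/measurable_EFinP.
  - move=> t _; rewrite -EFinM lee_fin indicE.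
    case: (boolP (t \in F)) => [|_]; first by rewrite inE mulr1.
    by rewrite mulr0 close_count_ge0.
have pm : (P F \is a fin_num)%E by exact: fin_num_measure.
move: (le_trans h2 h); rewrite -[P F](fineK pm) -EFinM !lee_fin => h3.
by rewrite expr_div_n ler_pdivlMr// mulrC.
Qed.

End NullProbability.

Section NullProbabilitySmall.
Context (R : realType) (n : nat).
Local Notation C := R[i].
Local Notation cfg := (config R ('I_n * 'I_n)%type).
Local Notation E := (expR 1 : R).
Variable S : 'M[C]_n.
Context (K : R) (d : measure_display) (T : measurableType d) (P : probability T R).
Variable X : T -> cfg.
Hypothesis M : entry_model (@transpose_pair n) K P X.
Variables (I : {set 'I_n}) (B w : R).
Hypothesis B1 : 1 <= B.
Hypothesis w0 : 0 < w.
Hypothesis w1 : w <= 1.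
Hypothesis nw : n%:R * w <= #|I|%:R.
Hypothesis m9 : (9 <= #|I|)%N.

Let n0 : (0 < n)%N.
Proof. by have := max_card (mem I); rewrite card_ord => /(leq_trans m9); exact: leq_trans. Qed.

Let K1 : 1 <= K. Proof. exact: em_K M. Qed.

Let E1 : 1 <= E. Proof. exact: expR1_ge1. Qed.

(** The largest coordinate [x_j] has squared modulus at least [|x|^2 / n], so [x / x_j] witnesses
    that column [j] is close. *)
Lemma almost_null_close (Cs : {set 'I_n}) (t2 : R) (a : cfg) : 0 <= t2 ->
  almost_null S Cs t2 a -> 1 <= close_count S finset.setT Cs (t2 * n%:R) 1 finset.set0 a.
Proof.
move=> t20 [x x0 hx].
have xpos : 0 < nsqv x.
  rewrite lt_def nsqv_ge0 andbT; apply/eqP => h; move: hx; rewrite h mulr0 ltNge.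
  by rewrite nsqr_ge0.
have [j _ jmax] := @arg_maxP _ _ _ (Ordinal n0) predT (fun i => nsq (x i 0)) isT.
have xn : nsqv x <= n%:R * nsq (x j 0).
  apply: (@le_trans _ _ (\sum_(i : 'I_n) nsq (x j 0))); first by apply: ler_sum => i _; exact: jmax.
  by rewrite sumr_const card_ord mulr_natl.
have xj : 0 < nsq (x j 0).
  by rewrite -(pmulr_rgt0 _ (_ : 0 < n%:R)) ?ltr0n//; exact: lt_le_trans xn.
have xj0 : x j 0 != 0 by rewrite -nsq_eq0 gt_eqF.
have jC : j \in Cs by apply: contraNT xj0 => /x0 ->.
rewrite /= finset.setD0 (bigD1 j)//= -[leLHS]addr0; apply: lerD; last first.
  by apply: sumr_ge0 => i _; rewrite mulr1 indicE ler0n.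
rewrite mulr1 indicE mem_set//; exists ((x j 0)^-1 *: x).
  split; first by rewrite mxE mulVf.
  move=> i; rewrite !finset.inE !orbF; case: eqVneq => //= ij /x0 xi.
  by rewrite mxE xi mulr0.
apply: le_lt_trans (nsqr_sub _ (finset.subsetT _)) _.
rewrite -scalemxAr nsqrZ.
rewrite nsqV mulrC ltr_pdivrMr//; apply: lt_le_trans hx _.
by rewrite -mulrA ler_wpM2l.
Qed.

(** A single close column with all rows, codimension [m = |I|] and no large direction. As
    [n * w <= m0], the bound is about [n (m0 w^4)^m]; the factor [n] uses up one power of [w], and
    [4m - 1 >= m + 12] by the lower bound on [m]. *)
Lemma almost_null_prob_small (m0 : nat) : (#|I| <= m0)%N ->
  (P [set t | almost_null S (~: I) (49 * B ^+ 2 * w ^+ 12 * n%:R) (X t)] <=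
     ((28 * K * B * E * m0%:R ^+ 2) ^+ #|I| * w ^+ (#|I| + 12))%:E)%E.
Proof.
move=> mm0; set m := #|I|; set t2 := 49 * _ * _ * _.
have n0' : 0 < n%:R :> R by rewrite ltr0n.
have B0 : 0 < B by exact: lt_le_trans ltr01 B1.
pose rho := 7 * B * w ^+ 6 * n%:R.
have t20 : 0 <= t2 by rewrite !mulr_ge0 ?exprn_ge0 ?(ltW w0) ?(ltW B0).
have rho0 : 0 < rho by rewrite !mulr_gt0 ?exprn_gt0.
have rE : t2 * n%:R = 1%:R * rho ^+ 2 by rewrite /t2 /rho; ring.
have card : (#|~: I| + m <= #|[set: 'I_n]%SET|)%N by rewrite finset.cardsT addnC cardsC.
have h := close_count_markov S M 1 (finset.subsetT _) card (leq0n m) rho0 rE ltr01.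
apply: le_trans (le_trans _ h) _.
  have mX := measurable_X (em_measurable M).
  apply: le_measure; rewrite ?inE.
  - by apply: (measurable_preX M); exact: measurable_almost_null.
  - apply: measurable_superlevel.
    by apply: (measurableT_comp (@measurable_close_count _ _ _ _ _ _ _ _) mX).
  - by move=> t; rewrite /= expr1; exact: almost_null_close.
rewrite lee_fin expr1 divr1 /close_bound subn0.
have m_gt0 : (0 < m)%N by apply: leq_trans m9.
have m_gt0' : 0 < m%:R :> R by rewrite ltr0n.
have m0' : 1 <= m0%:R :> R by rewrite ler1n; apply: leq_trans mm0.
have mm0' : m%:R <= m0%:R :> R by rewrite ler_nat.
have y1 : 1 <= E / w by rewrite ler_pdivlMr// mul1r; apply: le_trans E1.
have prodb : \prod_(c < m) Num.sqrt (n%:R / c.+1%:R) <= (E / w) ^+ m.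
  apply: prod_sqrt_le => //; last by rewrite mul2n -addnn leq_addr.
  rewrite -mulrA ler_wpM2l ?expR_ge0// ler_pdivrMr// mulrC ler_pdivlMr//.
have K0 : 0 < K by exact: lt_le_trans ltr01 K1.
have E0 : 0 < E by exact: expR_gt0.
apply: (@le_trans _ _ (n%:R * (2 ^+ m * (2 * K * rho) ^+ m * (E / w) ^+ m))).
  apply: ler_wpM2l => //; apply: ler_wpM2l => //.
  have Kr : 0 <= 2 * K * rho by apply: mulr_ge0 (ltW rho0); apply: mulr_ge0 (ltW K0).
  by apply: mulr_ge0; apply: exprn_ge0.
have -> : n%:R * (2 ^+ m * (2 * K * rho) ^+ m * (E / w) ^+ m) =
    n%:R * ((28 * K * B * E) * (n%:R * w) * w ^+ 4) ^+ m.
  rewrite -!exprMn; congr (_ * _ ^+ _); rewrite /rho; field.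
  by rewrite gt_eqF.
pose D := 28 * K * B * E; have D0 : 0 < D by rewrite !mulr_gt0.
have w40 : 0 <= w ^+ 4 by rewrite exprn_ge0// ltW.
apply: (@le_trans _ _ (n%:R * (D * m0%:R * w ^+ 4) ^+ m)).
  apply: ler_wpM2l => //; apply: lerXn2r; rewrite ?nnegrE.
  - by apply: mulr_ge0 w40; apply: mulr_ge0 (ltW D0) _; exact: mulr_ge0 (ltW w0).
  - by apply: mulr_ge0 w40; exact: mulr_ge0 (ltW D0) _.
  apply: ler_wpM2r; first by rewrite exprn_ge0// ltW.
  by apply: ler_wpM2l; [exact: ltW|exact: le_trans nw mm0'].
have -> : n%:R * (D * m0%:R * w ^+ 4) ^+ m =
    (n%:R * w) * ((D * m0%:R) ^+ m * w ^+ (4 * m).-1).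
  rewrite [_ ^+ m]exprMn -exprM -[in LHS](prednK (_ : 0 < 4 * m)%N) ?muln_gt0// exprS.
  by ring.
apply: (@le_trans _ _ (m0%:R * ((D * m0%:R) ^+ m * w ^+ (m + 12)))).
  apply: ler_pM => //.
  - by rewrite mulr_ge0 ?(ltW w0).
  - apply: mulr_ge0; apply: exprn_ge0; last exact: ltW.
    exact: mulr_ge0 (ltW D0) _.
  - exact: le_trans nw mm0'.
  apply: ler_wpM2l; first by rewrite exprn_ge0// mulr_ge0// ltW.
  have mm : (m + 12 <= (4 * m).-1)%N by have : (9 <= m)%N := m9; move: (m) => k; clear; lia.
  exact: ler_wiXn2l (ltW w0) w1 _ _ mm.
rewrite mulrA; apply: ler_wpM2r; first by rewrite exprn_ge0// ltW.
rewrite -/D expr2 mulrA [leRHS]exprMn mulrC; apply: ler_wpM2l.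
  by rewrite exprn_ge0// mulr_ge0// ltW.
by apply: ler_eXnr.
Qed.

End NullProbabilitySmall.

Lemma exists_subset_card (T : finType) (A : {set T}) (k : nat) : (k <= #|A|)%N ->
  exists2 B : {set T}, B \subset A & #|B| = k.
Proof.
move=> kA; exists [set x in take k (enum A)]%SET.
  by apply/fintype.subsetP => x; rewrite finset.inE => /mem_take; rewrite mem_enum.
rewrite cardsE (card_uniqP _) ?size_take -?cardE; last exact: take_uniq (enum_uniq _).
by rewrite /minn; case: ltnP => // h; apply/eqP; rewrite eqn_leq h kA.
Qed.

(** * Numerical bounds for large index sets *)

Section NullProbabilityLarge.
Context (R : realType) (n : nat).
Local Notation C := R[i].
Local Notation cfg := (config R ('I_n * 'I_n)%type).
Local Notation E := (expR 1 : R).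

(** The net costs [g^-12] for each of [2h] real directions and every unexceptional row gains [g^4];
    with [m - 8h] such rows, [4 (m - 8h) - 24 h = 4m - 56h >= 3 (m + 12)]. *)
Lemma incompressible_bound (a A L g : R) (m h : nat) :
  0 <= a -> a * g ^+ 12 <= A -> 1 <= A -> 1 <= L -> 0 < g -> g <= 1 ->
  (100 * h <= m)%N -> (1 <= h)%N ->
  a ^+ (2 * h) * (2 ^+ (m - 4 * h) * (L * g ^+ 4) ^+ (m - 4 * h - 4 * h)) <=
    (2 * A * L) ^+ m * (g ^+ 3) ^+ (m + 12).
Proof.
move=> a0 aA A1 L1 g0 g1 mh h1; set k := (m - 4 * h - 4 * h)%N.
have [j kj jm] : exists2 j, (4 * k = 12 * (2 * h) + j)%N & (3 * (m + 12) <= j)%N.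
  by exists (4 * k - 12 * (2 * h))%N; rewrite /k; clear -mh h1; lia.
have g0' := ltW g0.
have L0 : 0 <= L by exact: le_trans ler01 L1.
have A0 : 0 <= A by exact: le_trans ler01 A1.
have -> : a ^+ (2 * h) * (2 ^+ (m - 4 * h) * (L * g ^+ 4) ^+ k) =
    2 ^+ (m - 4 * h) * (a * g ^+ 12) ^+ (2 * h) * L ^+ k * g ^+ j.
  rewrite (exprMn _ L) (exprMn _ a) -!(exprM g) kj exprD; ring.
rewrite -(exprM g) (exprMn _ (2 * A)) (exprMn _ 2); apply: ler_pM.
- by rewrite !mulr_ge0 ?exprn_ge0 ?mulr_ge0 ?exprn_ge0.
- exact: exprn_ge0.
- apply: ler_pM.
  + by rewrite !mulr_ge0 ?exprn_ge0 ?mulr_ge0 ?exprn_ge0.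
  + exact: exprn_ge0.
  + apply: ler_pM; rewrite ?exprn_ge0 ?mulr_ge0 ?exprn_ge0//.
      by apply: ler_weXn2l; [rewrite ler1n|exact: leq_subr].
    apply: (@le_trans _ _ (A ^+ (2 * h))).
      by apply: lerXn2r; rewrite ?nnegrE ?mulr_ge0 ?exprn_ge0.
    by apply: ler_weXn2l => //; clear -mh; lia.
  + by apply: ler_weXn2l => //; rewrite /k; clear; lia.
- exact: ler_wiXn2l.
Qed.

(** [404 * K] is [2 * K * 202], from [rho <= 202 * w]; the outer 404 absorbs the prefactor
    [n * w <= 101 * h] divided by the threshold [h / 4]. *)
Definition compressible_cst (K : R) : R := 404 * (16 * (404 * K) ^+ 3 * (26 * E) ^+ 2).

Lemma compressible_cst_ge1 (K : R) : 1 <= K -> 1 <= compressible_cst K.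
Proof.
move=> K1; have e1 : 1 <= E by exact: expR1_ge1.
apply: mulr_ege1; first by rewrite ler1n.
apply: mulr_ege1; last by apply: exprn_ege1; apply: mulr_ege1; rewrite ?ler1n.
by apply: mulr_ege1; [rewrite ler1n|apply: exprn_ege1; apply: mulr_ege1; rewrite ?ler1n].
Qed.

(** With [q = 4h] and [e = h], a close column costs about [rho^(3h) w^(-2h)], of order [w^h] since
    [rho] is of order [w]. The choice of the column loses one more power, and
    [200 (h - 1) >= m + 12]. The condition [400 <= h] keeps the threshold of order [h]. *)
Lemma compressible_bound (K w : R) (h m : nat) : 1 <= K -> 0 < w -> w <= 1 -> (400 <= h)%N ->
  (100 * h <= m < 100 * h.+1)%N -> n%:R * w <= m%:R -> (0 < n)%N ->
  (n%:R * close_bound n K (4 * h) h (2 * w ^+ 2 * n%:R / h%:R) / ((h.+1 - 200)%:R / 2)) ^+ 200 <=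
    (compressible_cst K ^+ 2) ^+ m * w ^+ (m + 12).
Proof.
move=> K1 w0 w1 h4 /andP[hm mh] nw n0.
have h0 : 0 < h%:R :> R by rewrite ltr0n; apply: leq_trans h4.
have n0' : 0 < n%:R :> R by rewrite ltr0n.
have K0 : 0 < K by exact: lt_le_trans ltr01 K1.
have E0 : 0 < E by exact: expR_gt0.
have E1 : 1 <= E by exact: expR1_ge1.
have nwh : n%:R * w <= 101 * h%:R.
  apply: le_trans nw _; rewrite -natrM ler_nat; clear -h4 mh; lia.
have thr : h%:R / 4 <= (h.+1 - 200)%:R / 2 :> R.
  have : h%:R <= 2 * (h.+1 - 200)%:R :> R by rewrite -natrM ler_nat; clear -h4; lia.
  by move=> ?; lra.
set rho := 2 * w ^+ 2 * n%:R / h%:R.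
have rho0 : 0 <= rho by rewrite divr_ge0 ?mulr_ge0 ?exprn_ge0// ltW.
have rho_le : rho <= 202 * w.
  rewrite /rho ler_pdivrMr//.
  have -> : 2 * w ^+ 2 * n%:R = 2 * w * (n%:R * w) by ring.
  have -> : 202 * w * h%:R = 2 * w * (101 * h%:R) by ring.
  by rewrite ler_wpM2l// mulr_ge0// ltW.
set F := 16 * (404 * K) ^+ 3 * (26 * E) ^+ 2.
have F1 : 1 <= F.
  apply: mulr_ege1; last by apply: exprn_ege1; apply: mulr_ege1; rewrite ?ler1n.
  by apply: mulr_ege1; [rewrite ler1n|apply: exprn_ege1; apply: mulr_ege1; rewrite ?ler1n].
have F0 : 0 < F by exact: lt_le_trans ltr01 F1.
have hb : close_bound n K (4 * h) h rho <= (F * w) ^+ h.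
  have prodb : \prod_(c < 4 * h) Num.sqrt (n%:R / c.+1%:R) <= (26 * E / w) ^+ (2 * h).
    apply: prod_sqrt_le.
    - by rewrite muln_gt0 /=; apply: leq_trans h4.
    - rewrite ler_pdivlMr// mul1r; apply: le_trans w1 _.
      by apply: mulr_ege1; rewrite ?ler1n.
    - rewrite ler_pdivrMr ?ltr0n ?muln_gt0 /=; last by apply: leq_trans h4.
      rewrite -(ler_pM2r w0) natrM.
      have -> : 26 * E / w * (4%:R * h%:R) * w = E * (104 * h%:R) by field; rewrite gt_eqF.
      rewrite -mulrA ler_wpM2l ?(ltW E0)//; apply: le_trans nwh _.
      by rewrite ler_wpM2r ?ler_nat// ltW.
    - by clear; lia.
  have -> : (F * w) ^+ h = 2 ^+ (4 * h) * (2 * K * (202 * w)) ^+ (4 * h - h) * (26 * E / w) ^+ (2 * h).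
    have -> : (4 * h - h = 3 * h)%N by clear; lia.
    rewrite !(exprM _ _ h) -!exprMn; congr (_ ^+ _); rewrite /F; field.
    by rewrite gt_eqF.
  have Kr : 0 <= 2 * K * rho by apply: mulr_ge0 rho0; apply: mulr_ge0 (ltW K0).
  rewrite /close_bound; apply: ler_pM prodb.
  - by apply: mulr_ge0; apply: exprn_ge0.
  - by apply: prodr_ge0.
  apply: ler_wpM2l; first exact: exprn_ge0.
  have K2 : 0 <= 2 * K by exact: mulr_ge0 (ltW K0).
  apply: lerXn2r; [exact: Kr| |exact: ler_wpM2l K2 _ _ rho_le].
  by apply: mulr_ge0 K2 _; exact: mulr_ge0 (ltW w0).
have b0 : 0 <= close_bound n K (4 * h) h rho.
  have Kr : 0 <= 2 * K * rho by apply: mulr_ge0 rho0; apply: mulr_ge0 (ltW K0).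
  by apply: mulr_ge0; [apply: mulr_ge0; apply: exprn_ge0|apply: prodr_ge0].
have step : n%:R * close_bound n K (4 * h) h rho / ((h.+1 - 200)%:R / 2) <=
    compressible_cst K ^+ h * w ^+ h.-1.
  have thr0 : 0 < (h.+1 - 200)%:R / 2 :> R by apply: lt_le_trans thr; rewrite divr_gt0.
  rewrite ler_pdivrMr//.
  apply: (@le_trans _ _ (n%:R * (F * w) ^+ h)); first by rewrite ler_wpM2l// ltW.
  apply: (@le_trans _ _ (compressible_cst K ^+ h * w ^+ h.-1 * (h%:R / 4))); last first.
    rewrite ler_wpM2l// mulr_ge0 ?exprn_ge0 ?(ltW w0)//.
    by rewrite (le_trans ler01)// compressible_cst_ge1.
  have -> : n%:R * (F * w) ^+ h = n%:R * w * (F ^+ h * w ^+ h.-1).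
    rewrite (exprMn _ F) -{2}(prednK (_ : 0 < h)%N); last by apply: leq_trans h4.
    by rewrite exprS; ring.
  have -> : compressible_cst K ^+ h * w ^+ h.-1 * (h%:R / 4) =
      404 ^+ h * (h%:R / 4) * (F ^+ h * w ^+ h.-1).
    by rewrite /compressible_cst -/F (exprMn _ 404); ring.
  apply: ler_wpM2r; first by rewrite mulr_ge0 ?exprn_ge0// ltW.
  apply: le_trans nwh _.
  have -> : 101 * h%:R = 404 * (h%:R / 4) :> R by field.
  apply: ler_wpM2r; first by rewrite divr_ge0// ltW.
  by apply: ler_eXnr; [apply: leq_trans h4|rewrite ler1n].
apply: (@le_trans _ _ ((compressible_cst K ^+ h * w ^+ h.-1) ^+ 200)).
  apply: lerXn2r => //; rewrite nnegrE.
    by apply: divr_ge0; [exact: mulr_ge0 (ler0n _ _) b0|rewrite divr_ge0].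
  by rewrite mulr_ge0 ?exprn_ge0// ?(ltW w0)// (le_trans ler01)// compressible_cst_ge1.
rewrite (exprMn _ (compressible_cst K ^+ h)) -!exprM; apply: ler_pM.
- by rewrite exprn_ge0// (le_trans ler01)// compressible_cst_ge1.
- by rewrite exprn_ge0// ltW.
- by apply: ler_weXn2l; [exact: compressible_cst_ge1|clear -hm; lia].
- by apply: ler_wiXn2l => //; [exact: ltW|clear -hm mh h4; lia].
Qed.

End NullProbabilityLarge.

(** * The constant for a fixed set and shift *)

Section NullConstant.
Context (R : realType) (K B : R).
Local Notation E := (expR 1 : R).

Definition incompressible_cst : R := 2 * (6 * E) * (2 ^+ 18 * K ^+ 2 * B ^+ 2).

(** The first summand serves [|I| <= 2 ^ 16]; the second serves larger sets, where
    [x^m + y^m <= (2 (x + y))^m] merges the two alternatives. *)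
Definition null_cst : R :=
  28 * K * B * E * (2 ^ 16)%:R ^+ 2 + 2 * (compressible_cst K ^+ 2 + incompressible_cst).

Hypothesis K1 : 1 <= K.
Hypothesis B1 : 1 <= B.

Let K0 : 0 <= K. Proof. exact: le_trans ler01 K1. Qed.
Let B0 : 0 <= B. Proof. exact: le_trans ler01 B1. Qed.
Let E0 : 0 <= E. Proof. exact: expR_ge0. Qed.

Lemma compressible_cst_ge0 : 0 <= compressible_cst K ^+ 2.
Proof. by apply: exprn_ge0; apply: le_trans (compressible_cst_ge1 K1). Qed.

Lemma incompressible_cst_ge0 : 0 <= incompressible_cst.
Proof.
apply: mulr_ge0; first by apply: mulr_ge0 => //; exact: mulr_ge0.
by apply: mulr_ge0; [apply: mulr_ge0|]; apply: exprn_ge0.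
Qed.

Lemma small_cst_ge0 : 0 <= 28 * K * B * E * (2 ^ 16)%:R ^+ 2.
Proof.
apply: mulr_ge0; last by apply: exprn_ge0; exact: ler0n.
by apply: mulr_ge0 => //; apply: mulr_ge0 => //; exact: mulr_ge0.
Qed.

Lemma null_cst_ge0 : 0 <= null_cst.
Proof.
apply: addr_ge0; first exact: small_cst_ge0.
apply: mulr_ge0 => //; apply: addr_ge0; first exact: compressible_cst_ge0.
exact: incompressible_cst_ge0.
Qed.

End NullConstant.

(** * Probability of the null event for a fixed set and shift *)

Section NullEventProbability.
Context (R : realType) (n : nat).
Local Notation C := R[i].
Local Notation cfg := (config R ('I_n * 'I_n)%type).
Local Notation E := (expR 1 : R).
Variable S : 'M[C]_n.
Context (K : R) (d : measure_display) (T : measurableType d) (P : probability T R).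
Variable X : T -> cfg.
Hypothesis M : entry_model (@transpose_pair n) K P X.
Variables (I : {set 'I_n}) (B g : R).
Hypothesis B1 : 1 <= B.
Hypothesis g0 : 0 < g.
Hypothesis g1 : g <= 1.
Local Notation w := (g ^+ 3).
Hypothesis w_small : 392 * B ^+ 2 * w ^+ 8 <= 1.
Hypothesis nw : n%:R * w <= #|I|%:R.
Hypothesis m9 : (9 <= #|I|)%N.

Local Notation t2 := (49 * B ^+ 2 * w ^+ 12 * n%:R).

(** The factors 49 and 10 are those that [null_event_shift] can guarantee. *)
Definition null_event : set cfg :=
  almost_null S (~: I) t2 `&` rows_bounded S [set: 'I_n]%SET (~: I) (10 * B ^+ 2 * n%:R).

Lemma measurable_null_event : measurable null_event.
Proof. by apply: measurableI; [exact: measurable_almost_null|exact: measurable_rows_bounded]. Qed.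

Let K1 : 1 <= K. Proof. exact: em_K M. Qed.

Let E1 : 1 <= E. Proof. exact: expR1_ge1. Qed.

(** All budgets are multiples of [h]: [4h] rows of [I] join the block and give the codimension, at
    most [h] small directions are allowed, and of the remaining [|I| - 4h] rows another [4h] may be
    exceptional. Sequences of 200 close columns decide between the two alternatives. *)
Lemma null_prob_large (h : nat) : (400 <= h)%N -> (100 * h <= #|I| < 100 * h.+1)%N ->
  (P [set t | null_event (X t)] <=
     (((compressible_cst K ^+ 2) ^+ #|I| + incompressible_cst K B ^+ #|I|) * w ^+ (#|I| + 12))%:E)%E.
Proof.
move=> h4 hm; set m := #|I|; have /andP[hm1 hm2] := hm.
have n0 : (0 < n)%N by have := max_card (mem I); rewrite card_ord => /(leq_trans m9); exact: leq_trans.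
have n0' : 0 < n%:R :> R by rewrite ltr0n.
have h0 : (0 < h)%N by exact: leq_trans h4.
have h0' : 0 < h%:R :> R by rewrite ltr0n.
have w0 : 0 < w by exact: exprn_gt0.
have w1 : w <= 1 by exact: exprn_ile1 (ltW g0) g1.
have B0 : 0 < B by exact: lt_le_trans ltr01 B1.
have [I1 I1I cI1] : exists2 I1 : {set 'I_n}, I1 \subset I & #|I1| = (4 * h)%N.
  by apply: exists_subset_card; apply: leq_trans hm1; rewrite leq_mul2r orbT.
pose Cs := ~: I; pose Rw := Cs :|: I1; pose I2 := I :\: I1.
have CI1 : [disjoint Cs & I1]%B.
  by rewrite finset.disjoints_subset finset.setCS.
have cRw : (#|Cs| + 4 * h <= #|Rw|)%N.
  have := cardsUI Cs I1; rewrite cI1 => <-.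
  have -> : Cs :&: I1 = finset.set0 by apply/eqP; rewrite finset.setI_eq0.
  by rewrite cards0 addn0.
have cI2 : #|I2| = (m - 4 * h)%N by rewrite cardsD (finset.setIidPr I1I) cI1.
have I2R : [disjoint I2 & Rw]%B.
  apply/pred0P => i; rewrite /= !finset.inE; case: (i \in I1) => //=.
  by case: (i \in I).
have I2C : [disjoint I2 & Cs]%B by apply: disjointWr I2R; exact: finset.subsetUl.
(* Chosen so that [h * rho^2] equals [2 n tau2 / (h / 2)]; the extra unit in [h.+1] makes [tau_r]
   strict. *)
pose rho := 2 * w ^+ 2 * n%:R / h%:R.
have rho0 : 0 < rho by rewrite divr_gt0// mulr_gt0// mulr_gt0// exprn_gt0.
pose r := h.+1%:R * rho ^+ 2.
have thr0 : 0 < (h.+1 - 200)%:R / 2 :> R.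
  by rewrite divr_gt0// ltr0n subn_gt0; apply: leq_trans (leqW h4).
have P1 := close_count_markov S M 200 (finset.subsetUl Cs I1) cRw
  (_ : h <= 4 * h)%N rho0 (erefl r) thr0.
have {}P1 := P1 (leq_pmull h (ltn0Sn 3)).
(* This makes [theta ^+ 2 * tau2] equal to [t2]. *)
pose theta := 7 * B * w ^+ 4.
have theta0 : 0 < theta by rewrite mulr_gt0 ?exprn_gt0// mulr_gt0.
have theta1 : theta ^+ 2 <= 8^-1.
  have -> : theta ^+ 2 = 8^-1 * (392 * B ^+ 2 * w ^+ 8) by rewrite /theta; field.
  by rewrite ger_pMr.
have th1 : theta <= 1.
  rewrite -ler_sqr ?nnegrE ?(ltW theta0)// expr1n; apply: le_trans theta1 _.
  by rewrite invf_le1 ?ler1n.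
have [p [p1 pth]] := exists_net_base theta0 th1.
have nb0 : 0 <= net_base R p by exact: le_trans ler01 (net_base_ge1 R p).
have netb : net_base R p * g ^+ 12 <= 6 * E.
  apply: le_trans pth; apply: ler_wpM2l => //.
  have -> : theta = 7 * B * g ^+ 12 by rewrite /theta -exprM.
  rewrite ler_peMl ?exprn_ge0 ?(ltW g0)//.
  by apply: mulr_ege1 => //; rewrite ler1n.
pose tau2 := w ^+ 4 * n%:R.
have tau0 : 0 < tau2 by rewrite mulr_gt0 ?exprn_gt0.
have tau_r : tau2 * (2 * n%:R) / (h.+1 - 200)%:R < r.
  have d0 : 0 < (h.+1 - 200)%:R :> R by rewrite ltr0n subn_gt0; apply: leq_trans (leqW h4).
  have dh : h%:R / 2 <= (h.+1 - 200)%:R :> R.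
    by rewrite ler_pdivrMr// -natrM ler_nat; clear -h4; lia.
  rewrite ltr_pdivrMr//; apply: (@lt_le_trans _ _ (r * (h%:R / 2))); last first.
    by apply: ler_wpM2l dh; rewrite mulr_ge0// exprn_ge0// ltW.
  have -> : r * (h%:R / 2) = tau2 * (2 * n%:R) + tau2 * (2 * n%:R) / h%:R.
    by rewrite /r /rho /tau2 -natr1; field; rewrite gt_eqF.
  by rewrite ltrDl divr_gt0// mulr_gt0// mulr_gt0.
have t2_le : t2 <= theta ^+ 2 * tau2.
  by rewrite le_eqVlt; apply/orP; left; apply/eqP; rewrite /theta /tau2; ring.
have L0 : 0 <= 10 * B ^+ 2 * n%:R by rewrite mulr_ge0// mulr_ge0// exprn_ge0// ltW.
(* The total error is at most [2058 B^4 w^7 (n w)] and [n w <= |I| <= 50 (4h + 1)], so a share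
   [2^17 B^4 w^7] for each of [4h + 1] rows suffices. Then [8 * rho2] is [2^20 B^4 g^21], which
   [c^10] covers for [c = 4 B g^2]; the cube root [g] of [w] makes [c^2] of order [g^4], an integral
   power. *)
pose rho2 := 2 ^+ 17 * B ^+ 4 * w ^+ 7.
pose c := 4 * B * g ^+ 2.
have c0 : 0 < c by rewrite mulr_gt0 ?exprn_gt0// mulr_gt0.
have rho20 : 0 <= rho2.
  apply: mulr_ge0; last by rewrite exprn_ge0// ltW.
  by apply: mulr_ge0; apply: exprn_ge0 => //; exact: ltW.
have rho_c : 8 * rho2 <= c ^+ 10.
  have -> : 8 * rho2 = 2 ^+ 20 * B ^+ 4 * g ^+ 20 * g by rewrite /rho2; ring.
  have -> : c ^+ 10 = 2 ^+ 20 * B ^+ 4 * g ^+ 20 * B ^+ 6 by rewrite /c; ring.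
  apply: ler_wpM2l; last by apply: le_trans g1 _; exact: exprn_ege1.
  apply: mulr_ge0; last by rewrite exprn_ge0// ltW.
  by apply: mulr_ge0; apply: exprn_ge0 => //; exact: ltW.
have rho_ge : 2 * (t2 + 2 * (10 * B ^+ 2 * n%:R) * theta ^+ 2) <= (4 * h).+1%:R * rho2.
  have mh : #|I|%:R <= 50 * (4 * h).+1%:R :> R.
    by rewrite -natrM ler_nat; clear -hm2 h0; lia.
  have B40 : 0 <= B ^+ 4 by rewrite exprn_ge0// ltW.
  have w70 : 0 <= w ^+ 7 by rewrite exprn_ge0// ltW.
  have Bw0 : 0 <= B ^+ 4 * w ^+ 7 by exact: mulr_ge0 B40 w70.
  apply: (@le_trans _ _ (2058 * (B ^+ 4 * w ^+ 7) * (n%:R * w))).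
    have -> : 2058 * (B ^+ 4 * w ^+ 7) * (n%:R * w) =
        2 * (49 * (B ^+ 4 * w ^+ 8 * n%:R) + 2 * (10 * B ^+ 2 * n%:R) * theta ^+ 2).
      by rewrite /theta; ring.
    have hBw : B ^+ 2 * w ^+ 12 <= B ^+ 4 * w ^+ 8.
      apply: ler_pM; [by rewrite exprn_ge0// ltW|by rewrite exprn_ge0// ltW|exact: ler_weXn2l|].
      by apply: ler_wiXn2l => //; exact: ltW.
    rewrite ler_pM2l// lerD2r (_ : t2 = 49 * (B ^+ 2 * w ^+ 12 * n%:R)); last by ring.
    by apply: ler_wpM2l => //; apply: ler_wpM2r hBw.
  apply: (@le_trans _ _ (2058 * (B ^+ 4 * w ^+ 7) * (50 * (4 * h).+1%:R))).
    by apply: ler_wpM2l; [exact: mulr_ge0 (ler0n R 2058) Bw0|exact: le_trans nw mh].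
  have -> : (4 * h).+1%:R * rho2 = 2 ^+ 17 * (B ^+ 4 * w ^+ 7 * (4 * h).+1%:R).
    by rewrite /rho2; ring.
  have -> : 2058 * (B ^+ 4 * w ^+ 7) * (50 * (4 * h).+1%:R) =
      2058 * 50 * (B ^+ 4 * w ^+ 7 * (4 * h).+1%:R) by ring.
  apply: ler_wpM2r; first exact: mulr_ge0 Bw0 (ler0n _ _).
  by lra.
have eI : (4 * h <= #|I2|)%N by rewrite cI2; clear -hm1; lia.
have lk : (200 <= h)%N by exact: leq_trans h4.
have P2 := compressed_prob S M I2R I2C n0 lk tau0 tau_r theta0 p1 theta1 t2_le L0 eI c0 rho20 rho_c rho_ge.
set F1 := [set t | _] in P1; set F2 := [set t | _] in P2.
have mX := measurable_X (em_measurable M).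
have mF1 : measurable F1.
  apply: measurable_superlevel.
  by apply: (measurableT_comp (@measurable_close_count _ _ _ _ _ _ _ _) mX).
have mF2 : measurable F2 by apply: (measurable_preX M); exact: measurable_compressed_event.
apply: (@le_trans _ _ (P (F1 `|` F2))).
  apply: le_measure; rewrite ?inE.
  - by apply: (measurable_preX M); exact: measurable_null_event.
  - exact: measurableU.
  move=> t [h1 h2].
  have [cc|cc] := leP (((h.+1 - 200)%:R / 2) ^+ 200) (close_count S Rw Cs r 200 finset.set0 (X t)).
    by left.
  right; split; [exact: cc|split; [exact: h1|]] => x x0; apply: le_trans (h2 x x0).
  by apply: nsqr_sub; exact: finset.subsetT.
apply: le_trans (@measureU2 _ _ _ P _ _ mF1 mF2) _.
rewrite mulrDl EFinD; apply: leeD.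
  apply: le_trans P1 _; rewrite lee_fin.
  exact: (compressible_bound K1 w0 w1 h4 hm nw n0).
apply: le_trans P2 _; rewrite lee_fin cI2.
have -> : lo_bound K c = 2 ^+ 18 * K ^+ 2 * B ^+ 2 * g ^+ 4 by rewrite /lo_bound /c; ring.
apply: incompressible_bound => //.
- by apply: mulr_ege1; rewrite ?ler1n.
- apply: mulr_ege1; last exact: exprn_ege1.
  by apply: mulr_ege1; apply: exprn_ege1; rewrite ?ler1n.
Qed.

Lemma null_prob : (P [set t | null_event (X t)] <= (null_cst K B ^+ #|I| * w ^+ (#|I| + 12))%:E)%E.
Proof.
have c00 := small_cst_ge0 K1 B1; have c10 := compressible_cst_ge0 K1.
have c20 := incompressible_cst_ge0 K1 B1.
have w0 : 0 <= w by rewrite exprn_ge0// ltW.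
have w1 : w <= 1 by exact: exprn_ile1 (ltW g0) g1.
have wm0 : 0 <= w ^+ (#|I| + 12) by exact: exprn_ge0.
pose h := (#|I| %/ 100)%N.
have hI : (100 * h <= #|I| < 100 * h.+1)%N.
  by rewrite /h mulnC leq_trunc_div /= mulnC ltn_ceil.
have [h4|h4] := leqP 400 h.
  apply: le_trans (null_prob_large h4 hI) _; rewrite lee_fin; apply: ler_wpM2r => //.
  apply: (@le_trans _ _ ((2 * (compressible_cst K ^+ 2 + incompressible_cst K B)) ^+ #|I|)).
    set x := _ ^+ 2; set y := incompressible_cst K B.
    have x0 : 0 <= x by exact: c10.
    have y0 : 0 <= y by exact: c20.
    have hx : x ^+ #|I| <= (x + y) ^+ #|I|.
      by apply: lerXn2r; rewrite ?nnegrE ?addr_ge0 ?lerDl.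
    have hy : y ^+ #|I| <= (x + y) ^+ #|I|.
      by apply: lerXn2r; rewrite ?nnegrE ?addr_ge0 ?lerDr.
    have xy0 : 0 <= (x + y) ^+ #|I| by rewrite exprn_ge0// addr_ge0.
    apply: (@le_trans _ _ (2 * (x + y) ^+ #|I|)); first by lra.
    rewrite exprMn; apply: ler_wpM2r => //.
    by apply: ler_eXnr; [exact: leq_trans m9|rewrite ler1n].
  have c0 : 0 <= 2 * (compressible_cst K ^+ 2 + incompressible_cst K B).
    by apply: mulr_ge0 => //; exact: addr_ge0.
  apply: lerXn2r; rewrite ?nnegrE//; first exact: addr_ge0.
  by rewrite /null_cst lerDr.
(* Here [|I| < 100 * 400]. *)
have m0 : (#|I| <= 2 ^ 16)%N.
  have /andP[_ /ltnW mI] := hI; apply: leq_trans mI _.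
  apply: (@leq_trans (2 ^ 7 * 2 ^ 9)); last by rewrite -expnD leqnn.
  by apply: leq_mul => //; apply: leq_trans h4 _.
have small := @almost_null_prob_small R n S K d T P X M I B w B1 (exprn_gt0 3 g0) w1 nw m9 _ m0.
apply: le_trans (le_trans _ small) _.
  apply: le_measure; rewrite ?inE.
  - by apply: (measurable_preX M); exact: measurable_null_event.
  - by apply: (measurable_preX M); exact: measurable_almost_null.
  - by move=> t [].
rewrite lee_fin; apply: ler_wpM2r => //; apply: lerXn2r; rewrite ?nnegrE//.
  by apply: addr_ge0 => //; apply: mulr_ge0 => //; exact: addr_ge0.
by rewrite /null_cst lerDl; apply: mulr_ge0 => //; exact: addr_ge0.
Qed.

End NullEventProbability.

(** * The entries of the given matrix as an instance of the model *)

Section EntryModel.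
Context (R : realType) (n : nat) (K : R).
Context (d : measure_display) (T : measurableType d) (P : probability T R).
Local Notation C := R[i].
Variable A : T -> 'M[C]_n.
Hypothesis K1 : 1 <= K.
Hypothesis mA : random_matrix A.
Hypothesis depA : Dep P A.
Hypothesis contA : Cont P K A.

Definition real_entries (t : T) : config R ('I_n * 'I_n)%type := fun p => complex.Re (A t p.1 p.2).

Lemma measurable_real_entries p : measurable_fun [set: T] (fun t => real_entries t p).
Proof. exact: (measurableT_comp measurable_fst (mA p)). Qed.

Lemma real_entries_sigma (Q : set ('I_n * 'I_n)) (E : set T) :
  coord_sigma real_entries Q E -> entries_sigma A Q E.
Proof.
apply: smallest_sub; first exact: smallest_sigma_algebra.
move=> _ [p Qp [B mB <-]]; apply: sub_sigma_algebra; exists p => //.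
exists (fst @^-1` B).
  by rewrite -[X in measurable X]setTI; exact: measurable_fst.
by [].
Qed.

Lemma entry_model_real_entries : entry_model (@transpose_pair n) K P real_entries.
Proof.
split => //.
- exact: measurable_real_entries.
- move=> [i j] B E mB hE.
  have [ind _] := depA; apply: (ind i j).
    apply: (@real_entries_sigma [set (i, j)]); apply: sub_sigma_algebra.
    by exists (i, j) => //; exists B => //; rewrite setTI.
  exact: real_entries_sigma.
- move=> [i j] u r r0; have [f [[mf f0 fP] fK]] := contA i j.
  have -> : [set t | (`|real_entries t (i, j) - u| <= r)%R] =
      (fun t => complex.Re (A t i j)) @^-1` `[u - r, u + r]%classic.
    apply/seteqP; split => t; rewrite /real_entries /= in_itv /= ler_distl; by [].
  rewrite fP//.
  apply: (@le_trans _ _ (\int[lebesgue_measure]_(x in `[(u - r)%R, (u + r)%R]) K%:E)%E).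
    apply: ge0_le_integral => //.
    - by move=> x _; rewrite lee_fin.
    - by apply/measurable_EFinP; apply: measurable_funTS.
    - by move=> x _; rewrite lee_fin.
  rewrite integral_cst//= lebesgue_measure_itv /= lte_fin.
  case: ifPn => _; last by rewrite mule0 lee_fin !mulr_ge0// (le_trans ler01).
  rewrite -EFinB -EFinM lee_fin; lra.
Qed.

End EntryModel.

(** * The operator norm as a quadratic inequality *)

Section Opnorm.
Context (R : realType) (n : nat).
Local Notation C := R[i].

(** A crude entrywise bound, used only to know that the supremum in [opnorm] is over a set bounded
    above. *)
Lemma nsqv_mulmx_bounded (A : 'M[C]_n) : exists c : R, 0 <= c /\
  forall v : 'cV[C]_n, nsqv v <= 1 -> nsqv (A *m v) <= c.
Proof.
pose nc := @ComplexField.Normc.normc R.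
have nc0 z : 0 <= nc z by case: z => x y; exact: sqrtr_ge0.
exists (\sum_i (\sum_j nc (A i j)) ^+ 2); split; first by apply: sumr_ge0 => i _; exact: sqr_ge0.
move=> v v1; apply: ler_sum => i _; rewrite -normc_sqr mxE.
have h : nc (\sum_j A i j * v j 0) <= \sum_j nc (A i j).
  elim/big_rec2: _ => [|j x y _ IH]; first by rewrite /nc /= expr0n /= addr0 sqrtr0.
  apply: le_trans (le_normcD _ _) _; apply: lerD => //.
  rewrite ComplexField.Normc.normcM ler_piMr// -ler_sqr ?nnegrE// ?expr1n ?ler01//.
  by rewrite normc_sqr; apply: le_trans (nsq_le_nsqv _ _) v1.
by rewrite ler_sqr ?nnegrE// sumr_ge0.
Qed.

Lemma opnorm_leP (A : 'M[C]_n) (b : R) : 0 <= b ->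
  opnorm A <= b <-> forall v : 'cV[C]_n, nsqv (A *m v) <= b ^+ 2 * nsqv v.
Proof.
move=> b0; pose Q := [set l2norm (A *m v) | v in [set v : 'cV[C]_n | l2norm v <= 1]].
have Q0 : Q !=set0.
  exists (l2norm (A *m (0 : 'cV[C]_n))); exists 0 => //=.
  by rewrite l2normE nsqv0 sqrtr0.
have [c [c0 hc]] := nsqv_mulmx_bounded A.
have Qub : has_ubound Q.
  exists (Num.sqrt c) => _ [v v1 <-]; rewrite l2normE ler_wsqrtr// hc//.
  by rewrite -l2norm_sqr -(expr1n _ 2) ler_sqr ?nnegrE ?l2norm_ge0.
split=> [Ab v|hb].
  have [->|v0] := eqVneq v 0.
    by rewrite mulmx0 nsqv0 mulr0.
  have pos : 0 < nsqv v by rewrite lt_def nsqv_eq0 v0 nsqv_ge0.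
  pose u := ((Num.sqrt (nsqv v))^-1)%:C%C *: v.
  have nc := nsq_normalizer v.
  have u1 : l2norm u <= 1 by rewrite l2normE nsqvZ nc mulVf ?gt_eqF// sqrtr1.
  have : l2norm (A *m u) <= b.
    by apply: le_trans Ab; apply: ub_le_sup => //; exists u.
  rewrite -ler_sqr ?nnegrE ?l2norm_ge0// l2norm_sqr -scalemxAr nsqvZ nc mulrC.
  by rewrite ler_pdivrMr.
apply: ge_sup => // _ [v v1 <-].
rewrite -ler_sqr ?nnegrE ?l2norm_ge0// l2norm_sqr; apply: le_trans (hb v) _.
rewrite -[leRHS]mulr1 ler_wpM2l ?sqr_ge0// -l2norm_sqr -(expr1n _ 2).
by rewrite ler_sqr ?nnegrE ?l2norm_ge0.
Qed.

End Opnorm.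

(** * Measurability of the eigenvector event *)

Section EigenvectorEvent.
Context (R : realType) (n : nat).
Local Notation C := R[i].
Local Notation cfg := (config R ('I_n * 'I_n)%type).
Variable S : 'M[C]_n.

Lemma nsqr_subvec (v : 'cV[C]_n) (I : {set 'I_n}) : nsqv (subvec v I) = nsqr I v.
Proof.
by rewrite /nsqr big_enum_val; apply: eq_bigr => i _; rewrite mxE.
Qed.

(** The residual at the Rayleigh quotient. For unit [v] it vanishes exactly for eigenvectors, which
    eliminates the eigenvalue and leaves an existential over a compact set of vectors. *)
Definition rayleigh_defect (a : cfg) (v : 'cV[C]_n) : R :=
  nsqv (cmx S a *m v - ((ctr v *m (cmx S a *m v)) 0 0) *: v).

Lemma rayleigh_defectE (a : cfg) (v : 'cV[C]_n) : nsqv v = 1 ->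
  (exists lambda : C, cmx S a *m v = lambda *: v) <-> rayleigh_defect a v <= 0.
Proof.
move=> v1; split=> [[lam h]|h].
  have h1 : (ctr v *m v) 0 0 = 1 by rewrite ctr_mul_vec v1 mxE eqxx mulr1n.
  rewrite /rayleigh_defect h -scalemxAr [in X in _ - X *: _]mxE h1 mulr1 subrr.
  by rewrite nsqv0.
exists ((ctr v *m (cmx S a *m v)) 0 0); apply/eqP; rewrite -subr_eq0 -nsqv_eq0.
by rewrite eq_le h nsqv_ge0.
Qed.

Definition weak_vectors (I : {set 'I_n}) (r : R) : set 'rV[R]_(n + n) :=
  [set x | nsqv (decode x) = 1 /\ nsqr I (decode x) <= r].

Lemma compact_weak_vectors I r : compact (weak_vectors I r).
Proof.
apply: (@subclosed_compact _ _ [set v : 'rV[R]_(n + n) | forall i, `[-1, 1]%classic (v ord0 i)]).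
- rewrite (_ : weak_vectors I r = (fun x => nsqv (decode x)) @^-1` [set x | x = 1] `&`
    (fun x => nsqr I (1%:M *m decode x)) @^-1` [set x | x <= r]).
    apply: closedI.
      by apply: closed_comp => [x _|]; [exact: continuous_nsqv_decode|exact: closed_eq].
    by apply: closed_comp => [x _|]; [exact: continuous_nsqr|exact: closed_le].
  by apply/seteqP; split => x; rewrite /weak_vectors /= mul1mx.
- exact: (@rV_compact R (n + n) (fun=> (`[-1, 1]%classic : set R)) (fun=> @segment_compact R _ _)).
move=> x [x1 _] i /=; rewrite in_itv /= -ler_norml -ler_sqr ?nnegrE// expr1n real_normK ?num_real//.
rewrite -x1; have : forall j, nsq (decode x j 0) <= nsqv (decode x) by move=> j; exact: nsq_le_nsqv.
rewrite -(splitK i); case: (fintype.split i) => j /(_ j) /=; rewrite {1}/nsq mxE /=.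
  by apply: le_trans; rewrite lerDl sqr_ge0.
by apply: le_trans; rewrite lerDr sqr_ge0.
Qed.

Lemma rayleigh_entry (a : cfg) (v : 'cV[C]_n) i :
  (cmx S a *m v - ((ctr v *m (cmx S a *m v)) 0 0) *: v) i 0 =
  \sum_j cmx S a i j * v j 0 - (\sum_k (v k 0)^* * (\sum_j cmx S a k j * v j 0)) * v i 0.
Proof.
rewrite mxE; congr (_ + _); first by rewrite mxE.
rewrite mxE; congr (- _); rewrite mxE; congr (_ * _).
by rewrite mxE; apply: eq_bigr => k _; rewrite ctrE; congr (_ * _); rewrite mxE.
Qed.

Lemma ccont_conj_decode i : ccont (fun x : 'rV[R]_(n + n) => (decode x i 0)^*).
Proof.
have [c1 c2] := @ccont_decode R n i; split => x.
  rewrite (_ : (fun _ => _) = (fun x => complex.Re (decode x i 0))); first exact: c1.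
  by apply/funext => y; case: (decode y i 0).
rewrite (_ : (fun _ => _) = (fun x => - complex.Im (decode x i 0))); last first.
  by apply/funext => y; case: (decode y i 0).
exact: (cvgN (c2 x)).
Qed.

Definition weak_eigenvector_event (delta : R) (Q : pred {set 'I_n}) : set cfg :=
  [set a | exists (I : {set 'I_n}) (v : 'cV[C]_n), [/\ Q I, v != 0,
     (exists lambda : C, cmx S a *m v = lambda *: v) & nsqr I v < delta * nsqv v]].

Lemma measurable_rayleigh (I : {set 'I_n}) (r : R) :
  measurable [set a : cfg | exists2 x, weak_vectors I r x & rayleigh_defect a (decode x) <= 0].
Proof.
apply: measurable_exists_le; last exact: compact_weak_vectors.
  move=> x; apply: measurable_sum => i; apply: measurable_nsq.
  rewrite (_ : (fun _ => _) = (fun a => \sum_j cmx S a i j * decode x j 0 -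
      (\sum_k (decode x k 0)^* * (\sum_j cmx S a k j * decode x j 0)) * decode x i 0)); last first.
    by apply/funext => a; exact: rayleigh_entry.
  have cm k : cmeas (fun a : cfg => \sum_j cmx S a k j * decode x j 0).
    by apply: cmeas_sum => j _; apply: cmeasM; [exact: cmeas_cmx|exact: cmeas_cst].
  apply: cmeasB => //; apply: cmeasM; last exact: cmeas_cst.
  by apply: cmeas_sum => k _; apply: cmeasM; [exact: cmeas_cst|exact: cm].
move=> a; apply: continuous_sum => i _; apply: continuous_nsq.
rewrite (_ : (fun _ => _) = (fun x => \sum_j cmx S a i j * decode x j 0 -
    (\sum_k (decode x k 0)^* * (\sum_j cmx S a k j * decode x j 0)) * decode x i 0)); last first.
  by apply/funext => x; exact: rayleigh_entry.
have cm k : ccont (fun x : 'rV[R]_(n + n) => \sum_j cmx S a k j * decode x j 0).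
  by apply: ccont_sum => j _; apply: ccontM; [exact: ccont_cst|exact: ccont_decode].
apply: ccontB => //; apply: ccontM; last exact: ccont_decode.
by apply: ccont_sum => k _; apply: ccontM; [exact: ccont_conj_decode|exact: cm].
Qed.

(** The strict bound on the mass of [I] does not define a closed set, so it is written as the union
    over [k] of the bounds [<= delta - 1 / (k + 1)], each giving a compact set of unit vectors. *)
Lemma measurable_weak_eigenvector_event delta Q : measurable (weak_eigenvector_event delta Q).
Proof.
rewrite (_ : weak_eigenvector_event delta Q =
  \bigcup_(I in [set I | Q I]) \bigcup_k [set a : cfg | exists2 x,
     weak_vectors I (delta - k.+1%:R^-1) x & rayleigh_defect a (decode x) <= 0]).
  apply: fin_bigcup_measurable => [|I _]; first exact: finite_finset.
  apply: bigcup_measurable => k _.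
  exact: measurable_rayleigh.
apply/seteqP; split=> [a [I [v [QI v0 hv Iv]]]|a [I QI [k _ [x [x1 Ix] hx]]]].
  have pos : 0 < nsqv v by rewrite lt_def nsqv_eq0 v0 nsqv_ge0.
  pose u := ((Num.sqrt (nsqv v))^-1)%:C%C *: v.
  have nc := nsq_normalizer v.
  have u1 : nsqv u = 1 by rewrite nsqvZ nc mulVf// gt_eqF.
  have Iu : nsqr I u < delta by rewrite nsqrZ nc mulrC ltr_pdivrMr.
  exists I => //; pose k := Num.truncn (delta - nsqr I u)^-1.
  exists k => //; exists (encode u).
    split; rewrite encodeK//.
    rewrite lerBrDr addrC -lerBrDr invf_ple ?posrE ?subr_gt0 ?ltr0n//.
    by rewrite ltW// truncnS_gt.
  rewrite encodeK; apply/(rayleigh_defectE _ u1); have [lam hl] := hv.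
  by exists lam; rewrite -scalemxAr hl !scalerA mulrC.
exists I, (decode x); split=> //.
- by apply/eqP => h; move/eqP: x1; rewrite h nsqv0 eq_sym oner_eq0.
- exact/(rayleigh_defectE _ x1).
- by rewrite x1 mulr1; apply: le_lt_trans Ix _; rewrite ltrBlDr ltrDl invr_gt0.
Qed.

End EigenvectorEvent.

(** * From an eigenvector to an almost null vector at a net point *)

Section Covering.
Context (R : realType) (n : nat).
Local Notation C := R[i].
Local Notation cfg := (config R ('I_n * 'I_n)%type).
Variables (Bim : 'M[R]_n) (B g : R).
Hypothesis B1 : 1 <= B.
Hypothesis g0 : 0 < g.
Hypothesis g1 : g <= 1.
Hypothesis n0 : (0 < n)%N.
Local Notation w := (g ^+ 3).
Hypothesis w_small : 2 * w ^+ 12 <= 1.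

Definition shift (lambda : C) : 'M[C]_n := \matrix_(i, j) (0 +i* Bim i j)%C - lambda%:M.

Lemma cmx_shift lambda a (v : 'cV[C]_n) : cmx (shift lambda) a *m v = cmx (shift 0) a *m v - lambda *: v.
Proof.
rewrite -mul_scalar_mx -mulmxBl; congr (_ *m v).
by apply/matrixP => i j; rewrite !mxE mul0rn subr0 addrA.
Qed.

(** Let [x] be [v] with its part on [I] removed, so that [(A - mu) x = (lambda - mu) v - (A - mu)
    v_I]. With [D = B^2 n], [|mu|^2 <= 4 D] and the squared norm of [A - mu] is at most
    [2 (1 + 4) D]. The right side is therefore at most [22 D w^12 |v|^2] in square, and
    [|x|^2 >= |v|^2 / 2] turns this into less than [49 D w^12 |x|^2]. *)
Lemma null_event_shift (a : cfg) (I : {set 'I_n}) (v : 'cV[C]_n) (lambda mu : C) :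
  rows_bounded (shift 0) [set: 'I_n]%SET [set: 'I_n]%SET (B ^+ 2 * n%:R) a ->
  v != 0 -> cmx (shift 0) a *m v = lambda *: v -> nsqr I v < w ^+ 12 * nsqv v ->
  nsq (lambda - mu) <= B ^+ 2 * n%:R * w ^+ 12 ->
  null_event (shift mu) I B g a.
Proof.
move=> hB v0 hv Iv lm; have ws := w_small.
have n0' : 0 < n%:R :> R by rewrite ltr0n.
have B0 : 0 < B by exact: lt_le_trans ltr01 B1.
pose D := B ^+ 2 * n%:R; have D0 : 0 < D by rewrite mulr_gt0// exprn_gt0.
have pos : 0 < nsqv v by rewrite lt_def nsqv_eq0 v0 nsqv_ge0.
have wpos : 0 < w ^+ 12 by rewrite exprn_gt0// exprn_gt0.
have nT := @nsqr_setT R n.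
have hA u : nsqv (cmx (shift 0) a *m u) <= D * nsqv u.
  by rewrite -nT; apply: hB => i; rewrite finset.inE.
have l1 : nsq lambda <= D.
  by have := hA v; rewrite hv nsqvZ ler_pM2r.
have m1 : nsq mu <= 4 * D.
  have -> : mu = lambda - (lambda - mu) by rewrite opprB addrC subrK.
  apply: le_trans (nsqD_le _ _) _; rewrite nsqN.
  have : D * w ^+ 12 <= D by rewrite ger_pMr//; lra.
  by rewrite -/D in lm; lra.
have hmu u : nsqv (cmx (shift mu) a *m u) <= 10 * D * nsqv u.
  rewrite cmx_shift; apply: le_trans (nsqvD_le _ _) _; rewrite nsqvN nsqvZ.
  have h1 := hA u; have h2 : nsq mu * nsqv u <= 4 * D * nsqv u.
    by rewrite ler_wpM2r ?nsqv_ge0.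
  by lra.
have DE : 10 * B ^+ 2 * n%:R = 10 * D by rewrite /D mulrA.
split; last by move=> x x0; rewrite nT DE; exact: hmu.
exists (coord_proj R (~: I) *m v).
  by move=> i iI; rewrite coord_projE (negPf iI).
have nx : nsqv (coord_proj R (~: I) *m v) = nsqv v - nsqr I v.
  rewrite -nsqr_coord /nsqv (bigID (mem I)) /= addrAC -[X in X - _ + _]/(nsqr I v) subrr add0r.
  by apply: eq_bigl => i; rewrite finset.inE.
have xE : coord_proj R (~: I) *m v = v - coord_proj R I *m v.
  apply/matrixP => i j; rewrite ord1 coord_projE [RHS]mxE [X in _ + X]mxE coord_projE finset.inE.
  by case: (i \in I); rewrite ?subrr ?subr0.
rewrite nT nx xE mulmxBr; apply: le_lt_trans (nsqvD_le _ _) _; rewrite nsqvN.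
have h1 : nsqv (cmx (shift mu) a *m v) <= D * w ^+ 12 * nsqv v.
  by rewrite cmx_shift hv -scalerBl nsqvZ ler_wpM2r ?nsqv_ge0.
have h2 : nsqv (cmx (shift mu) a *m (coord_proj R I *m v)) <= 10 * D * (w ^+ 12 * nsqv v).
  by apply: le_trans (hmu _) _; rewrite -nsqr_coord ler_wpM2l ?mulr_ge0// ltW.
have h3 : w ^+ 12 * nsqv v <= nsqv v / 2 by rewrite mulrC ler_wpM2l ?nsqv_ge0//; lra.
have -> : 49 * B ^+ 2 * w ^+ 12 * n%:R = 49 * (D * w ^+ 12) by rewrite /D; ring.
set y := D * w ^+ 12 in h1 *; have y0 : 0 < y by rewrite mulr_gt0.
have h4 : y * (nsqv v / 2) <= y * (nsqv v - nsqr I v) by rewrite ler_wpM2l ?(ltW y0)//; lra.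
have h5 : 0 < y * nsqv v by rewrite mulr_gt0.
have h6 : 10 * D * (w ^+ 12 * nsqv v) = 10 * (y * nsqv v) by rewrite /y; ring.
lra.
Qed.

(** A net of mesh [w^6] of the unit disc, scaled by [sqrt (B^2 n)]; two real dimensions give of
    order [w^-12] points. *)
Lemma eigenvalue_net : exists N : seq C, (size N)%:R * w ^+ 12 <= 36 * expR 1 ^+ 2 :> R /\
  forall lambda : C, nsq lambda <= B ^+ 2 * n%:R ->
    exists2 mu, mu \in N & nsq (lambda - mu) <= B ^+ 2 * n%:R * w ^+ 12.
Proof.
have n0' : 0 < n%:R :> R by rewrite ltr0n.
have B0 : 0 < B by exact: lt_le_trans ltr01 B1.
pose D := B ^+ 2 * n%:R; have D0 : 0 < D by rewrite mulr_gt0// exprn_gt0.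
pose theta := w ^+ 6; have theta0 : 0 < theta by rewrite exprn_gt0// exprn_gt0.
have th1 : theta <= 1.
  by apply: exprn_ile1; [rewrite exprn_ge0// ltW|apply: exprn_ile1 => //; exact: ltW].
have [p [p1 netb]] := exists_net_base theta0 th1.
have [N [N1 N2]] := @complex_net R 1 [set: 'I_1]%SET theta p theta0 p1.
pose r : C := (Num.sqrt D)%:C%C.
have r2 : nsq r = D by rewrite nsq_real sqr_sqrtr// ltW.
have r0 : r != 0 by rewrite -nsq_eq0 r2 gt_eqF.
exists [seq r * (y : 'cV[C]_1) 0 0 | y <- N]; split.
  rewrite size_map; apply: (@le_trans _ _ ((net_base R p * theta) ^+ 2)).
    rewrite (exprMn _ _ theta) -(exprM w); apply: ler_wpM2r; first by rewrite exprn_ge0// exprn_ge0// ltW.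
    by move: N1; rewrite finset.cardsT card_ord muln1.
  have -> : 36 * expR 1 ^+ 2 = (6 * expR 1) ^+ 2 :> R by ring.
  have nb0 : 0 <= net_base R p by exact: le_trans ler01 (net_base_ge1 R p).
  apply: lerXn2r netb; rewrite nnegrE; first exact: mulr_ge0 nb0 (ltW theta0).
  by rewrite mulr_ge0// expR_ge0.
move=> lambda hl; pose z : 'cV[C]_1 := \col_i (lambda / r).
have nr : nsq r^-1 = D^-1 by rewrite nsqV r2.
have n1 (u : 'cV[C]_1) : nsqr [set: 'I_1]%SET u = nsq (u 0 0).
  rewrite /nsqr (eq_bigl predT) ?big_ord1//; last by move=> i; rewrite finset.inE.
have z1 : nsqr [set: 'I_1]%SET z <= 1 by rewrite n1 mxE nsqM nr ler_pdivrMr// mul1r.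
have [y yN [_ hy]] := N2 z z1.
exists (r * y 0 0); first by apply/mapP; exists y.
have -> : lambda - r * y 0 0 = r * (lambda / r - y 0 0) by field.
move: hy; rewrite n1 2!mxE [in X in X -> _]mxE => hy.
rewrite nsqM r2; apply: ler_wpM2l; first exact: ltW.
by move: hy; rewrite /theta -exprM.
Qed.

End Covering.

(** * Union bound over sets and eigenvalues *)

Section WeakEigenvectors.
Context (R : realType) (n : nat).
Local Notation C := R[i].
Local Notation cfg := (config R ('I_n * 'I_n)%type).
Local Notation E := (expR 1 : R).
Context (K : R) (d : measure_display) (T : measurableType d) (P : probability T R).
Variable X : T -> cfg.
Hypothesis M : entry_model (@transpose_pair n) K P X.
Variables (Bim : 'M[R]_n) (B g eps s : R) (m : nat).
Hypothesis B1 : 1 <= B.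
Hypothesis g0 : 0 < g.
Local Notation w := (g ^+ 3).
Hypothesis wE : w = eps * s.
Hypothesis eps0 : 0 < eps.
Hypothesis s0 : 0 < s.
Hypothesis s1 : s <= 1.
Hypothesis w_small : 392 * B ^+ 2 * w <= 1.
Hypothesis m9 : (9 <= m)%N.
Hypothesis epsm : eps * n%:R <= m%:R.
Hypothesis m_min : forall k : nat, eps * n%:R <= k%:R -> (m <= k)%N.

Definition weak_event : set cfg :=
  rows_bounded (shift Bim 0) [set: 'I_n]%SET [set: 'I_n]%SET (B ^+ 2 * n%:R) `&`
  weak_eigenvector_event (shift Bim 0) (w ^+ 12) (fun I => eps * n%:R <= #|I|%:R).

Lemma measurable_weak_event : measurable weak_event.
Proof. by apply: measurableI; [exact: measurable_rows_bounded|exact: measurable_weak_eigenvector_event]. Qed.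

(** A vector that is weak on [I] is weak on every subset, so only sets with exactly [m] elements are
    needed, [m] being the least integer above [eps * n]. There are at most [(e n / m)^m] of them.
    The size of the eigenvalue net cancels the extra [w^12], and [n w / m = s (eps n / m) <= s]. *)
Lemma weak_event_prob :
  (P [set t | weak_event (X t)] <= (36 * E ^+ 2 * (E * null_cst K B * s) ^+ m)%:E)%E.
Proof.
have K1 := em_K M.
have w0 : 0 < w by exact: exprn_gt0.
have B2 : 1 <= B ^+ 2 by exact: exprn_ege1.
have w392 : 392 * w <= 1.
  have h : w <= B ^+ 2 * w by rewrite ler_peMl// ltW.
  apply: le_trans w_small; rewrite -[leRHS]mulrA.
  exact: ler_wpM2l (ler0n R 392) _ _ h.
have w1 : w <= 1 by apply: le_trans w392; rewrite ler_peMl ?(ltW w0)// ler1n.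
have g1 : g <= 1 by rewrite -(@expr_le1 _ 3) // ltW.
have C0 := null_cst_ge0 K1 B1.
have m0 : (0 < m)%N by exact: leq_trans m9.
have [n0|n0] := posnP n.
  have h : eps * n%:R <= 0%N%:R by rewrite n0 mulr0.
  by have := leq_trans m0 (m_min h).
have n0' : 0 < n%:R :> R by rewrite ltr0n.
have m0' : 0 < m%:R :> R by rewrite ltr0n.
have nw : n%:R * w <= m%:R.
  rewrite wE mulrCA mulrA; apply: le_trans epsm; apply: ler_piMr s1.
  exact: mulr_ge0 (ltW eps0) (ler0n _ _).
have wk k : w ^+ k.+1 <= w.
  by rewrite (exprS w) ler_piMr ?(ltW w0)// exprn_ile1// ltW.
have w8 : 392 * B ^+ 2 * w ^+ 8 <= 1.
  apply: le_trans w_small; apply: ler_wpM2l (wk 7%N).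
  exact: mulr_ge0 (ler0n R 392) (le_trans ler01 B2).
have w12 : 2 * w ^+ 12 <= 1 by have := wk 11%N; lra.
have [N [N1 N2]] := eigenvalue_net B1 g0 g1 n0.
pose Is := [set I : {set 'I_n} | #|I| == m]%SET.
pose L := [seq (J, mu) | J <- enum Is, mu <- N].
have sL : (size L)%:R * w ^+ 12 <= (E * n%:R / m%:R) ^+ m * (36 * E ^+ 2).
  rewrite size_allpairs -cardE card_draws card_ord natrM -mulrA; apply: ler_pM => //.
    by rewrite mulr_ge0// exprn_ge0// ltW.
  exact: bin_le.
pose F (p : {set 'I_n} * C) : set T := [set t | null_event (shift Bim p.2) p.1 B g (X t)].
have step : (P [set t | weak_event (X t)] <= ((size L)%:R * (null_cst K B ^+ m * w ^+ (m + 12)))%:E)%E.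
  apply: (@union_bound _ _ _ _ _ _ F).
  - by move=> p; apply: (measurable_preX M); exact: measurable_null_event.
  - by apply: (measurable_preX M); exact: measurable_weak_event.
  - move=> t [hB [I [v [QI v0 [lambda hv] Iv]]]].
    have [I' I'I cI'] := exists_subset_card (m_min QI).
    have pos : 0 < nsqv v by rewrite lt_def nsqv_eq0 v0 nsqv_ge0.
    have l1 : nsq lambda <= B ^+ 2 * n%:R.
      rewrite -(ler_pM2r pos) -nsqvZ -hv.
      rewrite -(nsqr_setT (_ *m _)).
      by apply: hB => i; rewrite finset.inE.
    have [mu muN hmu] := N2 lambda l1.
    exists (I', mu).
      by apply/allpairsP; exists (I', mu); split => //; rewrite mem_enum finset.inE cI'.
    apply: (null_event_shift B1 g0 n0 w12 hB v0 hv _ hmu).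
    by apply: le_lt_trans Iv; exact: nsqr_sub.
  - move=> [I mu] /allpairsP[[I' mu'] /= [II _ [-> ->]]].
    have cI : #|I'| = m by move: II; rewrite mem_enum finset.inE => /eqP.
    have := @null_prob R n (shift Bim mu') K d T P X M I' B g B1 g0 g1 w8.
    by rewrite cI => /(_ nw m9).
apply: le_trans step _; rewrite lee_fin.
have -> : (size L)%:R * (null_cst K B ^+ m * w ^+ (m + 12)) =
    (size L)%:R * w ^+ 12 * (null_cst K B * w) ^+ m.
  by rewrite (exprMn _ (null_cst K B)) (exprD w); ring.
have Cw0 : 0 <= null_cst K B * w by rewrite mulr_ge0// ltW.
apply: (@le_trans _ _ ((E * n%:R / m%:R) ^+ m * (36 * E ^+ 2) * (null_cst K B * w) ^+ m)).
  by rewrite ler_wpM2r// exprn_ge0.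
rewrite mulrAC -exprMn mulrC; apply: ler_wpM2l.
  by rewrite mulr_ge0// exprn_ge0// expR_ge0.
have Em0 : 0 <= E * n%:R / m%:R by rewrite divr_ge0// mulr_ge0// expR_ge0.
apply: lerXn2r; rewrite ?nnegrE.
- exact: mulr_ge0 Em0 Cw0.
- by rewrite mulr_ge0 ?mulr_ge0 ?expR_ge0// ltW.
have -> : E * n%:R / m%:R * (null_cst K B * w) = E * null_cst K B * s * (eps * n%:R / m%:R).
  by rewrite wE; ring.
rewrite ler_piMr ?ler_pdivrMr ?mul1r//.
by rewrite mulr_ge0 ?mulr_ge0 ?expR_ge0// ltW.
Qed.

End WeakEigenvectors.

(** * Conditioning on the norm event and choosing the constant *)

Local Open Scope complex_scope.

Theorem theorem1p3 (R : realType) (K M : R) (hK : 1 <= K) (hM : 1 <= M) :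
  exists c : R, 0 < c /\
    forall (d : measure_display) (T : measurableType d) (P : probability T R)
      (n : nat) (A : T -> 'M[R[i]]_n) (eps s : R),
      (0 < n)%N ->
      random_matrix A ->
      Dep P A ->
      Cont P K A ->
      ((2^-1)%:E <= P (bounded_event A M))%E ->
      8 / n%:R < eps -> eps < 2^-1 ->
      0 < s ->
      1 - (c * s) `^ (eps * n%:R) <=
        condprob P
          [set t | forall v : 'cV[R[i]]_n, eigenvector (A t) v ->
             forall I : {set 'I_n}, eps * n%:R <= #|I|%:R ->
               (eps * s) ^+ 6 * l2norm v <= l2norm (subvec v I)]
          (bounded_event A M).
Proof.
pose E : R := expR 1.
have E1 : 1 <= E by exact: expR1_ge1.
have C0 := null_cst_ge0 hK hM.
(* [72 = 2 * 36]: the 2 comes from conditioning on an event of probability at least [1 / 2],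
   [36 * E ^+ 2] from the eigenvalue net, and the third [E] from the choice of the set. The second
   summand lets [c * s < 1] imply [w_small]. *)
pose c := 72 * E ^+ 3 * null_cst K M + 392 * M ^+ 2.
have M2 : 1 <= M ^+ 2 by exact: exprn_ege1.
have c1 : 0 <= 72 * E ^+ 3 * null_cst K M.
  by rewrite mulr_ge0// mulr_ge0// exprn_ge0// (le_trans ler01).
have c392 : 392 <= c by rewrite /c; lra.
exists c; split; first by lra.
move=> d T P n A eps s n0 mA depA contA hB eps8 eps2 s0.
set good := [set t | _]; set BE := bounded_event A M.
have n0' : 0 < n%:R :> R by rewrite ltr0n.
have eps0 : 0 < eps by apply: le_lt_trans eps8; rewrite divr_ge0.
(* If [c * s >= 1] the claimed lower bound is at most 0. *)
have [cs1|cs1] := leP 1 (c * s).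
  have h : 1 <= (c * s) `^ (eps * n%:R).
    have := ler_powR cs1 (mulr_ge0 (ltW eps0) (ler0n R n)); by rewrite powRr0.
  apply: (@le_trans _ _ 0); first by rewrite subr_le0.
  by rewrite /condprob divr_ge0// fine_ge0.
pose X := real_entries A.
have EM : entry_model (@transpose_pair n) K P X by exact: entry_model_real_entries.
have [_ [Bim hBim]] := depA.
have AE t : cmx (shift Bim 0) (X t) = A t.
  apply/matrixP => i j; rewrite !mxE mul0rn subr0 -(hBim t).
  by rewrite /X /real_entries /=; case: (A t i j) => x y; apply/eqP; rewrite eq_complex /= addr0 add0r !eqxx.
have BEE : BE = [set t | rows_bounded (shift Bim 0) [set: 'I_n]%SET [set: 'I_n]%SET (M ^+ 2 * n%:R) (X t)].
  have b0 : 0 <= M * Num.sqrt n%:R by rewrite mulr_ge0// (le_trans ler01).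
  have b2 : (M * Num.sqrt n%:R) ^+ 2 = M ^+ 2 * n%:R by rewrite exprMn sqr_sqrtr.
  have nT := @nsqr_setT R n.
  apply/seteqP; split => t.
    move=> /(opnorm_leP _ b0) h v _; rewrite nT AE -b2; exact: h.
  by move=> h; apply/(opnorm_leP _ b0) => v; rewrite b2 -nT -AE; apply: h => i; rewrite finset.inE.
pose W : set T := [set t | weak_eigenvector_event (shift Bim 0) ((eps * s) ^+ 12)
  (fun I => eps * n%:R <= #|I|%:R) (X t)].
have es0 : 0 < eps * s by rewrite mulr_gt0.
have goodE : good = ~` W.
  have equiv (v : 'cV[R[i]]_n) (I : {set 'I_n}) :
      ((eps * s) ^+ 6 * l2norm v <= l2norm (subvec v I)) = ((eps * s) ^+ 12 * nsqv v <= nsqr I v).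
    have e6 : 0 <= (eps * s) ^+ 6 * l2norm v.
      by apply: mulr_ge0 (l2norm_ge0 v); rewrite exprn_ge0// ltW.
    rewrite -(ler_sqr e6 (l2norm_ge0 (subvec v I))).
    by rewrite (exprMn _ _ (l2norm v)) !l2norm_sqr nsqr_subvec -exprM.
  apply/seteqP; split => t.
    move=> h [I [v [QI v0 hv Iv]]]; move: Iv; rewrite ltNge => /negP; apply.
    by rewrite -equiv; apply: h => //; split => //; rewrite -AE.
  move=> h v [v0 hv] I QI; rewrite equiv leNgt; apply/negP => Iv; apply: h.
  by exists I, v; split => //; rewrite AE.
have mW : measurable W.
  by apply: (measurable_preX EM); exact: measurable_weak_eigenvector_event.
have mBE : measurable BE.
  by rewrite BEE; apply: (measurable_preX EM); exact: measurable_rows_bounded.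
have [m epsm m_min] : exists2 m : nat, eps * n%:R <= m%:R &
    forall k : nat, eps * n%:R <= k%:R -> (m <= k)%N.
  have ex : exists k : nat, eps * n%:R <= k%:R.
    by exists (Num.truncn (eps * n%:R)).+1; rewrite ltW// truncnS_gt.
  by case: (ex_minnP ex) => m epsm m_min; exists m.
(* [eps > 8 / n] is strict, so the integer [m] exceeds 8. *)
have m9 : (9 <= m)%N.
  by rewrite -(ltr_nat R); apply: lt_le_trans epsm; rewrite -ltr_pdivrMr.
have s1 : s <= 1.
  apply: le_trans (ltW cs1); rewrite ler_peMl ?(ltW s0)//.
  by apply: le_trans c392; rewrite ler1n.
pose g := (eps * s) `^ 3^-1.
have g0 : 0 < g by rewrite powR_gt0.
have gE : g ^+ 3 = eps * s.
  rewrite -powR_mulrn ?powR_ge0// /g -powRrM mulVf ?powRr1 ?(ltW es0)//.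
have w_small : 392 * M ^+ 2 * g ^+ 3 <= 1.
  rewrite gE; apply: le_trans (ltW cs1); apply: ler_pM.
  - exact: mulr_ge0 (ler0n R 392) (le_trans ler01 M2).
  - exact: ltW.
  - by rewrite /c lerDr.
  - by rewrite ler_piMl ?(ltW s0)//; apply: le_trans (ltW eps2) _; rewrite invf_le1 ?ler1n.
have H := weak_event_prob EM Bim hM g0 gE eps0 s0 s1 w_small m9 epsm m_min.
rewrite -/E in H; set V := [set t | _] in H.
have VE : V = BE `&` W.
  by rewrite BEE /V /W; apply/seteqP; split => t; rewrite /weak_event /= gE.
have mV : measurable V by rewrite VE; exact: measurableI.
have mG : measurable (good `&` BE).
  by apply: measurableI => //; rewrite goodE; exact: measurableC.
have PBE : (P BE = P (good `&` BE) + P V)%E.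
  rewrite -measureU//; last first.
    by rewrite VE goodE; apply/seteqP; split => // t [[nW _] [_ /nW]].
  congr (P _); rewrite VE goodE; apply/seteqP; split => t.
    by move=> tB; have [tW|tW] := pselect (W t); [right|left].
  by move=> [[]|[]].
have fB : P BE \is a fin_num by exact: fin_num_measure.
have fG : P (good `&` BE) \is a fin_num by exact: fin_num_measure.
have fV : P V \is a fin_num by exact: fin_num_measure.
move: PBE hB H; rewrite /condprob -/BE -(fineK fB) -(fineK fG) -(fineK fV) -EFinD !lee_fin /=.
set x := fine (P (good `&` BE)); set q := fine (P V); set b := fine (P BE).
move=> [bE] b2 H; set y := _ `^ _.
have c0 : 0 <= c by exact: le_trans (ler0n R 392) c392.
have cs0 : 0 <= c * s by exact: mulr_ge0 c0 (ltW s0).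
have ECs0 : 0 <= E * null_cst K M * s.
  by apply: mulr_ge0 (ltW s0); exact: mulr_ge0 (le_trans ler01 E1) C0.
(* The prefactor is absorbed by raising it to the power [m]; then [(c * s)^m] is at most the real
   power with exponent [eps * n <= m], because [c * s < 1]. *)
have hy : 72 * E ^+ 2 * (E * null_cst K M * s) ^+ m <= y.
  apply: (@le_trans _ _ ((c * s) ^+ m)); last first.
    rewrite -(powR_mulrn _ cs0).
    rewrite /y /powR; case: eqP => [_|_].
      by rewrite !mulf_eq0 !pnatr_eq0 (gtn_eqF n0) (gtn_eqF (leq_trans _ m9)) ?(gt_eqF eps0).
    rewrite ler_expR ler_wnM2r// ln_le0// ltW//.
  have E72 : 1 <= 72 * E ^+ 2 by apply: mulr_ege1; [rewrite ler1n|exact: exprn_ege1].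
  apply: (@le_trans _ _ ((72 * E ^+ 2) ^+ m * (E * null_cst K M * s) ^+ m)).
    apply: ler_wpM2r; first exact: exprn_ge0.
    by apply: ler_eXnr => //; exact: leq_trans m9.
  rewrite -exprMn; apply: lerXn2r; rewrite ?nnegrE//.
    by apply: mulr_ge0 ECs0; exact: le_trans ler01 E72.
  have -> : 72 * E ^+ 2 * (E * null_cst K M * s) = 72 * E ^+ 3 * null_cst K M * s by ring.
  by apply: ler_wpM2r; [exact: ltW|rewrite /c lerDl; exact: mulr_ge0 (ler0n R 392) (le_trans ler01 M2)].
have y0 : 0 <= y by exact: powR_ge0.
(* The conditional probability of the bad event is [q / b <= 2 * q <= y], since [b >= 1 / 2]. *)
rewrite ler_pdivlMr; last by lra.
have hq : 2 * q <= y by apply: le_trans hy; lra.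
have hb : y * (2 * b) >= y by rewrite ler_peMr//; lra.
have -> : x = b - q by rewrite bE addrK.
by lra.
Qed.
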